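(* Consider the equation $$u''''-2u''+u-u^3=0$$ on $\mathbb{R}$, written as a first-order system in $\mathbb{R}^4$ for $(u,u',u'',u''')$, with conserved energy $$E(u,u',u'',u''')=u'u'''-\tfrac12(u'')^2-(u')^2+\tfrac12u^2-\tfrac14u^4 .$$ Let $u$ be any homoclinic solution of this equation. Then along the orbit of $u$ the stable manifold $W^s$ and the unstable manifold $W^u$ of the equilibrium $0$ intersect transversally in the zero energy set $\{E=0\}$; that is, at every point $m=(u(x),u'(x),u''(x),u'''(x))$ of the orbit, $T_mW^s+T_mW^u=T_m\{E=0\}$.
   Context: A homoclinic solution is a nontrivial solution $u$ on $\mathbb{R}$ such that $u,u',u'',u'''\to0$ as $x\to\pm\infty$. The stable (unstable) manifold of $0$ is the set of initial points in $\mathbb{R}^4$ whose solutions tend to $0$ as $x\to+\infty$ ($x\to-\infty$). *)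

(* Defs.v *)
From Stdlib Require Import Reals Lra Lia.
From Coquelicot Require Import Coquelicot.
Open Scope R_scope.

Definition R4 : NormedModule R_AbsRing :=
  prod_NormedModule R_AbsRing
    (prod_NormedModule R_AbsRing
      (prod_NormedModule R_AbsRing R_NormedModule R_NormedModule)
      R_NormedModule)
    R_NormedModule.

Definition vector_field (m : R4) : R4 :=
  let '(a, b, c, d) := m in (b, c, d, 2 * c - a + a ^ 3).

Definition energy (m : R4) : R :=
  let '(a, b, c, d) := m in
  b * d - / 2 * c ^ 2 - b ^ 2 + / 2 * a ^ 2 - / 4 * a ^ 4.

Definition zero_energy_set (m : R4) : Prop := energy m = 0.

(* Differentiability of every order up to 4 is required separately:
   [ex_derive_n u 4] alone says nothing about the lower derivatives, because
   [Derive] is total. *)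
Definition is_solution (u : R -> R) : Prop :=
  (forall (k : nat) (x : R), (k <= 4)%nat -> ex_derive_n u k x) /\
  (forall x : R, Derive_n u 4 x - 2 * Derive_n u 2 x + u x - u x ^ 3 = 0).

Definition homoclinic (u : R -> R) : Prop :=
  is_solution u /\
  (exists x : R, u x <> 0) /\
  (forall k : nat, (k <= 3)%nat ->
     is_lim (Derive_n u k) p_infty 0 /\ is_lim (Derive_n u k) m_infty 0).

Definition orbit_point (u : R -> R) (x : R) : R4 :=
  (u x, Derive_n u 1 x, Derive_n u 2 x, Derive_n u 3 x).

(* Solutions may blow up in finite time, so a solution defining a point of the
   stable (unstable) manifold is only required on the half-line x >= 0
   (x <= 0).  Asking for a two-sided derivative at 0 is no restriction: the
   values of [U] on the other side are otherwise free. *)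
Definition forward_to_0 (U : R -> R4) (m : R4) : Prop :=
  U 0 = m /\
  (forall x : R, 0 <= x -> is_derive U x (vector_field (U x))) /\
  filterlim U (Rbar_locally p_infty) (locally (zero : R4)).

Definition backward_to_0 (U : R -> R4) (m : R4) : Prop :=
  U 0 = m /\
  (forall x : R, x <= 0 -> is_derive U x (vector_field (U x))) /\
  filterlim U (Rbar_locally m_infty) (locally (zero : R4)).

Definition stable_manifold (m : R4) : Prop :=
  exists U : R -> R4, forward_to_0 U m.

Definition unstable_manifold (m : R4) : Prop :=
  exists U : R -> R4, backward_to_0 U m.

(* Velocities at [m] of the C^1 curves through [m] contained in [S]. *)
Definition tangent_space (S : R4 -> Prop) (m v : R4) : Prop :=
  exists (g dg : R -> R4) (e : R),
    0 < e /\ g 0 = m /\ dg 0 = v /\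
    (forall t : R, Rabs t < e ->
       is_derive g t (dg t) /\ continuous dg t /\ S (g t)).

(* The preimage under the time-[T] flow of the local stable manifold of size
   [delta], i.e. of the points whose forward orbit stays in the [delta]-ball
   and tends to 0. *)
Definition stable_disc (delta T : R) (m : R4) : Prop :=
  exists U : R -> R4, forward_to_0 U m /\
    forall x : R, T <= x -> norm (U x) < delta.

Definition unstable_disc (delta T : R) (m : R4) : Prop :=
  exists U : R -> R4, backward_to_0 U m /\
    forall x : R, x <= - T -> norm (U x) < delta.

(* The global stable manifold is an immersed submanifold, which may accumulate
   on itself, so its tangent space is not that of the bare subset
   [stable_manifold] of R^4.  Its manifold structure is that of the increasing
   union over [T] of the sets [stable_disc delta T], which are embedded for
   small [delta]; the structure does not depend on [delta]. *)
Definition tangent_stable (m v : R4) : Prop :=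
  forall delta : R, 0 < delta ->
    exists T : R, 0 <= T /\ tangent_space (stable_disc delta T) m v.

Definition tangent_unstable (m v : R4) : Prop :=
  forall delta : R, 0 < delta ->
    exists T : R, 0 <= T /\ tangent_space (unstable_disc delta T) m v.

Lemma locally_norm_lt (V : NormedModule R_AbsRing) (delta : R) :
  0 < delta -> locally (zero : V) (fun y : V => norm y < delta).
Proof.
intros Hd; apply (locally_le_locally_norm (zero : V)).
exists (mkposreal delta Hd); intros y Hy.
rewrite <- (minus_zero_r y); exact Hy.
Qed.

Lemma stable_manifold_union (delta : R) (m : R4) :
  0 < delta ->
  (stable_manifold m <-> exists T : R, 0 <= T /\ stable_disc delta T m).
Proof.
intros Hd; split.
- intros [U HU].
  destruct HU as [H0 [HD HL]].
  assert (HB : locally (zero : R4) (fun y : R4 => norm y < delta)).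
  { now apply locally_norm_lt. }
  destruct (HL _ HB) as [M HM].
  exists (Rmax 0 (M + 1)); split; [apply Rmax_l|].
  exists U; split; [now split|].
  intros x Hx; apply HM.
  generalize (Rmax_r 0 (M + 1)); lra.
- intros [T [_ [U [HU _]]]]; now exists U.
Qed.

Lemma unstable_manifold_union (delta : R) (m : R4) :
  0 < delta ->
  (unstable_manifold m <-> exists T : R, 0 <= T /\ unstable_disc delta T m).
Proof.
intros Hd; split.
- intros [U HU].
  destruct HU as [H0 [HD HL]].
  assert (HB : locally (zero : R4) (fun y : R4 => norm y < delta)).
  { now apply locally_norm_lt. }
  destruct (HL _ HB) as [M HM].
  exists (Rmax 0 (1 - M)); split; [apply Rmax_l|].
  exists U; split; [now split|].
  intros x Hx; apply HM.
  generalize (Rmax_r 0 (1 - M)); lra.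
- intros [T [_ [U [HU _]]]]; now exists U.
Qed.

Definition transversal_in_zero_energy_at (m : R4) : Prop :=
  stable_manifold m /\ unstable_manifold m /\ zero_energy_set m /\
  forall v : R4,
    (exists vs vu : R4,
       tangent_stable m vs /\ tangent_unstable m vu /\ v = plus vs vu) <->
    tangent_space zero_energy_set m v.

(* Main.v *)
(* Write the equation as (D^2 - 1)^2 u = u^3; its linearisation along u is
   (D^2 - 1)^2 phi = 3 u^2 phi, with a nonnegative coefficient. Hence, with
   z = phi'' - phi, the cone phi, phi' + phi, z, z' + z >= 0 is forward
   invariant, and a bounded solution can only start in it with phi' = - phi
   and z = z' = 0.

   Applied to u, the cone shows that u has no zero, say u > 0. Let x0 be a
   maximum of u, and let phi solve the linearised equation and decay at both
   ends; subtract a multiple of u' to get phi' (x0) = 0. If phi (x0) > 0, put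
   g = phi - k u with k = phi (x0) / u (x0). Then g (x0) = g' (x0) = 0,
   conservation of energy gives g'' (x0) > 0, and (D^2 - 1)^2 g - 3 u^2 g is
   2 k u^3 > 0, so that the cone excludes g at +oo or, after reflection, at
   -oo. Thus only the multiples of u' decay at both ends.

   Every solution of the linearised equation decaying at +oo is tangent to the
   stable manifold: integrated from +oo, the perturbed equation becomes a
   Volterra equation, a contraction in a weighted sup norm, whose fixed point
   is C^1 in the parameter. Besides u' there is one more such direction at each
   end; the three are independent by the previous paragraph and therefore span
   the kernel of dE, which has dimension three. *)

(* The linear part has the double exponents 1 and -1. All equations are written in the variables
   [v], [v + v'], [z], [z + z'], which split [(D^2 - 1)^2] into the first-order factors [D + 1],
   [D - 1], [D + 1], [D - 1]. Off the diagonal this system has only nonnegative entries, which is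
   why the cone is invariant, and each factor can be integrated from [+oo] on its own.

   Why a cone argument at one end suffices: where a function and its derivative vanish and [z >= 0],
   the only entry of undetermined sign is [z + z']. Time reversal turns it into [z - z'], and the
   two are not both negative. So one of the two ends always applies, and this is where decay at both
   ends enters.

   Everything at [-oo] is obtained from [+oo] by [s -> - s]. Nondegeneracy is first known at one
   critical point only and is carried to the other points by uniqueness for the linear equation.

   A tangent vector requires a whole curve inside a single [stable_disc delta T]; hence the
   perturbed solutions need a tail bound uniform in the parameter, not mere convergence to 0. *)
Require Import Defs.
From Stdlib Require Import Reals Lra Lia.
From Stdlib Require Import ClassicalEpsilon.
From Coquelicot Require Import Coquelicot.
Open Scope R_scope.

(** * Monotonicity and first-order equations *)

(** An indexed family such as [y 0%nat] is first hidden behind a function variable, so that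
    [auto_derive] treats it as an atom whose derivative is then read off the hypotheses. *)
Ltac der :=
  repeat match goal with
  | H : is_derive (?y ?n) _ _ |- _ =>
      let f := fresh "f" in set (f := y n) in *; clearbody f
  end;
  auto_derive;
  [ repeat match goal with |- _ /\ _ => split end;
    try exact I; try (eexists; eassumption); try lra
  | repeat match goal with
    | H : is_derive ?f ?s ?l |- context [Derive ?g ?s] =>
        replace (Derive g s) with l by (symmetry; apply is_derive_unique; exact H)
    end; try (field; fail); try (field; lra) ].

Lemma derivable_cont (f : R -> R) (x l : R) : is_derive f x l -> continuous f x.
Proof. intros H; apply (ex_derive_continuous f); now exists l. Qed.

Lemma nondecreasing_of_derive (f df : R -> R) (a b : R) :
  a <= b ->
  (forall s, a <= s <= b -> is_derive f s (df s)) ->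
  (forall s, a <= s <= b -> 0 <= df s) -> f a <= f b.
Proof.
intros Hab Hd Hp.
destruct (MVT_gen f a b df) as [c [Hc He]];
  rewrite ?(Rmin_left a b), ?(Rmax_right a b) in * by lra.
- intros x Hx; apply Hd; lra.
- intros x Hx; apply continuity_pt_filterlim.
  now apply (derivable_cont _ _ (df x)), Hd.
- assert (0 <= df c * (b - a)) by (apply Rmult_le_pos; [now apply Hp | lra]).
  lra.
Qed.

Lemma exp_decay_lt (K k a eps : R) :
  0 < k -> 0 < eps -> exists s, a <= s /\ K * exp (- k * s) < eps.
Proof.
intros Hk He.
(* For this [M], [exp (k * M) > k * M > Rabs K / eps]. *)
set (M := Rmax a (Rabs K / (k * eps) + 1)).
assert (Hke : 0 < k * eps) by nra.
assert (H1 : 0 <= Rabs K / (k * eps)).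
{ apply Rdiv_le_0_compat; [apply Rabs_pos | lra]. }
assert (HM : Rabs K / (k * eps) + 1 <= M) by apply Rmax_r.
exists M; split; [apply Rmax_l|].
replace (- k * M) with (- (k * M)) by ring.
rewrite exp_Ropp.
assert (HkM : k * M < exp (k * M)).
{ generalize (exp_ineq1_le (k * M)); lra. }
assert (0 < exp (k * M)) by apply exp_pos.
apply Rle_lt_trans with (Rabs K * / exp (k * M)).
- apply Rmult_le_compat_r; [left; now apply Rinv_0_lt_compat | apply Rle_abs].
- apply Rmult_lt_reg_r with (exp (k * M)); [lra|].
  rewrite Rmult_assoc, Rinv_l, Rmult_1_r by lra.
  assert (Rabs K = Rabs K / (k * eps) * (k * eps)) by (field; lra).
  nra.
Qed.

Lemma le_0_of_decay (K k a c : R) :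
  0 < k -> (forall s, a <= s -> c <= K * exp (- k * s)) -> c <= 0.
Proof.
intros Hk H; destruct (Rle_lt_dec c 0) as [|Hc]; [easy|].
destruct (exp_decay_lt K k a c Hk Hc) as [s [Hs1 Hs2]].
specialize (H s Hs1); lra.
Qed.

Lemma nondecreasing_decay_le_0 (g dg : R -> R) (K k a : R) :
  0 < k ->
  (forall s, a <= s -> is_derive g s (dg s)) ->
  (forall s, a <= s -> 0 <= dg s) ->
  (forall s, a <= s -> g s <= K * exp (- k * s)) ->
  forall s, a <= s -> g s <= 0.
Proof.
intros Hk Hd Hp Hb s Hs.
apply (le_0_of_decay K k s); [easy|]; intros s' Hs'.
apply Rle_trans with (g s'); [|apply Hb; lra].
apply (nondecreasing_of_derive g dg); [easy| |];
  intros r Hr; [apply Hd | apply Hp]; lra.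
Qed.

(** Multiplied by the integrating factor [exp (- sg * s)], [p - w] is nondecreasing, and its upper
    bound tends to 0. The comparison thus runs from [+oo], with a growth condition in place of
    initial data. *)
Lemma first_order_le (sg a k K : R) (p F w dw : R -> R) :
  0 < k ->
  (forall s, a <= s -> is_derive p s (sg * p s + F s)) ->
  (forall s, a <= s -> is_derive w s (dw s)) ->
  (forall s, a <= s -> - F s <= sg * w s - dw s) ->
  (forall s, a <= s -> exp (- sg * s) * (p s - w s) <= K * exp (- k * s)) ->
  forall s, a <= s -> p s <= w s.
Proof.
intros Hk Hp Hw HF HK s Hs.
assert (H : exp (- sg * s) * (p s - w s) <= 0).
{ apply (nondecreasing_decay_le_0 (fun s => exp (- sg * s) * (p s - w s))
    (fun s => exp (- sg * s) * (F s + (sg * w s - dw s))) K k a); auto.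
  - intros r Hr; generalize (Hp r Hr) (Hw r Hr); intros H1 H2.
    der.
  - intros r Hr; apply Rmult_le_pos; [left; apply exp_pos|].
    specialize (HF r Hr); lra. }
generalize (exp_pos (- sg * s)); nra.
Qed.

Lemma first_order_bound (sg a k K A : R) (p F w dw : R -> R) :
  0 < k ->
  (forall s, a <= s -> is_derive p s (sg * p s + F s)) ->
  (forall s, a <= s -> is_derive w s (dw s)) ->
  (forall s, a <= s -> Rabs (F s) <= A * (sg * w s - dw s)) ->
  (forall s, a <= s -> exp (- sg * s) * (Rabs (p s) - A * w s) <= K * exp (- k * s)) ->
  forall s, a <= s -> Rabs (p s) <= A * w s.
Proof.
intros Hk Hp Hw HF HK s Hs.
assert (Hw' : forall s, a <= s -> is_derive (fun s => A * w s) s (A * dw s)).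
{ intros r Hr; generalize (Hw r Hr); intros H; der. }
apply Rabs_le; split.
- assert (H : - p s <= A * w s); [|lra].
  apply (first_order_le sg a k K (fun s => - p s) (fun s => - F s)
    (fun s => A * w s) (fun s => A * dw s)); auto.
  + intros r Hr; generalize (Hp r Hr); intros H; der.
  + intros r Hr; specialize (HF r Hr); generalize (Rle_abs (F r)); lra.
  + intros r Hr; apply Rle_trans with (2 := HK r Hr).
    apply Rmult_le_compat_l; [left; apply exp_pos|].
    generalize (Rle_abs (- p r)); rewrite Rabs_Ropp; lra.
- apply (first_order_le sg a k K p F
    (fun s => A * w s) (fun s => A * dw s)); auto.
  + intros r Hr; specialize (HF r Hr); generalize (Rle_abs (- F r)).
    rewrite Rabs_Ropp; lra.
  + intros r Hr; apply Rle_trans with (2 := HK r Hr).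
    apply Rmult_le_compat_l; [left; apply exp_pos|].
    generalize (Rle_abs (p r)); lra.
Qed.

(** The primitive that vanishes at [+oo]. Its normalising constant is found without an improper
    integral: [lo] is nondecreasing, [up] is nonincreasing, and the supremum [L] of [lo] separates
    them. *)
Lemma primitive_decay (f : R -> R) (a k K : R) :
  0 < k -> (forall s, continuous f s) ->
  (forall s, a <= s -> Rabs (f s) <= K * exp (- k * s)) ->
  exists P : R -> R, (forall s, is_derive P s (f s)) /\
    forall s, a <= s -> Rabs (P s) <= K / k * exp (- k * s).
Proof.
intros Hk Hc Hb.
set (P0 := fun s => RInt f a s).
assert (HP0 : forall s, is_derive P0 s (f s)).
{ intros s; apply (is_derive_RInt f P0 a s); [|apply Hc].
  exists (mkposreal 1 Rlt_0_1); intros t _.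
  apply (RInt_correct f a t), (ex_RInt_continuous f); intros; apply Hc. }
set (lo := fun s => P0 s - K / k * exp (- k * s)).
set (up := fun s => P0 s + K / k * exp (- k * s)).
assert (HK : forall s, a <= s -> 0 <= K / k * exp (- k * s)).
{ intros s Hs; specialize (Hb s Hs).
  assert (0 <= K * exp (- k * s)) by (generalize (Rabs_pos (f s)); lra).
  replace (K / k * exp (- k * s)) with (K * exp (- k * s) / k) by (field; lra).
  now apply Rdiv_le_0_compat. }
assert (Hlo : forall s t, a <= s -> s <= t -> lo s <= lo t).
{ intros s t Hs Hst.
  apply (nondecreasing_of_derive lo (fun s => f s + K * exp (- k * s)));
    [easy| |]; intros r Hr.
  - unfold lo; generalize (HP0 r); intros H; der.
  - assert (Har : a <= r) by lra.
    specialize (Hb r Har); generalize (Rle_abs (- f r)); rewrite Rabs_Ropp; lra. }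
assert (Hup : forall s t, a <= s -> s <= t -> up t <= up s).
{ intros s t Hs Hst.
  assert (H : - up s <= - up t); [|lra].
  apply (nondecreasing_of_derive (fun s => - up s) (fun s => - f s + K * exp (- k * s)));
    [easy| |]; intros r Hr.
  - unfold up; generalize (HP0 r); intros H; der.
  - assert (Har : a <= r) by lra.
    specialize (Hb r Har); generalize (Rle_abs (f r)); lra. }
assert (Hlu : forall s t, a <= s -> a <= t -> lo s <= up t).
{ intros s t Hs Ht.
  assert (H1 : lo s <= lo (Rmax s t)) by (apply Hlo; [easy|apply Rmax_l]).
  assert (H2 : up (Rmax s t) <= up t) by (apply Hup; [easy|apply Rmax_r]).
  assert (H3 : a <= Rmax s t) by (apply Rle_trans with s; [easy|apply Rmax_l]).
  generalize (HK _ H3); unfold lo, up in *; lra. }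
destruct (completeness (fun y => exists s, a <= s /\ y = lo s)) as [L [HL1 HL2]].
- exists (up a); intros y [s [Hs ->]]; apply Hlu; lra.
- exists (lo a), a; split; [lra|easy].
- exists (fun s => P0 s - L); split.
  + intros s; generalize (HP0 s); intros H; der.
  + intros s Hs.
    assert (H1 : lo s <= L) by (apply HL1; now exists s).
    assert (H2 : L <= up s).
    { apply HL2; intros y [t [Ht ->]]; now apply Hlu. }
    unfold lo, up in *; apply Rabs_le; lra.
Qed.

Lemma gronwall_zero (N dN : R -> R) (a b K : R) :
  a <= b ->
  (forall s, a <= s <= b -> is_derive N s (dN s)) ->
  (forall s, a <= s <= b -> dN s <= K * N s) ->
  N a <= 0 -> N b <= 0.
Proof.
intros Hab Hd HK Ha.
assert (H : - (exp (- K * a) * N a) <= - (exp (- K * b) * N b)).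
{ apply (nondecreasing_of_derive (fun s => - (exp (- K * s) * N s))
    (fun s => exp (- K * s) * (K * N s - dN s))); [easy| |]; intros s Hs.
  - generalize (Hd s Hs); intros H; der.
  - apply Rmult_le_pos; [left; apply exp_pos|].
    specialize (HK s Hs); lra. }
generalize (exp_pos (- K * a)) (exp_pos (- K * b)); nra.
Qed.

(** * The invariant cone *)

(** A quadratic remainder is what is available in two places: for the squared negative part, and for
    the perturbed solutions as functions of the parameter. *)
Lemma is_derive_of_quadratic (f : R -> R) (t l e C : R) :
  0 < e ->
  (forall h, Rabs h < e -> Rabs (f (t + h) - f t - h * l) <= C * h ^ 2) ->
  is_derive f t l.
Proof.
intros He H; apply is_derive_Reals; intros eps Heps.
assert (HC : 0 < Rabs C + 1) by (generalize (Rabs_pos C); lra).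
assert (Hd : 0 < Rmin e (eps / (Rabs C + 1))).
{ apply Rmin_glb_lt; [easy|]; now apply Rdiv_lt_0_compat. }
exists (mkposreal _ Hd); intros h Hh0 Hh; simpl in Hh.
assert (H1 : Rabs h < e) by (apply Rlt_le_trans with (1 := Hh), Rmin_l).
assert (H2 : Rabs h < eps / (Rabs C + 1)) by (apply Rlt_le_trans with (1 := Hh), Rmin_r).
specialize (H h H1).
replace ((f (t + h) - f t) / h - l) with ((f (t + h) - f t - h * l) / h) by (field; easy).
unfold Rdiv; rewrite Rabs_mult, Rabs_inv.
assert (Hp : 0 < Rabs h) by now apply Rabs_pos_lt.
apply Rmult_lt_reg_r with (Rabs h); [easy|].
rewrite Rmult_assoc, Rinv_l, Rmult_1_r by lra.
apply Rle_lt_trans with (1 := H).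
rewrite <- (pow2_abs h).
assert (H3 : Rabs h * (Rabs C + 1) < eps).
{ apply Rmult_lt_reg_r with (/ (Rabs C + 1)); [now apply Rinv_0_lt_compat|].
  rewrite Rmult_assoc, Rinv_r, Rmult_1_r by lra; exact H2. }
generalize (Rle_abs C); intros H4.
assert (C * Rabs h ^ 2 <= Rabs C * Rabs h * Rabs h) by (simpl; nra).
assert (0 <= Rabs C) by apply Rabs_pos.
nra.
Qed.

(** The square makes the negative part differentiable even at 0, so that Gronwall's inequality can
    measure the violation of a sign condition. *)
Lemma is_derive_neg_sq (x : R) :
  is_derive (fun x => Rmin x 0 ^ 2) x (2 * Rmin x 0).
Proof.
apply (is_derive_of_quadratic _ _ _ 1 1); [lra|]; intros h _.
unfold Rmin; destruct (Rle_dec (x + h) 0), (Rle_dec x 0);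
  apply Rabs_le; split; nra.
Qed.

(* The iterated factors of v'''' - 2 v'' + v = F: with y 0 = v one has
   y 1 = v + v', y 2 = v'' - v and y 3 = y 2 + (y 2)'. *)
Definition chain_at (y : nat -> R -> R) (F s : R) : Prop :=
  is_derive (y 0%nat) s (y 1%nat s - y 0%nat s) /\
  is_derive (y 1%nat) s (y 1%nat s + y 2%nat s) /\
  is_derive (y 2%nat) s (y 3%nat s - y 2%nat s) /\
  is_derive (y 3%nat) s (y 3%nat s + F).

Definition lincomb (a b : R) (y z : nat -> R -> R) (i : nat) (s : R) : R :=
  a * y i s + b * z i s.

Lemma chain_lincomb (a b : R) (y z : nat -> R -> R) (F G s : R) :
  chain_at y F s -> chain_at z G s ->
  chain_at (lincomb a b y z) (a * F + b * G) s.
Proof.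
intros [H0 [H1 [H2 H3]]] [K0 [K1 [K2 K3]]]; unfold lincomb.
split; [|split; [|split]]; der.
Qed.

Lemma chain_ext (y : nat -> R -> R) (F G s : R) :
  F = G -> chain_at y F s -> chain_at y G s.
Proof. now intros ->. Qed.

Lemma chain_continuous (y : nat -> R -> R) (F s : R) (i : nat) :
  chain_at y F s -> (i < 4)%nat -> continuous (y i) s.
Proof.
intros [H0 [H1 [H2 H3]]] Hi.
destruct i as [|[|[|[|i]]]]; [eapply derivable_cont; eassumption .. | lia].
Qed.

(** The chain of [v (- s)]: its derivative has the opposite sign, so [v + v'] becomes
    [v - v' = 2 v - (v + v')], and likewise for [z]. *)
Definition reflect (y : nat -> R -> R) (i : nat) (s : R) : R :=
  match i with
  | 0%nat => y 0%nat (- s)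
  | 1%nat => 2 * y 0%nat (- s) - y 1%nat (- s)
  | 2%nat => y 2%nat (- s)
  | _ => 2 * y 2%nat (- s) - y 3%nat (- s)
  end.

Lemma is_derive_opp_arg (f : R -> R) (s l : R) :
  is_derive f (- s) l -> is_derive (fun s => f (- s)) s (- l).
Proof. intros H; der. Qed.

Lemma chain_reflect (y : nat -> R -> R) (F s : R) :
  chain_at y F (- s) -> chain_at (reflect y) F s.
Proof.
intros [H0 [H1 [H2 H3]]].
apply is_derive_opp_arg in H0; apply is_derive_opp_arg in H1.
apply is_derive_opp_arg in H2; apply is_derive_opp_arg in H3.
set (z0 := fun s => y 0%nat (- s)) in *; set (z1 := fun s => y 1%nat (- s)) in *.
set (z2 := fun s => y 2%nat (- s)) in *; set (z3 := fun s => y 3%nat (- s)) in *.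
change (y 0%nat (- s)) with (z0 s) in *; change (y 1%nat (- s)) with (z1 s) in *.
change (y 2%nat (- s)) with (z2 s) in *; change (y 3%nat (- s)) with (z3 s) in *.
split; [|split; [|split]]; unfold reflect.
- change (is_derive z0 s (2 * z0 s - z1 s - z0 s)).
  replace (2 * z0 s - z1 s - z0 s) with (- (z1 s - z0 s)) by ring; exact H0.
- change (is_derive (fun s => 2 * z0 s - z1 s) s (2 * z0 s - z1 s + z2 s)); der.
- change (is_derive z2 s (2 * z2 s - z3 s - z2 s)).
  replace (2 * z2 s - z3 s - z2 s) with (- (z3 s - z2 s)) by ring; exact H2.
- change (is_derive (fun s => 2 * z2 s - z3 s) s (2 * z2 s - z3 s + F)); der.
Qed.

(** A positive value of [f] would grow at least like [exp s], against the upper bound. *)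
Lemma growth_unbounded (f df : R -> R) (a K : R) :
  (forall s, a <= s -> is_derive f s (df s)) ->
  (forall s, a <= s -> f s <= df s) ->
  (forall s, a <= s -> f s <= K) ->
  forall s, a <= s -> f s <= 0.
Proof.
intros Hd Hg HK s Hs.
assert (H : exp (- 1 * s) * f s <= 0).
{ apply (nondecreasing_decay_le_0 (fun s => exp (- 1 * s) * f s)
    (fun s => exp (- 1 * s) * (df s - f s)) K 1 a); auto; [lra| | |]; intros r Hr.
  - generalize (Hd r Hr); intros H; der.
  - apply Rmult_le_pos; [left; apply exp_pos|]; specialize (Hg r Hr); lra.
  - generalize (exp_pos (- (1) * r)) (HK r Hr).
    replace (- (1) * r) with (- 1 * r) by ring; nra. }
generalize (exp_pos (- 1 * s)); nra.
Qed.

(** Different entries of the system are coupled with nonnegative coefficients only, so the sum of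
    the squared negative parts obeys a linear differential inequality and stays 0 once it is 0. *)
Lemma chain_nonneg (y : nat -> R -> R) (c h : R -> R) (a B : R) :
  (forall s, a <= s -> chain_at y (c s * y 0%nat s + h s) s) ->
  (forall s, a <= s -> 0 <= c s <= B) ->
  (forall s, a <= s -> 0 <= h s) ->
  (forall i, (i < 4)%nat -> 0 <= y i a) ->
  forall i s, (i < 4)%nat -> a <= s -> 0 <= y i s.
Proof.
intros Hy Hc Hh Ha.
set (n := fun i s => Rmin (y i s) 0).
assert (Hn : forall s, a <= s -> n 0%nat s ^ 2 + n 1%nat s ^ 2 + n 2%nat s ^ 2 + n 3%nat s ^ 2 <= 0).
{ intros s Hs.
  apply (gronwall_zero
    (fun s => Rmin (y 0%nat s) 0 ^ 2 + Rmin (y 1%nat s) 0 ^ 2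
              + Rmin (y 2%nat s) 0 ^ 2 + Rmin (y 3%nat s) 0 ^ 2)
    (fun s => (y 1%nat s - y 0%nat s) * (2 * n 0%nat s)
      + (y 1%nat s + y 2%nat s) * (2 * n 1%nat s)
      + (y 3%nat s - y 2%nat s) * (2 * n 2%nat s)
      + (y 3%nat s + (c s * y 0%nat s + h s)) * (2 * n 3%nat s)) a s (4 + B)); [easy| | |].
  - intros r [Hr _]; destruct (Hy r Hr) as [H0 [H1 [H2 H3]]].
    apply (is_derive_plus (V := R_NormedModule)
      (fun s => Rmin (y 0%nat s) 0 ^ 2 + Rmin (y 1%nat s) 0 ^ 2 + Rmin (y 2%nat s) 0 ^ 2)
      (fun s => Rmin (y 3%nat s) 0 ^ 2));
    [apply (is_derive_plus (V := R_NormedModule)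
      (fun s => Rmin (y 0%nat s) 0 ^ 2 + Rmin (y 1%nat s) 0 ^ 2)
      (fun s => Rmin (y 2%nat s) 0 ^ 2));
    [apply (is_derive_plus (V := R_NormedModule)
      (fun s => Rmin (y 0%nat s) 0 ^ 2)
      (fun s => Rmin (y 1%nat s) 0 ^ 2))|]|];
    apply (is_derive_comp (V := R_NormedModule) (fun x => Rmin x 0 ^ 2));
      (apply is_derive_neg_sq || assumption).
  - intros r [Hr _]; unfold n; specialize (Hc r Hr); specialize (Hh r Hr).
    revert Hc Hh; generalize (c r) (h r) (y 0%nat r) (y 1%nat r) (y 2%nat r) (y 3%nat r).
    clear; intros c h y0 y1 y2 y3 Hc Hh.
    assert (HR : forall x, Rmin x 0 <= 0 /\ Rmin x 0 <= x /\ x * Rmin x 0 = Rmin x 0 ^ 2).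
    { intros x; unfold Rmin; destruct (Rle_dec x 0); repeat split; nra. }
    destruct (HR y0) as [A0 [B0 C0]]; destruct (HR y1) as [A1 [B1 C1]].
    destruct (HR y2) as [A2 [B2 C2]]; destruct (HR y3) as [A3 [B3 C3]].
    set (n0 := Rmin y0 0) in *; set (n1 := Rmin y1 0) in *.
    set (n2 := Rmin y2 0) in *; set (n3 := Rmin y3 0) in *.
    (* Off the diagonal each [y] may be replaced by its negative part: the other factor is
       nonpositive and the negative part lies below [y]. *)
    assert (D0 : y1 * n0 <= n1 * n0) by nra.
    assert (D1 : y2 * n1 <= n2 * n1) by nra.
    assert (D2 : y3 * n2 <= n3 * n2) by nra.
    assert (D3 : y0 * n3 <= n0 * n3) by nra.
    assert (D4 : h * n3 <= 0) by nra.
    assert (D5 : c * (y0 * n3) <= c * (n0 * n3)) by (apply Rmult_le_compat_l; lra).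
    assert (D6 : 2 * (n0 * n3) <= n0 ^ 2 + n3 ^ 2) by (generalize (pow2_ge_0 (n0 - n3)); lra).
    assert (D7 : c * (2 * (n0 * n3)) <= B * (n0 ^ 2 + n3 ^ 2)).
    { apply Rle_trans with (c * (n0 ^ 2 + n3 ^ 2)).
      - apply Rmult_le_compat_l; lra.
      - apply Rmult_le_compat_r; [generalize (pow2_ge_0 n0) (pow2_ge_0 n3)|]; lra. }
    assert (D8 : 0 <= B * (n1 ^ 2 + n2 ^ 2)).
    { apply Rmult_le_pos; [lra|].
      generalize (pow2_ge_0 n1) (pow2_ge_0 n2); lra. }
    generalize (pow2_ge_0 (n0 - n1)) (pow2_ge_0 (n1 - n2)) (pow2_ge_0 (n2 - n3))
      (pow2_ge_0 n0) (pow2_ge_0 n1) (pow2_ge_0 n2) (pow2_ge_0 n3).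
    lra.
  - rewrite !(Rmin_right _ 0) by (apply Ha; lia); lra. }
intros i s Hi Hs; specialize (Hn s Hs).
assert (Hni : n i s = 0).
{ destruct i as [|[|[|[|i]]]]; [nra ..| lia]. }
unfold n in Hni; rewrite <- Hni; apply Rmin_l.
Qed.

(** Inside the cone entries 1 and 3 satisfy [f' >= f], so boundedness makes them vanish on the whole
    half-line; entry 2 feeds entry 1 and must then vanish at [a] as well. *)
Lemma chain_cone (y : nat -> R -> R) (c h : R -> R) (a B K : R) :
  (forall s, a <= s -> chain_at y (c s * y 0%nat s + h s) s) ->
  (forall s, a <= s -> 0 <= c s <= B) ->
  (forall s, a <= s -> 0 <= h s) ->
  (forall i s, (i < 4)%nat -> a <= s -> Rabs (y i s) <= K) ->
  (forall i, (i < 4)%nat -> 0 <= y i a) ->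
  y 1%nat a = 0 /\ y 2%nat a = 0 /\ y 3%nat a = 0.
Proof.
intros Hy Hc Hh HK Ha.
generalize (chain_nonneg y c h a B Hy Hc Hh Ha); intros Hp.
assert (HK' : forall i s, (i < 4)%nat -> a <= s -> y i s <= K).
{ intros i s Hi Hs; apply Rle_trans with (1 := Rle_abs _); auto. }
assert (H3 : forall s, a <= s -> y 3%nat s <= 0).
{ apply (growth_unbounded _ (fun s => y 3%nat s + (c s * y 0%nat s + h s)) a K); auto.
  - intros s Hs; apply Hy; lra.
  - intros s Hs; specialize (Hh s Hs); destruct (Hc s Hs) as [Hc1 _].
    assert (0 <= y 0%nat s) by (apply Hp; [lia|lra]).
    assert (0 <= c s * y 0%nat s) by now apply Rmult_le_pos.
    lra. }
assert (H1 : forall s, a <= s -> y 1%nat s <= 0).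
{ apply (growth_unbounded _ (fun s => y 1%nat s + y 2%nat s) a K); auto.
  - intros s Hs; now apply Hy.
  - intros s Hs; assert (0 <= y 2%nat s) by (apply Hp; [lia|lra]); lra. }
assert (P1 := Ha 1%nat ltac:(lia)); assert (P2 := Ha 2%nat ltac:(lia)).
assert (P3 := Ha 3%nat ltac:(lia)).
assert (Q1 := H1 a (Rle_refl a)); assert (Q3 := H3 a (Rle_refl a)).
split; [lra|split; [|lra]].
destruct (Rle_lt_dec (y 2%nat a) 0) as [|Hpos]; [lra|exfalso].
assert (H2 : forall s, a <= s -> exp a * y 2%nat a <= exp s * y 2%nat s).
{ intros s Hs.
  apply (nondecreasing_of_derive (fun s => exp s * y 2%nat s)
    (fun s => exp s * y 3%nat s)); [easy| |]; intros r [Hr _].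
  - destruct (Hy r Hr) as [_ [_ [K2 _]]]; der.
  - apply Rmult_le_pos; [left; apply exp_pos | apply Hp; [lia|lra]]. }
(* A lower bound of entry 2 on [[a, a + 1]], because [exp s * y 2 s] is nondecreasing; entry 1 would
   reach at least [m] at [a + 1]. *)
set (m := exp a * y 2%nat a / exp (a + 1)) in *.
assert (Hm : 0 < m).
{ apply Rdiv_lt_0_compat; [|apply exp_pos].
  apply Rmult_lt_0_compat; [apply exp_pos|easy]. }
assert (H : y 1%nat a - m * a <= y 1%nat (a + 1) - m * (a + 1)).
{ apply (nondecreasing_of_derive (fun s => y 1%nat s - m * s)
    (fun s => y 1%nat s + y 2%nat s - m)); [lra| |]; intros r [Hr Hr'].
  - destruct (Hy r Hr) as [_ [K1 _]]; der.
  - assert (0 <= y 1%nat r) by (apply Hp; [lia|lra]).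
    assert (m <= y 2%nat r); [|lra].
    assert (0 <= y 2%nat r) by (apply Hp; [lia|lra]).
    unfold m; apply Rle_div_l; [apply exp_pos|].
    apply Rle_trans with (1 := H2 r Hr).
    rewrite Rmult_comm; apply Rmult_le_compat_l; [easy|].
    destruct Hr' as [Hr'|Hr']; [left; now apply exp_increasing|rewrite Hr'; lra]. }
assert (y 1%nat (a + 1) <= 0) by (apply H1; lra).
lra.
Qed.

Lemma gronwall_zero_two_sided (N dN : R -> R) (a b x K : R) :
  a <= x <= b ->
  (forall s, a <= s <= b -> is_derive N s (dN s)) ->
  (forall s, a <= s <= b -> Rabs (dN s) <= K * N s) ->
  N x <= 0 -> forall s, a <= s <= b -> N s <= 0.
Proof.
intros Hx Hd HK H0 s Hs.
destruct (Rle_lt_dec x s) as [Hxs|Hsx].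
- apply (gronwall_zero N dN x s K); auto; intros r Hr; [apply Hd; lra|].
  assert (Hr' : a <= r <= b) by lra.
  generalize (HK r Hr') (Rle_abs (dN r)); lra.
- rewrite <- (Ropp_involutive s).
  apply (gronwall_zero (fun s => N (- s)) (fun s => - dN (- s)) (- x) (- s) K);
    [lra| | |now rewrite Ropp_involutive]; intros r Hr.
  + apply is_derive_opp_arg, Hd; lra.
  + assert (Hr' : a <= - r <= b) by lra.
    generalize (HK _ Hr') (Rle_abs (- dN (- r))); rewrite Rabs_Ropp; lra.
Qed.

(** Uniqueness in both time directions for the linear equation with bounded coefficient, by
    Gronwall's inequality for the sum of squares. *)
Lemma chain_zero (y : nat -> R -> R) (c : R -> R) (a b x B : R) :
  a <= x <= b ->
  (forall s, a <= s <= b -> chain_at y (c s * y 0%nat s) s) ->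
  (forall s, a <= s <= b -> 0 <= c s <= B) ->
  (forall i, (i < 4)%nat -> y i x = 0) ->
  forall i s, (i < 4)%nat -> a <= s <= b -> y i s = 0.
Proof.
intros Hx Hy Hc H0.
assert (HN : forall s, a <= s <= b ->
  y 0%nat s ^ 2 + y 1%nat s ^ 2 + y 2%nat s ^ 2 + y 3%nat s ^ 2 <= 0).
{ apply (gronwall_zero_two_sided
    (fun s => y 0%nat s ^ 2 + y 1%nat s ^ 2 + y 2%nat s ^ 2 + y 3%nat s ^ 2)
    (fun s => 2 * (y 0%nat s * (y 1%nat s - y 0%nat s) + y 1%nat s * (y 1%nat s + y 2%nat s)
      + y 2%nat s * (y 3%nat s - y 2%nat s)
      + y 3%nat s * (y 3%nat s + c s * y 0%nat s))) a b x (6 + B)); auto.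
  - intros s Hs; destruct (Hy s Hs) as [H1 [H2 [H3 H4]]]; der.
  - intros s Hs; specialize (Hc s Hs); revert Hc.
    generalize (c s) (y 0%nat s) (y 1%nat s) (y 2%nat s) (y 3%nat s).
    clear; intros c y0 y1 y2 y3 Hc.
    assert (D6 : Rabs (2 * (y0 * y3)) <= y0 ^ 2 + y3 ^ 2).
    { generalize (pow2_ge_0 (y0 - y3)) (pow2_ge_0 (y0 + y3)); intros; apply Rabs_le; lra. }
    assert (D7 : Rabs (c * (2 * (y0 * y3))) <= B * (y0 ^ 2 + y3 ^ 2)).
    { rewrite Rabs_mult, (Rabs_pos_eq c) by lra.
      apply Rmult_le_compat; try lra; apply Rabs_pos. }
    assert (D8 : 0 <= B * (y1 ^ 2 + y2 ^ 2)).
    { apply Rmult_le_pos; [lra|]; generalize (pow2_ge_0 y1) (pow2_ge_0 y2); lra. }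
    apply Rabs_le_between in D7.
    generalize (pow2_ge_0 (y0 - y1)) (pow2_ge_0 (y1 - y2)) (pow2_ge_0 (y2 - y3))
      (pow2_ge_0 (y0 + y1)) (pow2_ge_0 (y1 + y2)) (pow2_ge_0 (y2 + y3))
      (pow2_ge_0 y0) (pow2_ge_0 y1) (pow2_ge_0 y2) (pow2_ge_0 y3).
    intros; apply Rabs_le; split; lra.
  - rewrite !H0 by lia; lra. }
intros i s Hi Hs; specialize (HN s Hs).
destruct i as [|[|[|[|i]]]]; [nra ..|lia].
Qed.

(** * Exponential decay *)

(** The exponent 2/3 is a compromise. Being below 1, it leaves room for [s * exp (- s)]; its double
    4/3 exceeds 1, so squares are dominated by [exp (- s)]; its triple is 2, so cubic terms decay
    faster than every nonzero decaying solution of the linear part. *)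
Definition rate (s : R) : R := exp (- (2 / 3) * s).

Lemma rate_pos (s : R) : 0 < rate s.
Proof. apply exp_pos. Qed.

Lemma rate_le (a s : R) : a <= s -> rate s <= rate a.
Proof.
unfold rate; intros [H| ->]; [left; apply exp_increasing; lra | lra].
Qed.

Lemma rate_plus (a s : R) : rate (a + s) = rate a * rate s.
Proof. unfold rate; rewrite <- exp_plus; f_equal; ring. Qed.

Definition decays (a : R) (f : R -> R) : Prop :=
  exists C, forall s, a <= s -> Rabs (f s) <= C * rate s.

Lemma decays_nonneg (a : R) (f : R -> R) :
  decays a f -> exists C, 0 <= C /\ forall s, a <= s -> Rabs (f s) <= C * rate s.
Proof.
intros [C HC]; exists C; split; [|easy].
specialize (HC a (Rle_refl a)); generalize (Rabs_pos (f a)) (rate_pos a); nra.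
Qed.

Lemma decays_lincomb (a c d : R) (f g : R -> R) :
  decays a f -> decays a g -> decays a (fun s => c * f s + d * g s).
Proof.
intros [C HC] [D HD]; exists (Rabs c * C + Rabs d * D); intros s Hs.
specialize (HC s Hs); specialize (HD s Hs).
apply Rle_trans with (1 := Rabs_triang _ _); rewrite !Rabs_mult.
generalize (Rabs_pos c) (Rabs_pos d); nra.
Qed.

Lemma decays_ext (a : R) (f g : R -> R) :
  (forall s, a <= s -> f s = g s) -> decays a f -> decays a g.
Proof. intros H [C HC]; exists C; intros s Hs; rewrite <- H by easy; auto. Qed.

Lemma decays_plus (a : R) (f g : R -> R) :
  decays a f -> decays a g -> decays a (fun s => f s + g s).
Proof.
intros Hf Hg; apply decays_ext with (fun s => 1 * f s + 1 * g s);
  [intros; ring | now apply decays_lincomb].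
Qed.

Lemma decays_minus (a : R) (f g : R -> R) :
  decays a f -> decays a g -> decays a (fun s => f s - g s).
Proof.
intros Hf Hg; apply decays_ext with (fun s => 1 * f s + (- 1) * g s);
  [intros; ring | now apply decays_lincomb].
Qed.

Lemma decays_scal (a c : R) (f : R -> R) :
  decays a f -> decays a (fun s => c * f s).
Proof.
intros Hf; apply decays_ext with (fun s => c * f s + 0 * f s);
  [intros; ring | now apply decays_lincomb].
Qed.

Lemma decays_mult (a : R) (f g : R -> R) :
  decays a f -> decays a g -> decays a (fun s => f s * g s).
Proof.
intros Hf Hg; destruct (decays_nonneg _ _ Hf) as [C [HC0 HC]].
destruct (decays_nonneg _ _ Hg) as [D [HD0 HD]].
exists (C * D * rate a); intros s Hs; rewrite Rabs_mult.
specialize (HC s Hs); specialize (HD s Hs).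
generalize (rate_pos s) (rate_le a s Hs); intros Hr Hra.
apply Rle_trans with ((C * rate s) * (D * rate s)).
- apply Rmult_le_compat; try easy; apply Rabs_pos.
- replace (C * rate s * (D * rate s)) with (C * D * rate s * rate s) by ring.
  apply Rmult_le_compat_r; [lra|].
  apply Rmult_le_compat_l; [now apply Rmult_le_pos|easy].
Qed.

Lemma decays_pow (a : R) (f : R -> R) (n : nat) :
  decays a f -> decays a (fun s => f s ^ S n).
Proof.
intros Hf; induction n as [|n IH].
- apply decays_ext with f; [intros; simpl; ring | easy].
- apply (decays_mult a f (fun s => f s ^ S n)); easy.
Qed.

Lemma decays_le (a b : R) (f : R -> R) : a <= b -> decays a f -> decays b f.
Proof. intros H [C HC]; exists C; intros s Hs; apply HC; lra. Qed.

Lemma decays_bounded (a : R) (f : R -> R) :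
  decays a f -> exists K, forall s, a <= s -> Rabs (f s) <= K.
Proof.
intros Hf; destruct (decays_nonneg _ _ Hf) as [C [HC0 HC]].
exists (C * rate a); intros s Hs; apply Rle_trans with (1 := HC s Hs).
apply Rmult_le_compat_l; [easy | now apply rate_le].
Qed.

Ltac decay :=
  repeat first [ assumption | apply decays_minus | apply decays_plus | apply decays_scal
               | apply decays_pow | apply decays_mult ].

Lemma constant_decays_0 (a : R) (f : R -> R) :
  (forall s, a <= s -> is_derive f s 0) -> decays a f ->
  forall s, a <= s -> f s = 0.
Proof.
intros Hd [C HC] s Hs.
apply Rle_antisym.
- apply (nondecreasing_decay_le_0 f (fun _ => 0) C (2 / 3) a); try easy; try lra; intros r Hr.
  apply Rle_trans with (1 := Rle_abs _); now apply HC.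
- assert (H : - f s <= 0); [|lra].
  apply (nondecreasing_decay_le_0 (fun s => - f s) (fun _ => 0) C (2 / 3) a); try easy; try lra;
    intros r Hr.
  + generalize (Hd r Hr); intros H; der.
  + apply Rle_trans with (1 := Rle_abs _); rewrite Rabs_Ropp; now apply HC.
Qed.

Definition chain_decays (a : R) (y : nat -> R -> R) : Prop :=
  forall i, (i < 4)%nat -> decays a (y i).

Lemma chain_decays_bound (a : R) (y : nat -> R -> R) :
  chain_decays a y ->
  exists C, 0 <= C /\ forall i s, (i < 4)%nat -> a <= s -> Rabs (y i s) <= C * rate s.
Proof.
intros H.
destruct (decays_nonneg _ _ (H 0%nat ltac:(lia))) as [C0 [P0 H0]].
destruct (decays_nonneg _ _ (H 1%nat ltac:(lia))) as [C1 [P1 H1]].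
destruct (decays_nonneg _ _ (H 2%nat ltac:(lia))) as [C2 [P2 H2]].
destruct (decays_nonneg _ _ (H 3%nat ltac:(lia))) as [C3 [P3 H3]].
exists (C0 + C1 + C2 + C3); split; [lra|]; intros i s Hi Hs.
generalize (rate_pos s); intros Hr.
destruct i as [|[|[|[|i]]]]; [| | | |lia].
- apply Rle_trans with (1 := H0 s Hs); apply Rmult_le_compat_r; lra.
- apply Rle_trans with (1 := H1 s Hs); apply Rmult_le_compat_r; lra.
- apply Rle_trans with (1 := H2 s Hs); apply Rmult_le_compat_r; lra.
- apply Rle_trans with (1 := H3 s Hs); apply Rmult_le_compat_r; lra.
Qed.

Lemma chain_decays_bounded (a : R) (y : nat -> R -> R) :
  chain_decays a y ->
  exists K, forall i s, (i < 4)%nat -> a <= s -> Rabs (y i s) <= K.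
Proof.
intros H; destruct (chain_decays_bound a y H) as [C [HC0 HC]].
exists (C * rate a); intros i s Hi Hs; apply Rle_trans with (1 := HC i s Hi Hs).
apply Rmult_le_compat_l; [easy | now apply rate_le].
Qed.

Lemma chain_decays_lincomb (a c d : R) (y z : nat -> R -> R) :
  chain_decays a y -> chain_decays a z -> chain_decays a (lincomb c d y z).
Proof. intros Hy Hz i Hi; apply decays_lincomb; auto. Qed.

(** Factor [D^2 - k^2] as [(D - k) (D + k)]: boundedness at [+oo] forces [f' + k f <= 0], hence
    [exp (k * s) * f s] is nonincreasing. *)
Lemma decays_of_convex (f df ddf : R -> R) (a k K : R) :
  0 < k ->
  (forall s, a <= s -> is_derive f s (df s)) ->
  (forall s, a <= s -> is_derive df s (ddf s)) ->
  (forall s, a <= s -> k ^ 2 * f s <= ddf s) ->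
  (forall s, a <= s -> Rabs (f s) <= K /\ Rabs (df s) <= K) ->
  forall s, a <= s -> f s <= exp (k * a) * f a * exp (- k * s).
Proof.
intros Hk H1 H2 H3 H4.
assert (H : forall s, a <= s -> exp (- k * s) * (df s + k * f s) <= 0).
{ apply (nondecreasing_decay_le_0 (fun s => exp (- k * s) * (df s + k * f s))
    (fun s => exp (- k * s) * (ddf s - k ^ 2 * f s)) (K + k * K) k a); auto; intros s Hs.
  - generalize (H1 s Hs) (H2 s Hs); intros E1 E2; der.
  - apply Rmult_le_pos; [left; apply exp_pos|]; specialize (H3 s Hs); lra.
  - rewrite Rmult_comm; apply Rmult_le_compat_r; [left; apply exp_pos|].
    destruct (H4 s Hs) as [A B].
    generalize (Rle_abs (f s)) (Rle_abs (df s)); nra. }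
intros s Hs.
assert (HH : - (exp (k * a) * f a) <= - (exp (k * s) * f s)).
{ apply (nondecreasing_of_derive (fun s => - (exp (k * s) * f s))
    (fun s => - (exp (k * s) * (df s + k * f s)))); [easy| |]; intros r [Hr _].
  - generalize (H1 r Hr); intros E1; der.
  - specialize (H r Hr).
    assert (df r + k * f r <= 0) by (generalize (exp_pos (- k * r)); nra).
    generalize (exp_pos (k * r)); nra. }
replace (f s) with (exp (k * s) * f s * exp (- k * s)).
- apply Rmult_le_compat_r; [left; apply exp_pos|lra].
- replace (- k * s) with (- (k * s)) by ring; rewrite exp_Ropp.
  field; apply Rgt_not_eq, exp_pos.
Qed.

Lemma decays_extend (a b : R) (f : R -> R) :
  (forall s, a <= s -> continuous f s) -> decays b f -> decays a f.
Proof.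
intros Hc Hf; destruct (decays_nonneg _ _ Hf) as [C [HC0 HC]].
destruct (bounded_continuity (V := R_NormedModule) f a b) as [M HM].
{ intros s Hs; apply Hc; lra. }
assert (Hb := rate_pos b).
exists (C + Rabs M / rate b); intros s Hs.
assert (H0 : 0 <= Rabs M / rate b) by (apply Rdiv_le_0_compat; [apply Rabs_pos | easy]).
generalize (rate_pos s); intros Hr.
destruct (Rle_lt_dec b s) as [Hbs|Hsb].
- apply Rle_trans with (1 := HC s Hbs); nra.
- assert (HsM : Rabs (f s) < M) by (apply HM; lra).
  assert (Hbs : rate b <= rate s) by (apply rate_le; lra).
  assert (Rabs M = Rabs M / rate b * rate b) by (field; lra).
  generalize (Rle_abs M); nra.
Qed.

Lemma decays_of_square (a D : R) (f : R -> R) :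
  (forall s, a <= s -> f s ^ 2 <= D * rate s ^ 2) -> decays a f.
Proof.
intros H; exists (sqrt (Rabs D)); intros s Hs.
apply Rsqr_incr_0_var.
- rewrite <- Rsqr_abs; rewrite Rsqr_mult, Rsqr_sqrt by apply Rabs_pos.
  specialize (H s Hs); unfold Rsqr.
  generalize (Rle_abs D) (pow2_ge_0 (rate s)); nra.
- apply Rmult_le_pos; [apply sqrt_pos | left; apply rate_pos].
Qed.

(** For a bounded solution, [C * rate] is a barrier from infinity, because
    [rate - rate' = 5/3 rate >= rate]. *)
Lemma decays_of_growing_ode (a : R) (p F : R -> R) (K : R) :
  (forall s, a <= s -> is_derive p s (p s + F s)) ->
  (forall s, a <= s -> Rabs (p s) <= K) ->
  decays a F -> decays a p.
Proof.
intros Hp HK [C HC]; exists C.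
apply (first_order_bound 1 a 1 (K + Rabs C * rate a) C p F rate (fun s => - (2 / 3) * rate s));
  [lra| | | |]; intros s Hs.
- rewrite Rmult_1_l; auto.
- unfold rate; der.
- specialize (HC s Hs); generalize (rate_pos s) (Rabs_pos (F s)); intros; nra.
- rewrite Rmult_comm; apply Rmult_le_compat_r; [left; apply exp_pos|].
  specialize (HK s Hs); generalize (rate_pos s) (rate_le a s Hs) (Rabs_pos C) (Rle_abs (- C)).
  rewrite Rabs_Ropp; intros; nra.
Qed.

Lemma is_lim_0_bound (f : R -> R) (eps : R) :
  0 < eps -> is_lim f p_infty 0 -> exists M, forall s, M <= s -> Rabs (f s) <= eps.
Proof.
intros He H; apply is_lim_spec in H.
destruct (H (mkposreal eps He)) as [M HM]; exists (M + 1); intros s Hs.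
assert (HMs : M < s) by lra.
specialize (HM s HMs); simpl in HM; rewrite Rminus_0_r in HM; lra.
Qed.

(* For [Q = u^2 + 100 z^2] with [z = u'' - u], the form [Q'' - (4/3)^2 Q] is
   positive as soon as [u^2 <= 1/900]; hence [Q] decays at least like
   [exp (- (4/3) s)]. *)
Lemma homoclinic_chain_decays (y : nat -> R -> R) :
  (forall s, chain_at y (y 0%nat s ^ 3) s) ->
  (forall i, (i < 4)%nat -> is_lim (y i) p_infty 0) ->
  forall a, chain_decays a y.
Proof.
intros Hy Hl a.
assert (Hb : exists T, forall i s, (i < 4)%nat -> T <= s -> Rabs (y i s) <= 1 / 30).
{ assert (Hp : 0 < 1 / 30) by lra.
  destruct (is_lim_0_bound _ _ Hp (Hl 0%nat ltac:(lia))) as [M0 H0].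
  destruct (is_lim_0_bound _ _ Hp (Hl 1%nat ltac:(lia))) as [M1 H1].
  destruct (is_lim_0_bound _ _ Hp (Hl 2%nat ltac:(lia))) as [M2 H2].
  destruct (is_lim_0_bound _ _ Hp (Hl 3%nat ltac:(lia))) as [M3 H3].
  exists (Rmax (Rmax M0 M1) (Rmax M2 M3)); intros i s Hi Hs.
  generalize (Rmax_l (Rmax M0 M1) (Rmax M2 M3)) (Rmax_r (Rmax M0 M1) (Rmax M2 M3))
    (Rmax_l M0 M1) (Rmax_r M0 M1) (Rmax_l M2 M3) (Rmax_r M2 M3); intros.
  destruct i as [|[|[|[|i]]]]; [apply H0|apply H1|apply H2|apply H3|lia]; lra. }
destruct Hb as [T Hb].
set (Q := fun s => y 0%nat s ^ 2 + 100 * y 2%nat s ^ 2).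
set (dQ := fun s => 2 * y 0%nat s * (y 1%nat s - y 0%nat s)
                    + 200 * y 2%nat s * (y 3%nat s - y 2%nat s)).
set (ddQ := fun s => 2 * (y 1%nat s - y 0%nat s) ^ 2 + 2 * y 0%nat s * (y 0%nat s + y 2%nat s)
   + 200 * (y 3%nat s - y 2%nat s) ^ 2 + 200 * y 2%nat s * (y 2%nat s + y 0%nat s ^ 3)).
assert (HQ : forall s, T <= s -> Q s <= exp (4 / 3 * T) * Q T * exp (- (4 / 3) * s)).
{ apply (decays_of_convex Q dQ ddQ T (4 / 3) 100); [lra| | | |]; intros s Hs.
  - destruct (Hy s) as [H0 [H1 [H2 H3]]]; unfold Q, dQ; der.
  - destruct (Hy s) as [H0 [H1 [H2 H3]]]; unfold dQ, ddQ; der.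
  - assert (H0 := Hb 0%nat s ltac:(lia) Hs); unfold Q, ddQ; revert H0.
    generalize (y 0%nat s) (y 1%nat s) (y 2%nat s) (y 3%nat s); clear.
    intros u y1 z y3 H0; apply Rabs_le_between in H0.
    assert (Hu : 0 <= u ^ 2 <= 1 / 900) by nra.
    assert (H : Rabs (2 * (u * z)) <= u ^ 2 + z ^ 2).
    { generalize (pow2_ge_0 (u - z)) (pow2_ge_0 (u + z)); intros; apply Rabs_le; lra. }
    assert (H' : Rabs (u ^ 2 * (2 * (u * z))) <= 1 / 900 * (u ^ 2 + z ^ 2)).
    { rewrite Rabs_mult, (Rabs_pos_eq (u ^ 2)) by lra.
      apply Rmult_le_compat; try lra; apply Rabs_pos. }
    apply Rabs_le_between in H'.
    (* The form to bound below is [2/9 u^2 + 2 u z + 200/9 z^2 + 200 u^3 z] plus squares. Splitting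
       off [(u + 9 z)^2 / 9] leaves [u^2 / 9], exactly the amount of [u^2] that [200 u^3 z] can
       consume when [u^2 <= 1/900]. *)
    generalize (pow2_ge_0 (y1 - u)) (pow2_ge_0 (y3 - z)) (pow2_ge_0 (u + 9 * z)) (pow2_ge_0 u)
      (pow2_ge_0 z).
    intros; lra.
  - assert (H0 := Hb 0%nat s ltac:(lia) Hs); assert (H1 := Hb 1%nat s ltac:(lia) Hs).
    assert (H2 := Hb 2%nat s ltac:(lia) Hs); assert (H3 := Hb 3%nat s ltac:(lia) Hs).
    unfold Q, dQ; revert H0 H1 H2 H3.
    generalize (y 0%nat s) (y 1%nat s) (y 2%nat s) (y 3%nat s); clear.
    intros u y1 z y3 H0 H1 H2 H3.
    apply Rabs_le_between in H0; apply Rabs_le_between in H1.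
    apply Rabs_le_between in H2; apply Rabs_le_between in H3.
    split; apply Rabs_le; split; nra. }
assert (Hr : forall s, exp (- (4 / 3) * s) = rate s ^ 2).
{ intros s; unfold rate; simpl; rewrite Rmult_1_r, <- exp_plus; f_equal; field. }
assert (D0 : decays T (y 0%nat)).
{ apply decays_of_square with (exp (4 / 3 * T) * Q T); intros s Hs.
  rewrite <- Hr; apply Rle_trans with (2 := HQ s Hs); unfold Q.
  generalize (pow2_ge_0 (y 2%nat s)); lra. }
assert (D2 : decays T (y 2%nat)).
{ apply decays_of_square with (exp (4 / 3 * T) * Q T); intros s Hs.
  rewrite <- Hr; apply Rle_trans with (2 := HQ s Hs); unfold Q.
  generalize (pow2_ge_0 (y 2%nat s)) (pow2_ge_0 (y 0%nat s)); lra. }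
intros i Hi.
apply decays_extend with T.
{ intros s _; eapply chain_continuous; [apply Hy | easy]. }
(* Entries 1 and 3 are bounded solutions of [p' = p + F] and inherit the decay of [F], which is
   entry 2 and [u^3] respectively. *)
destruct i as [|[|[|[|i]]]]; [easy| |easy| |lia].
- apply decays_of_growing_ode with (y 2%nat) (1 / 30); auto.
  intros s _; apply Hy.
- apply decays_of_growing_ode with (fun s => y 0%nat s ^ 3) (1 / 30); auto.
  + intros s _; apply Hy.
  + now apply decays_pow.
Qed.

(** * Nondegeneracy of the homoclinic orbit *)

(** A homoclinic solution in chain form, with convergence to 0 already upgraded to exponential
    decay. Decay at [-oo] is expressed as decay of the reflected chain at [+oo]. *)
Definition orbit (y : nat -> R -> R) : Prop :=
  (forall s, chain_at y (y 0%nat s ^ 3) s) /\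
  (forall a, chain_decays a y) /\
  (forall a, chain_decays a (reflect y)).

Definition opp_chain (y : nat -> R -> R) (i : nat) (s : R) : R := - y i s.

Definition linear_solution (y : nat -> R -> R) (a : R) (f : nat -> R -> R) : Prop :=
  (forall s, a <= s -> chain_at f (3 * y 0%nat s ^ 2 * f 0%nat s) s) /\
  chain_decays a f.

(* The chain of the derivative of [y 0]. *)
Definition deriv_chain (y : nat -> R -> R) (i : nat) (s : R) : R :=
  match i with
  | 0%nat => y 1%nat s - y 0%nat s
  | 1%nat => y 1%nat s + y 2%nat s
  | 2%nat => y 3%nat s - y 2%nat s
  | _ => y 3%nat s + y 0%nat s ^ 3
  end.

Lemma chain_opp (y : nat -> R -> R) (F s : R) :
  chain_at y F s -> chain_at (opp_chain y) (- F) s.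
Proof.
intros [H0 [H1 [H2 H3]]]; unfold opp_chain; split; [|split; [|split]]; der.
Qed.

Lemma decays_opp (a : R) (f : R -> R) : decays a f -> decays a (fun s => - f s).
Proof. intros [C HC]; exists C; intros s Hs; rewrite Rabs_Ropp; auto. Qed.

Lemma reflect_opp_decays (a : R) (y : nat -> R -> R) :
  chain_decays a (reflect y) -> chain_decays a (reflect (opp_chain y)).
Proof.
intros H i Hi; apply decays_ext with (fun s => - reflect y i s); [|now apply decays_opp, H].
intros s _; unfold reflect, opp_chain; destruct i as [|[|[|i]]]; ring.
Qed.

Lemma reflect_involutive (y : nat -> R -> R) (i : nat) (s : R) :
  (i < 4)%nat -> reflect (reflect y) i s = y i s.
Proof.
intros Hi; unfold reflect; rewrite Ropp_involutive.
destruct i as [|[|[|[|i]]]]; [ring .. | lia].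
Qed.

Lemma orbit_opp (y : nat -> R -> R) : orbit y -> orbit (opp_chain y).
Proof.
intros [H1 [H2 H3]]; split; [|split].
- intros s; apply (chain_ext _ (- y 0%nat s ^ 3)); [unfold opp_chain; ring|].
  apply (chain_ext _ (- (y 0%nat s ^ 3))); [ring|]; now apply chain_opp.
- intros a i Hi; now apply decays_opp, H2.
- intros a; now apply reflect_opp_decays.
Qed.

Lemma orbit_reflect (y : nat -> R -> R) : orbit y -> orbit (reflect y).
Proof.
intros [H1 [H2 H3]]; split; [|split; [easy|]].
- intros s; apply chain_reflect, H1.
- intros a i Hi; apply decays_ext with (y i); [|now apply H2].
  intros s _; now rewrite reflect_involutive.
Qed.

Lemma deriv_chain_solution (y : nat -> R -> R) (a : R) :
  orbit y -> linear_solution y a (deriv_chain y).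
Proof.
intros [H1 [H2 _]]; split.
- intros s _; destruct (H1 s) as [E0 [E1 [E2 E3]]].
  unfold deriv_chain; split; [|split; [|split]]; der.
- assert (D0 := H2 a 0%nat ltac:(lia)); assert (D1 := H2 a 1%nat ltac:(lia)).
  assert (D2 := H2 a 2%nat ltac:(lia)); assert (D3 := H2 a 3%nat ltac:(lia)).
  intros i Hi; unfold deriv_chain.
  destruct i as [|[|[|i]]]; decay.
Qed.

Lemma reflect_deriv_solution (y : nat -> R -> R) (a : R) :
  orbit y -> linear_solution (reflect y) a (reflect (deriv_chain y)).
Proof.
intros Hy; assert (Hr := orbit_reflect y Hy).
split.
- intros s Hs; apply chain_reflect.
  exact (proj1 (deriv_chain_solution y (- s) Hy) (- s) (Rle_refl _)).
- intros i Hi.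
  (* Reflection and differentiation anticommute, whence the sign. *)
  apply decays_ext with (fun s => - deriv_chain (reflect y) i s).
  + intros s _; unfold deriv_chain, reflect; destruct i as [|[|[|[|i]]]]; [ring ..|lia].
  + apply decays_opp; now apply deriv_chain_solution.
Qed.

(** This is [E = 0] after substituting [u'' = z + u] and [u''' = z' + u']; the quadratic terms in
    [u] and [u'] cancel and [u' z' = z^2 / 2 + u z + u^4 / 4] remains. The conserved value is 0 by
    decay. *)
Lemma orbit_energy (y : nat -> R -> R) (s : R) :
  orbit y ->
  (y 1%nat s - y 0%nat s) * (y 3%nat s - y 2%nat s)
    = / 2 * y 2%nat s ^ 2 + y 0%nat s * y 2%nat s + / 4 * y 0%nat s ^ 4.
Proof.
intros [H1 [H2 _]].
assert (D0 := H2 s 0%nat ltac:(lia)); assert (D1 := H2 s 1%nat ltac:(lia)).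
assert (D2 := H2 s 2%nat ltac:(lia)); assert (D3 := H2 s 3%nat ltac:(lia)).
set (e := fun s => (y 1%nat s - y 0%nat s) * (y 3%nat s - y 2%nat s)
    - (/ 2 * y 2%nat s ^ 2 + y 0%nat s * y 2%nat s + / 4 * y 0%nat s ^ 4)).
assert (H : e s = 0).
{ apply (constant_decays_0 s); [| |lra]; unfold e.
  - intros r _; destruct (H1 r) as [E0 [E1 [E2 E3]]]; der.
  - decay. }
unfold e in H; lra.
Qed.

(** The linearisation of the previous identity: [dE] along the orbit is conserved by the linearised
    flow and tends to 0 on decaying solutions. *)
Lemma linear_energy (y f : nat -> R -> R) (a s : R) :
  orbit y -> linear_solution y a f -> a <= s ->
  (f 1%nat s - f 0%nat s) * (y 3%nat s - y 2%nat s)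
    + (y 1%nat s - y 0%nat s) * (f 3%nat s - f 2%nat s)
    = y 2%nat s * f 2%nat s + f 0%nat s * y 2%nat s + y 0%nat s * f 2%nat s
      + y 0%nat s ^ 3 * f 0%nat s.
Proof.
intros [H1 [H2 _]] [K1 K2] Hs.
assert (D0 := H2 a 0%nat ltac:(lia)); assert (D1 := H2 a 1%nat ltac:(lia)).
assert (D2 := H2 a 2%nat ltac:(lia)); assert (D3 := H2 a 3%nat ltac:(lia)).
assert (F0 := K2 0%nat ltac:(lia)); assert (F1 := K2 1%nat ltac:(lia)).
assert (F2 := K2 2%nat ltac:(lia)); assert (F3 := K2 3%nat ltac:(lia)).
set (e := fun s => (f 1%nat s - f 0%nat s) * (y 3%nat s - y 2%nat s)
    + (y 1%nat s - y 0%nat s) * (f 3%nat s - f 2%nat s)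
    - (y 2%nat s * f 2%nat s + f 0%nat s * y 2%nat s + y 0%nat s * f 2%nat s
      + y 0%nat s ^ 3 * f 0%nat s)).
assert (H : e s = 0).
{ apply (constant_decays_0 a); [| |easy]; unfold e.
  - intros r Hr; destruct (H1 r) as [E0 [E1 [E2 E3]]].
    destruct (K1 r Hr) as [G0 [G1 [G2 G3]]]; der.
  - decay. }
unfold e in H; lra.
Qed.

(** * Absence of zeros and constant sign of a homoclinic solution *)

Lemma orbit_bounded (y : nat -> R -> R) (a : R) :
  orbit y -> exists B, 0 <= B /\ forall s, a <= s -> 0 <= y 0%nat s ^ 2 <= B.
Proof.
intros [_ [H _]]; destruct (decays_bounded a (y 0%nat)) as [K HK]; [apply H; lia|].
exists (K ^ 2); split; [apply pow2_ge_0|]; intros s Hs; split; [apply pow2_ge_0|].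
rewrite <- pow2_abs; apply pow_incr; split; [apply Rabs_pos | auto].
Qed.

Lemma orbit_zero (y : nat -> R -> R) (x : R) :
  orbit y -> (forall i, (i < 4)%nat -> y i x = 0) -> forall s, y 0%nat s = 0.
Proof.
intros Hy H0 s.
destruct (orbit_bounded y (Rmin x s) Hy) as [B [_ HB]].
apply (chain_zero y (fun s => y 0%nat s ^ 2) (Rmin x s) (Rmax x s) x B); auto.
- split; [apply Rmin_l | apply Rmax_l].
- intros r _; apply (chain_ext _ (y 0%nat r ^ 3)); [ring | apply Hy].
- intros r [Hr _]; auto.
- split; [apply Rmin_r | apply Rmax_r].
Qed.

(** Since [u^3 = u^2 * u], the nonlinear equation is itself of the form treated by the cone, with
    coefficient [u^2 >= 0]. *)
Lemma orbit_cone (y : nat -> R -> R) (x : R) :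
  orbit y -> (forall i, (i < 4)%nat -> 0 <= y i x) ->
  y 1%nat x = 0 /\ y 2%nat x = 0 /\ y 3%nat x = 0.
Proof.
intros Hy H.
destruct (orbit_bounded y x Hy) as [B [_ HB]].
destruct (chain_decays_bounded x y) as [K HK]; [apply Hy|].
apply (chain_cone y (fun s => y 0%nat s ^ 2) (fun _ => 0) x B K); auto; try (intros; lra).
intros r _; apply (chain_ext _ (y 0%nat r ^ 3)); [ring | apply Hy].
Qed.

(** At a zero of [u] the energy reads [u' z' = z^2 / 2], so [z' >= 0] and all four entries lie in
    the cone, which forces [u' = 0]. *)
Lemma orbit_no_crossing_aux (y : nat -> R -> R) (x : R) :
  orbit y -> y 0%nat x = 0 -> 0 < y 1%nat x -> 0 <= y 2%nat x -> False.
Proof.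
intros Hy H0 H1 H2.
assert (He := orbit_energy y x Hy); rewrite H0 in He.
assert (H3 : 0 <= y 3%nat x) by nra.
destruct (orbit_cone y x Hy) as [E _]; [|lra].
intros i Hi; destruct i as [|[|[|[|i]]]]; [lra ..|lia].
Qed.

Lemma orbit_no_crossing (y : nat -> R -> R) (x : R) :
  orbit y -> y 0%nat x = 0 -> 0 < y 1%nat x -> False.
Proof.
intros Hy H0 H1.
destruct (Rle_lt_dec 0 (y 2%nat x)) as [H2|H2].
- now apply (orbit_no_crossing_aux y x).
(* Passing to [- u (- x)] keeps the sign of [u'] at the zero and changes that of [z]. *)
- apply (orbit_no_crossing_aux (opp_chain (reflect y)) (- x)).
  + now apply orbit_opp, orbit_reflect.
  + unfold opp_chain, reflect; rewrite Ropp_involutive; lra.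
  + unfold opp_chain, reflect; rewrite Ropp_involutive; lra.
  + unfold opp_chain, reflect; rewrite Ropp_involutive; lra.
Qed.

(** A simple zero is excluded by the crossing argument. At a double zero the energy gives [z = 0],
    the cone for [u] or for [- u] gives [z' = 0], and uniqueness makes [u] vanish identically. *)
Lemma orbit_nonzero (y : nat -> R -> R) :
  orbit y -> (exists s, y 0%nat s <> 0) -> forall x, y 0%nat x <> 0.
Proof.
intros Hy [s Hs] x H0.
destruct (Rtotal_order (y 1%nat x) 0) as [H1|[H1|H1]].
- apply (orbit_no_crossing (opp_chain y) x); [now apply orbit_opp| |];
    unfold opp_chain; lra.
- assert (He := orbit_energy y x Hy); rewrite H0, H1 in He.
  assert (H2 : y 2%nat x = 0) by nra.
  apply Hs, (orbit_zero y x Hy).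
  assert (H3 : y 3%nat x = 0).
  { destruct (Rle_lt_dec 0 (y 3%nat x)) as [H3|H3].
    - destruct (orbit_cone y x Hy) as [_ [_ E]]; [|easy].
      intros i Hi; destruct i as [|[|[|[|i]]]]; [lra ..|lia].
    - destruct (orbit_cone (opp_chain y) x (orbit_opp y Hy)) as [_ [_ E]].
      + unfold opp_chain; intros i Hi; destruct i as [|[|[|[|i]]]]; [lra ..|lia].
      + unfold opp_chain in E; lra. }
  intros i Hi; destruct i as [|[|[|[|i]]]]; [easy ..|lia].
- now apply (orbit_no_crossing y x).
Qed.

Lemma orbit_continuous (y : nat -> R -> R) (i : nat) (s : R) :
  orbit y -> (i < 4)%nat -> continuous (y i) s.
Proof. intros Hy Hi; eapply chain_continuous; [apply Hy | easy]. Qed.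

Lemma orbit_sign (y : nat -> R -> R) :
  orbit y -> (exists s, y 0%nat s <> 0) ->
  (forall x, 0 < y 0%nat x) \/ (forall x, y 0%nat x < 0).
Proof.
intros Hy Hs; assert (Hn := orbit_nonzero y Hy Hs).
assert (HI : forall x, ~ (y 0%nat 0 * y 0%nat x <= 0)).
{ intros x Hx.
  destruct (IVT_gen (y 0%nat) 0 x 0) as [c [_ Hc]].
  - intros r; apply continuity_pt_filterlim, (orbit_continuous y 0 r Hy); lia.
  - unfold Rmin, Rmax; destruct (Rle_dec (y 0%nat 0) (y 0%nat x)); split; nra.
  - now apply (Hn c). }
destruct (Rtotal_order (y 0%nat 0) 0) as [H|[H|H]].
- right; intros x; specialize (HI x); destruct (Rlt_le_dec (y 0%nat x) 0); [easy|].
  exfalso; apply HI; nra.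
- now destruct (Hn 0).
- left; intros x; specialize (HI x); destruct (Rlt_le_dec 0 (y 0%nat x)); [easy|].
  exfalso; apply HI; nra.
Qed.

(** If [z + z'] is negative at the common starting point, then [z - z' = 2 z - (z + z')] is
    positive, so the reflected function [g] starts in the cone instead of [f]. *)
Lemma cone_pair (f g : nat -> R -> R) (c h d k : R -> R) (a b B K : R) :
  (forall s, a <= s -> chain_at f (c s * f 0%nat s + h s) s) ->
  (forall s, a <= s -> 0 <= c s <= B) -> (forall s, a <= s -> 0 <= h s) ->
  (forall i s, (i < 4)%nat -> a <= s -> Rabs (f i s) <= K) ->
  (forall s, b <= s -> chain_at g (d s * g 0%nat s + k s) s) ->
  (forall s, b <= s -> 0 <= d s <= B) -> (forall s, b <= s -> 0 <= k s) ->
  (forall i s, (i < 4)%nat -> b <= s -> Rabs (g i s) <= K) ->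
  f 0%nat a = 0 -> f 1%nat a = 0 -> 0 <= f 2%nat a ->
  g 0%nat b = 0 -> g 1%nat b = 0 -> g 2%nat b = f 2%nat a ->
  g 3%nat b = 2 * f 2%nat a - f 3%nat a ->
  f 2%nat a = 0 /\ f 3%nat a = 0.
Proof.
intros Hf Hc Hh HKf Hg Hd Hk HKg F0 F1 F2 G0 G1 G2 G3.
destruct (Rle_lt_dec 0 (f 3%nat a)) as [H3|H3].
- destruct (chain_cone f c h a B K) as [_ E]; auto.
  intros i Hi; destruct i as [|[|[|[|i]]]]; [lra ..|lia].
- destruct (chain_cone g d k b B K) as [_ [E1 E2]]; auto; [|lra].
  intros i Hi; destruct i as [|[|[|[|i]]]]; [lra ..|lia].
Qed.

(** [f] is known only to the right of [x], and [g] describes only the left side, in reversed time.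
    The matching data make them the two halves of one solution across [x]. *)
Definition reflected_data (f g : nat -> R -> R) (x : R) : Prop :=
  g 0%nat (- x) = f 0%nat x /\ g 1%nat (- x) = 2 * f 0%nat x - f 1%nat x /\
  g 2%nat (- x) = f 2%nat x /\ g 3%nat (- x) = 2 * f 2%nat x - f 3%nat x.

Lemma reflect_data (f : nat -> R -> R) (x : R) : reflected_data f (reflect f) x.
Proof. unfold reflected_data, reflect; now rewrite Ropp_involutive. Qed.

Lemma reflected_data_lincomb (a b : R) (f g f' g' : nat -> R -> R) (x : R) :
  reflected_data f g x -> reflected_data f' g' x ->
  reflected_data (lincomb a b f f') (lincomb a b g g') x.
Proof.
intros [H0 [H1 [H2 H3]]] [K0 [K1 [K2 K3]]]; unfold reflected_data, lincomb.
rewrite H0, H1, H2, H3, K0, K1, K2, K3; repeat split; ring.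
Qed.

Lemma linear_solution_lincomb (y : nat -> R -> R) (a c d : R) (f g : nat -> R -> R) :
  linear_solution y a f -> linear_solution y a g ->
  linear_solution y a (lincomb c d f g).
Proof.
intros [F1 F2] [G1 G2]; split; [|now apply chain_decays_lincomb].
intros s Hs.
apply (chain_ext _ (c * (3 * y 0%nat s ^ 2 * f 0%nat s) + d * (3 * y 0%nat s ^ 2 * g 0%nat s)));
  [unfold lincomb; ring|].
apply chain_lincomb; auto.
Qed.

(* The cone argument for [f - k u], which solves the linearised equation with
   the additional source [2 k u^3 >= 0]. *)
Lemma linear_pair_cone (y f g : nat -> R -> R) (x k : R) :
  orbit y -> (forall s, 0 < y 0%nat s) -> 0 <= k ->
  linear_solution y x f -> linear_solution (reflect y) (- x) g ->
  reflected_data f g x ->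
  f 0%nat x = k * y 0%nat x -> f 1%nat x = k * y 1%nat x -> y 1%nat x = y 0%nat x ->
  0 <= f 2%nat x - k * y 2%nat x ->
  f 2%nat x = k * y 2%nat x /\ f 3%nat x = k * y 3%nat x.
Proof.
intros Hy Hpos Hk Hf Hg [R0 [R1 [R2 R3]]] F0 F1 Y1 F2.
assert (Hr := orbit_reflect y Hy).
destruct (orbit_bounded y x Hy) as [B1 [HB1 HB1']].
destruct (orbit_bounded (reflect y) (- x) Hr) as [B2 [HB2 HB2']].
assert (Hf' : chain_decays x (lincomb 1 (- k) f y)).
{ apply chain_decays_lincomb; [apply Hf | apply Hy]. }
assert (Hg' : chain_decays (- x) (lincomb 1 (- k) g (reflect y))).
{ apply chain_decays_lincomb; [apply Hg | apply Hy]. }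
destruct (chain_decays_bounded _ _ Hf') as [K1 HK1].
destruct (chain_decays_bounded _ _ Hg') as [K2 HK2].
destruct (cone_pair (lincomb 1 (- k) f y) (lincomb 1 (- k) g (reflect y))
  (fun s => 3 * y 0%nat s ^ 2) (fun s => 2 * k * y 0%nat s ^ 3)
  (fun s => 3 * reflect y 0%nat s ^ 2) (fun s => 2 * k * reflect y 0%nat s ^ 3)
  x (- x) (3 * (B1 + B2)) (Rmax K1 K2)) as [E2 E3].
- intros s Hs.
  apply (chain_ext _ (1 * (3 * y 0%nat s ^ 2 * f 0%nat s) + (- k) * y 0%nat s ^ 3));
    [unfold lincomb; ring|].
  apply chain_lincomb; [now apply Hf | apply Hy].
- intros s Hs; specialize (HB1' s Hs); lra.
- intros s Hs; apply Rmult_le_pos; [lra|]; apply pow_le; left; apply Hpos.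
- intros i s Hi Hs; apply Rle_trans with (2 := Rmax_l _ _); auto.
- intros s Hs.
  apply (chain_ext _ (1 * (3 * reflect y 0%nat s ^ 2 * g 0%nat s)
    + (- k) * reflect y 0%nat s ^ 3)); [unfold lincomb; ring|].
  apply chain_lincomb; [now apply Hg | apply Hr].
- intros s Hs; specialize (HB2' s Hs); lra.
- intros s Hs; apply Rmult_le_pos; [lra|]; apply pow_le; left; apply Hpos.
- intros i s Hi Hs; apply Rle_trans with (2 := Rmax_r _ _); auto.
- unfold lincomb; rewrite F0; ring.
- unfold lincomb; rewrite F1; ring.
- unfold lincomb; lra.
- unfold lincomb, reflect; rewrite Ropp_involutive, R0, F0; ring.
- unfold lincomb, reflect; rewrite Ropp_involutive, R1, F0, F1, Y1; ring.
- unfold lincomb, reflect; rewrite Ropp_involutive, R2; ring.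
- unfold lincomb, reflect; rewrite Ropp_involutive, R3; ring.
- unfold lincomb in E2, E3; split; lra.
Qed.

Lemma nondegenerate_aux (y f g : nat -> R -> R) (x : R) :
  orbit y -> (forall s, 0 < y 0%nat s) ->
  y 1%nat x = y 0%nat x -> y 2%nat x + y 0%nat x < 0 ->
  linear_solution y x f -> linear_solution (reflect y) (- x) g ->
  reflected_data f g x ->
  f 1%nat x = f 0%nat x -> 0 <= f 0%nat x ->
  forall i, (i < 4)%nat -> f i x = 0.
Proof.
intros Hy Hpos Y1 Y2 Hf Hg HR F1 F0.
assert (He := orbit_energy y x Hy).
assert (Hle := linear_energy y f x x Hy Hf (Rle_refl x)).
rewrite Y1 in He, Hle; rewrite F1 in Hle.
assert (P := Hpos x).
set (k := f 0%nat x / y 0%nat x).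
assert (Hk : 0 <= k) by now apply Rdiv_le_0_compat.
assert (Hk0 : f 0%nat x = k * y 0%nat x) by (unfold k; field; lra).
(* Combination of the linearised energy identity with [2 k] times the energy identity at the
   critical point, where the terms in [u'] and [phi'] are gone. The factor [y 2 + y 0] is [u'' < 0],
   which fixes the sign of the other factor. *)
assert (E : (f 2%nat x - k * y 2%nat x) * (y 2%nat x + y 0%nat x) = - k * / 2 * y 0%nat x ^ 4).
{ rewrite Hk0 in Hle; nra. }
assert (P4 : 0 < y 0%nat x ^ 4) by now apply pow_lt.
assert (E2 : 0 <= f 2%nat x - k * y 2%nat x).
{ destruct (Rle_lt_dec 0 (f 2%nat x - k * y 2%nat x)) as [|H]; [easy|].
  assert (0 < (f 2%nat x - k * y 2%nat x) * (y 2%nat x + y 0%nat x)) by nra.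
  assert (0 <= k * y 0%nat x ^ 4) by (apply Rmult_le_pos; lra).
  lra. }
destruct (linear_pair_cone y f g x k) as [A2 A3]; auto.
{ rewrite F1, Y1; easy. }
(* The cone forces the first factor in [E] to vanish, whereas the right side is a nonzero multiple
   of [k]. *)
assert (Hk1 : k = 0).
{ rewrite A2, Rminus_diag, Rmult_0_l in E; nra. }
rewrite Hk1 in *.
intros i Hi; destruct i as [|[|[|[|i]]]]; [lra ..|lia].
Qed.

Lemma nondegenerate (y f g : nat -> R -> R) (x : R) :
  orbit y -> (forall s, 0 < y 0%nat s) ->
  y 1%nat x = y 0%nat x -> y 2%nat x + y 0%nat x < 0 ->
  linear_solution y x f -> linear_solution (reflect y) (- x) g ->
  reflected_data f g x ->
  exists l, forall i, (i < 4)%nat -> f i x = l * deriv_chain y i x.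
Proof.
intros Hy Hpos Y1 Y2 Hf Hg HR.
(* [l] is [phi' (x) / u'' (x)], so that [phi - l u'] has zero derivative at [x]. *)
set (l := (f 1%nat x - f 0%nat x) / (y 2%nat x + y 0%nat x)).
exists l.
assert (HD := deriv_chain_solution y x Hy).
assert (HDr := reflect_deriv_solution y (- x) Hy).
set (f' := lincomb 1 (- l) f (deriv_chain y)).
set (g' := lincomb 1 (- l) g (reflect (deriv_chain y))).
assert (Hf' : linear_solution y x f') by now apply linear_solution_lincomb.
assert (Hg' : linear_solution (reflect y) (- x) g') by now apply linear_solution_lincomb.
assert (HR' : reflected_data f' g' x).
{ apply reflected_data_lincomb; [easy | apply reflect_data]. }
assert (F1 : f' 1%nat x = f' 0%nat x).
{ unfold f', lincomb, deriv_chain, l; rewrite Y1; field; lra. }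
assert (H : forall i, (i < 4)%nat -> f' i x = 0).
{ destruct (Rle_lt_dec 0 (f' 0%nat x)) as [F0|F0].
  - now apply (nondegenerate_aux y f' g').
  (* By linearity the case [phi (x) < 0] reduces to the other one; multiplication by a scalar is
     expressed as a [lincomb] with second coefficient 0. *)
  - assert (H : forall i, (i < 4)%nat -> lincomb (- 1) 0 f' f' i x = 0).
    + apply (nondegenerate_aux y _ (lincomb (- 1) 0 g' g')); auto.
      * now apply linear_solution_lincomb.
      * now apply linear_solution_lincomb.
      * now apply reflected_data_lincomb.
      * unfold lincomb; rewrite F1; ring.
      * unfold lincomb; lra.
    + intros i Hi; specialize (H i Hi); unfold lincomb in H; lra. }
intros i Hi; specialize (H i Hi); unfold f', lincomb in H; lra.
Qed.

(** If [u' = u'' = 0] at [x], the energy gives [u^2 = 2]. Now [u'] solves the linearised equation,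
    decays at both ends and has vanishing value and derivative at [x], so the two-ended cone
    argument yields [z' = 0] and [z + z' + u^3 = 0], that is [- u + 2 u = 0]. *)
Lemma critical_second_derivative (y : nat -> R -> R) (x : R) :
  orbit y -> y 0%nat x <> 0 -> y 1%nat x = y 0%nat x -> y 2%nat x + y 0%nat x <> 0.
Proof.
intros Hy H0 Y1 Y2.
assert (He := orbit_energy y x Hy); rewrite Y1 in He.
assert (HD := deriv_chain_solution y x Hy).
assert (HDr := reflect_deriv_solution y (- x) Hy).
assert (Hr := orbit_reflect y Hy).
assert (Y2' : y 2%nat x = - y 0%nat x) by lra.
assert (Y0 : y 0%nat x ^ 2 = 2).
{ rewrite Y2' in He; apply Rmult_eq_reg_l with (y 0%nat x ^ 2); nra. }
destruct (orbit_bounded y x Hy) as [B1 [HB1 HB1']].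
destruct (orbit_bounded (reflect y) (- x) Hr) as [B2 [HB2 HB2']].
(* The factor [e] will be 1 or -1, chosen so that the [z]-entry of [e u'] is nonnegative. *)
assert (Hc : forall e, 0 <= e * (y 3%nat x - y 2%nat x) ->
  e * (y 3%nat x - y 2%nat x) = 0 /\ e * (y 3%nat x + y 0%nat x ^ 3) = 0).
{ intros e Pe.
  set (f := lincomb e 0 (deriv_chain y) (deriv_chain y)).
  set (g := lincomb e 0 (reflect (deriv_chain y)) (reflect (deriv_chain y))).
  assert (Hf : linear_solution y x f) by now apply linear_solution_lincomb.
  assert (Hg : linear_solution (reflect y) (- x) g) by now apply linear_solution_lincomb.
  destruct (chain_decays_bounded _ _ (proj2 Hf)) as [K1 HK1].
  destruct (chain_decays_bounded _ _ (proj2 Hg)) as [K2 HK2].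
  assert (HR : reflected_data f g x) by (apply reflected_data_lincomb; apply reflect_data).
  destruct HR as [R0 [R1 [R2 R3]]].
  assert (F0 : f 0%nat x = 0) by (unfold f, lincomb, deriv_chain; rewrite Y1; ring).
  assert (F1 : f 1%nat x = 0) by (unfold f, lincomb, deriv_chain; rewrite Y1, Y2'; ring).
  destruct (cone_pair f g (fun s => 3 * y 0%nat s ^ 2) (fun _ => 0)
    (fun s => 3 * reflect y 0%nat s ^ 2) (fun _ => 0) x (- x) (3 * (B1 + B2)) (Rmax K1 K2))
    as [E2 E3]; try (intros; lra); auto.
  - intros s Hs; apply (chain_ext _ (3 * y 0%nat s ^ 2 * f 0%nat s)); [ring | now apply Hf].
  - intros s Hs; specialize (HB1' s Hs); lra.
  - intros i s Hi Hs; apply Rle_trans with (2 := Rmax_l _ _); auto.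
  - intros s Hs; apply (chain_ext _ (3 * reflect y 0%nat s ^ 2 * g 0%nat s));
      [ring | now apply Hg].
  - intros s Hs; specialize (HB2' s Hs); lra.
  - intros i s Hi Hs; apply Rle_trans with (2 := Rmax_r _ _); auto.
  - unfold f, lincomb, deriv_chain; lra.
  - unfold f, lincomb, deriv_chain in E2, E3; lra. }
assert (H : y 3%nat x - y 2%nat x = 0 /\ y 3%nat x + y 0%nat x ^ 3 = 0).
{ destruct (Rle_lt_dec 0 (y 3%nat x - y 2%nat x)) as [H|H].
  - destruct (Hc 1); lra.
  - destruct (Hc (- 1)); lra. }
apply H0; replace (y 0%nat x ^ 3) with (y 0%nat x * y 0%nat x ^ 2) in H by ring.
rewrite Y0 in H; lra.
Qed.

(** A positive function decaying at both ends attains its maximum. There [u'' <= 0], and strictness,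
    needed for dividing by [u''], comes from the exclusion of degenerate critical points. *)
Lemma orbit_maximum (y : nat -> R -> R) :
  orbit y -> (forall s, 0 < y 0%nat s) ->
  exists x, y 1%nat x = y 0%nat x /\ y 2%nat x + y 0%nat x < 0.
Proof.
intros Hy Hpos.
destruct (decays_nonneg 0 (y 0%nat)) as [C [HC0 HC]]; [apply Hy; lia|].
destruct (decays_nonneg 0 (reflect y 0%nat)) as [D [HD0 HD]]; [apply Hy; lia|].
destruct (exp_decay_lt (C + D) (2 / 3) 0 (y 0%nat 0)) as [T [HT0 HT]]; [lra|auto|].
change (exp (- (2 / 3) * T)) with (rate T) in HT.
assert (Hout : forall s, T <= Rabs s -> y 0%nat s < y 0%nat 0).
{ intros s Hs.
  assert (Hr : rate (Rabs s) <= rate T) by now apply rate_le.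
  generalize (rate_pos (Rabs s)); intros Hp.
  apply Rle_lt_trans with ((C + D) * rate (Rabs s)).
  - destruct (Rle_lt_dec 0 s) as [H0|H0].
    + rewrite (Rabs_pos_eq s H0); specialize (HC s H0); generalize (Rle_abs (y 0%nat s)).
      generalize (rate_pos s); nra.
    + rewrite (Rabs_left s H0); assert (H1 : 0 <= - s) by lra; specialize (HD _ H1).
      unfold reflect in HD; rewrite Ropp_involutive in HD.
      generalize (Rle_abs (y 0%nat s)) (rate_pos (- s)); nra.
  - apply Rle_lt_trans with (2 := HT); apply Rmult_le_compat_l; lra. }
destruct (continuity_ab_maj (y 0%nat) (- T) T) as [x [Hx1 Hx2]]; [lra| |].
{ intros s _; apply continuity_pt_filterlim, (orbit_continuous y 0 s Hy); lia. }
assert (H0x : y 0%nat 0 <= y 0%nat x) by (apply Hx1; lra).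
assert (HxT : Rabs x < T).
{ destruct (Rlt_le_dec (Rabs x) T) as [|H]; [easy|].
  specialize (Hout x H); lra. }
apply Rabs_def2 in HxT.
destruct (proj1 Hy x) as [E0 [_ [E2 _]]].
assert (Y1 : y 1%nat x = y 0%nat x).
{ apply is_derive_Reals in E0.
  set (pr := exist _ _ E0 : derivable_pt (y 0%nat) x).
  generalize (deriv_maximum (y 0%nat) (- T) T x pr ltac:(lra) ltac:(lra)
    ltac:(intros s Hs1 Hs2; apply Hx1; lra)).
  unfold derive_pt, pr; simpl; lra. }
exists x; split; [easy|].
assert (Hne := critical_second_derivative y x Hy (Rgt_not_eq _ _ (Hpos x)) Y1).
destruct (Rle_lt_dec (y 2%nat x + y 0%nat x) 0) as [|Hm]; [lra|exfalso].
(* [m] is half of [u'' (x)]. Just to the right of [x], [u''] stays above [m], so [u] would rise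
   there by at least [m / 2 * d ^ 2], beyond its maximum. *)
set (m := (y 2%nat x + y 0%nat x) / 2).
assert (Hc : continuous (fun s => y 2%nat s + y 0%nat s) x).
{ apply (continuous_plus (V := R_NormedModule) (y 2%nat) (y 0%nat));
    apply (orbit_continuous y); auto; lia. }
assert (Hmp : 0 < m) by (unfold m; lra).
destruct (proj1 (filterlim_locally _ _) Hc (mkposreal m Hmp)) as [e He].
assert (Hepos : 0 < Rmin (e / 2) (T - x)).
{ apply Rmin_glb_lt; [generalize (cond_pos e)|]; lra. }
set (d := Rmin (e / 2) (T - x)) in *.
assert (Hde : d <= e / 2) by apply Rmin_l.
assert (HdT : d <= T - x) by apply Rmin_r.
assert (Hge : forall s, x <= s <= x + d -> m <= y 2%nat s + y 0%nat s).
{ intros s Hs.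
  assert (Hb : ball x e s).
  { apply Rabs_def1; unfold minus, plus, opp; simpl; generalize (cond_pos e); lra. }
  specialize (He s Hb); apply Rabs_def2 in He.
  unfold minus, plus, opp in He; simpl in He; unfold m in *; lra. }
assert (H1 : forall s, x <= s <= x + d -> m * (s - x) <= y 1%nat s - y 0%nat s).
{ intros s Hs.
  assert (H : y 1%nat x - y 0%nat x - m * (x - x) <= y 1%nat s - y 0%nat s - m * (s - x)).
  { apply (nondecreasing_of_derive (fun s => y 1%nat s - y 0%nat s - m * (s - x))
      (fun s => y 2%nat s + y 0%nat s - m)); [lra| |]; intros r Hr.
    - destruct (proj1 Hy r) as [G0 [G1 _]]; der.
    - assert (Hr' : x <= r <= x + d) by lra; specialize (Hge r Hr'); lra. }
  lra. }
assert (H2 : y 0%nat x - m / 2 * (x - x) ^ 2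
  <= y 0%nat (x + d) - m / 2 * (x + d - x) ^ 2).
{ apply (nondecreasing_of_derive (fun s => y 0%nat s - m / 2 * (s - x) ^ 2)
    (fun s => y 1%nat s - y 0%nat s - m * (s - x))); [lra| |]; intros r Hr.
  - destruct (proj1 Hy r) as [G0 _]; der.
  - specialize (H1 r Hr); lra. }
assert (H3 : y 0%nat (x + d) <= y 0%nat x) by (apply Hx1; lra).
assert (0 < m / 2 * d ^ 2) by (apply Rmult_lt_0_compat; [lra|now apply pow_lt]).
nra.
Qed.

(** * Volterra equations from infinity *)

(* The factor [exp (L exp (- s))] makes the Volterra operator a contraction on
   an entire half-line without any smallness of the coefficient. *)
Definition weight (L s : R) : R := exp (- 2 * s + L * exp (- s)).

Lemma weight_pos (L s : R) : 0 < weight L s.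
Proof. apply exp_pos. Qed.

Lemma exp_le (x y : R) : x <= y -> exp x <= exp y.
Proof. intros [H| ->]; [left; now apply exp_increasing | lra]. Qed.

Lemma weight_le (L a s : R) : 0 <= L -> a <= s -> weight L s <= exp (L * exp (- a)) * exp (- 2 * s).
Proof.
intros HL Hs; unfold weight; rewrite <- exp_plus; apply exp_le.
assert (exp (- s) <= exp (- a)) by (apply exp_le; lra); nra.
Qed.

Lemma weight_ge (L s : R) : 0 <= L -> exp (- 2 * s) <= weight L s.
Proof.
intros HL; unfold weight; apply exp_le; generalize (exp_pos (- s)); nra.
Qed.

Lemma weight_derive (L s : R) :
  is_derive (weight L) s (- (2 + L * exp (- s)) * weight L s).
Proof. unfold weight; auto_derive; [easy | ring]. Qed.

(** The weight [w] is a barrier for both factors, [sg * w - w' = (2 + sg + L * exp (- s)) * w], as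
    the exponent 2 exceeds 1. The constant [M] only certifies decay at infinity and does not enter
    the conclusion. *)
Lemma first_order_weight (sg L a A M : R) (p F : R -> R) :
  sg = 1 \/ sg = - 1 -> 0 <= L -> 0 <= A ->
  (forall s, a <= s -> is_derive p s (sg * p s + F s)) ->
  (forall s, a <= s -> Rabs (F s) <= A * ((2 + sg + L * exp (- s)) * weight L s)) ->
  (forall s, a <= s -> Rabs (p s) <= M * weight L s) ->
  forall s, a <= s -> Rabs (p s) <= A * weight L s.
Proof.
intros Hsg HL HA Hp HF HM.
apply (first_order_bound sg a (2 + sg) (Rabs M * exp (L * exp (- a))) A p F
  (weight L) (fun s => - (2 + L * exp (- s)) * weight L s)); auto.
- destruct Hsg; lra.
- intros; apply weight_derive.
- intros s Hs; apply Rle_trans with (1 := HF s Hs); right; ring.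
- intros s Hs; specialize (HM s Hs).
  generalize (weight_pos L s) (weight_le L a s HL Hs); intros W0 W1.
  replace (- (2 + sg) * s) with (- sg * s + (- 2) * s) by ring.
  rewrite exp_plus.
  replace (Rabs M * exp (L * exp (- a)) * (exp (- sg * s) * exp (-2 * s)))
    with (exp (- sg * s) * (Rabs M * (exp (L * exp (- a)) * exp (-2 * s)))) by ring.
  apply Rmult_le_compat_l; [left; apply exp_pos|].
  apply Rle_trans with (Rabs M * weight L s).
  + generalize (Rle_abs M); nra.
  + apply Rmult_le_compat_l; [apply Rabs_pos | easy].
Qed.

Definition weight_bound (L a M : R) (y : nat -> R -> R) : Prop :=
  forall i s, (i < 4)%nat -> a <= s -> Rabs (y i s) <= M * weight L s.

(** Only the factor of entry 3 sees the source. There the barrier provides the coefficient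
    [3 + L * exp (- s)], which later turns a Lipschitz constant [L / 2 * exp (- s)] into a
    contraction by 1/2. In the other factors the coefficient is at least 1, so [A] is passed on
    unchanged. *)
Lemma chain_estimate (L a A M : R) (y : nat -> R -> R) (F : R -> R) :
  0 <= L -> 0 <= A ->
  (forall s, a <= s -> chain_at y (F s) s) ->
  (forall s, a <= s -> Rabs (F s) <= A * ((3 + L * exp (- s)) * weight L s)) ->
  weight_bound L a M y -> weight_bound L a A y.
Proof.
intros HL HA Hy HF HM.
assert (M0 := fun s => HM 0%nat s ltac:(lia)); assert (M1 := fun s => HM 1%nat s ltac:(lia)).
assert (M2 := fun s => HM 2%nat s ltac:(lia)); assert (M3 := fun s => HM 3%nat s ltac:(lia)).
assert (Hstep : forall sg (p q : R -> R), sg = 1 \/ sg = - 1 ->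
  (forall s, a <= s -> is_derive p s (sg * p s + q s)) ->
  (forall s, a <= s -> Rabs (q s) <= A * weight L s) ->
  (forall s, a <= s -> Rabs (p s) <= M * weight L s) ->
  forall s, a <= s -> Rabs (p s) <= A * weight L s).
{ intros sg p q Hsg Hp Hq HpM.
  apply (first_order_weight sg L a A M p q); auto.
  intros s Hs; apply Rle_trans with (1 := Hq s Hs).
  apply Rmult_le_compat_l; [easy|].
  generalize (weight_pos L s); intros W.
  assert (0 <= L * exp (- s)) by (apply Rmult_le_pos; [easy | left; apply exp_pos]).
  destruct Hsg; subst sg; nra. }
assert (B3 : forall s, a <= s -> Rabs (y 3%nat s) <= A * weight L s).
{ apply (first_order_weight 1 L a A M (y 3%nat) F); auto.
  - intros s Hs; destruct (Hy s Hs) as [_ [_ [_ E]]]; now rewrite Rmult_1_l.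
  - intros s Hs; replace (2 + 1) with 3 by ring; auto. }
assert (B2 : forall s, a <= s -> Rabs (y 2%nat s) <= A * weight L s).
{ apply (Hstep (- 1) _ (y 3%nat)); auto.
  intros s Hs; destruct (Hy s Hs) as [_ [_ [E _]]].
  replace (- 1 * y 2%nat s + y 3%nat s) with (y 3%nat s - y 2%nat s) by ring; easy. }
assert (B1 : forall s, a <= s -> Rabs (y 1%nat s) <= A * weight L s).
{ apply (Hstep 1 _ (y 2%nat)); auto.
  intros s Hs; destruct (Hy s Hs) as [_ [E _]]; now rewrite Rmult_1_l. }
assert (B0 : forall s, a <= s -> Rabs (y 0%nat s) <= A * weight L s).
{ apply (Hstep (- 1) _ (y 1%nat)); auto.
  intros s Hs; destruct (Hy s Hs) as [E _].
  replace (- 1 * y 0%nat s + y 1%nat s) with (y 1%nat s - y 0%nat s) by ring; easy. }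
intros i s Hi Hs; destruct i as [|[|[|[|i]]]]; [auto ..|lia].
Qed.

Lemma le_of_half_pow (x A M : R) : (forall n, x <= A + M * (1 / 2) ^ n) -> x <= A.
Proof.
intros H; destruct (Rle_lt_dec x A) as [|Hx]; [easy|exfalso].
assert (HM : 0 < Rabs M + 1) by (generalize (Rabs_pos M); lra).
destruct (pow_lt_1_zero (1 / 2)) with (y := (x - A) / (Rabs M + 1)) as [N HN].
- rewrite Rabs_pos_eq; lra.
- apply Rdiv_lt_0_compat; lra.
- specialize (HN N (le_n N)); specialize (H N).
  assert (Hp : 0 < (1 / 2) ^ N) by (apply pow_lt; lra).
  rewrite Rabs_pos_eq in HN by lra.
  apply Rlt_div_r in HN; [|easy].
  generalize (Rle_abs M); nra.
Qed.

(** A bootstrap: as [2 * B <= L], a bound [A + q] improves to [A + q / 2], so the a priori constant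
    [M] is halved away. Applied to differences, this serves as uniqueness and as continuous
    dependence. *)
Lemma chain_stability (L a A B M : R) (y : nat -> R -> R) (F : R -> R) :
  0 <= A -> 0 <= B -> 2 * B <= L ->
  (forall s, a <= s -> chain_at y (F s) s) ->
  (forall s, a <= s -> Rabs (F s) <= A * weight L s + B * exp (- s) * Rabs (y 0%nat s)) ->
  weight_bound L a M y -> weight_bound L a A y.
Proof.
intros HA HB HL Hy HF HM.
assert (HM' : weight_bound L a (Rabs M) y).
{ intros i s Hi Hs; apply Rle_trans with (1 := HM i s Hi Hs).
  apply Rmult_le_compat_r; [left; apply weight_pos | apply Rle_abs]. }
assert (H : forall n, weight_bound L a (A + Rabs M * (1 / 2) ^ n) y).
{ induction n as [|n IH].
  - intros i s Hi Hs; apply Rle_trans with (1 := HM' i s Hi Hs).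
    apply Rmult_le_compat_r; [left; apply weight_pos|]; simpl; lra.
  - assert (Hp : 0 <= Rabs M * (1 / 2) ^ n).
    { apply Rmult_le_pos; [apply Rabs_pos | apply pow_le; lra]. }
    apply (chain_estimate L a _ (Rabs M) y F); auto; [lra| |].
    + simpl; lra.
    + intros s Hs; apply Rle_trans with (1 := HF s Hs).
      specialize (IH 0%nat s ltac:(lia) Hs).
      generalize (weight_pos L s) (exp_pos (- s)); intros W0 E0.
      set (q := Rabs M * (1 / 2) ^ n) in *.
      replace (Rabs M * (1 / 2) ^ S n) with (q / 2) by (unfold q; simpl; field).
      assert (H1 : B * exp (- s) * Rabs (y 0%nat s)
        <= L / 2 * exp (- s) * ((A + q) * weight L s)).
      { apply Rmult_le_compat; try nra; apply Rabs_pos. }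
      apply Rle_trans with (1 := Rplus_le_compat_l _ _ _ H1).
      assert (0 <= L * exp (- s) * weight L s).
      { apply Rmult_le_pos; [apply Rmult_le_pos|]; lra. }
      assert (0 <= A * (L * exp (- s) * weight L s)) by now apply Rmult_le_pos.
      assert (0 <= A * weight L s) by (apply Rmult_le_pos; lra).
      assert (0 <= q * weight L s) by (apply Rmult_le_pos; lra).
      lra. }
intros i s Hi Hs.
apply (le_of_half_pow _ _ (Rabs M * weight L s)); intros n.
apply Rle_trans with (1 := H n i s Hi Hs); right; ring.
Qed.

(** Variation of constants from [+oo]: [exp (- sg * s) * F s] decays like [exp (- (2 + sg) * s)] for
    either sign, so it has a primitive vanishing at infinity. *)
Lemma first_order_solve (sg L a M : R) (F : R -> R) :
  sg = 1 \/ sg = - 1 -> 0 <= L -> (forall s, continuous F s) ->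
  (forall s, a <= s -> Rabs (F s) <= M * weight L s) ->
  exists p, (forall s, is_derive p s (sg * p s + F s)) /\
    exists M', forall s, a <= s -> Rabs (p s) <= M' * weight L s.
Proof.
intros Hsg HL HF HM.
assert (HM0 : 0 <= M).
{ specialize (HM a (Rle_refl a)); generalize (Rabs_pos (F a)) (weight_pos L a); nra. }
assert (Hk : 0 < 2 + sg) by (destruct Hsg; lra).
destruct (primitive_decay (fun s => exp (- sg * s) * F s) a (2 + sg)
  (M * exp (L * exp (- a)))) as [P [HP1 HP2]]; auto.
- intros s; apply (continuous_mult (fun s => exp (- sg * s)) F); [|apply HF].
  eapply derivable_cont with (l := - sg * exp (- sg * s)); auto_derive; [easy|ring].
- intros s Hs; rewrite Rabs_mult, (Rabs_pos_eq (exp _)) by (left; apply exp_pos).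
  replace (- (2 + sg) * s) with (- sg * s + (- 2) * s) by ring; rewrite exp_plus.
  replace (M * exp (L * exp (- a)) * (exp (- sg * s) * exp (-2 * s)))
    with (exp (- sg * s) * (M * (exp (L * exp (- a)) * exp (-2 * s)))) by ring.
  apply Rmult_le_compat_l; [left; apply exp_pos|].
  apply Rle_trans with (1 := HM s Hs); apply Rmult_le_compat_l; [easy|].
  now apply weight_le.
- exists (fun s => exp (sg * s) * P s); split.
  + intros s; generalize (HP1 s); intros H.
    assert (E : exp (sg * s) * exp (- sg * s) = 1).
    { rewrite <- exp_plus; replace (sg * s + - sg * s) with 0 by ring; apply exp_0. }
    auto_derive; [now exists (exp (- sg * s) * F s)|].
    replace (Derive (fun x => P x) s) with (exp (- sg * s) * F s)
      by (symmetry; now apply is_derive_unique).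
    replace (sg * (exp (sg * s) * P s) + F s)
      with (sg * (exp (sg * s) * P s) + exp (sg * s) * exp (- sg * s) * F s)
      by (rewrite E; ring).
    ring.
  + exists (M * exp (L * exp (- a)) / (2 + sg)); intros s Hs.
    rewrite Rabs_mult, (Rabs_pos_eq (exp _)) by (left; apply exp_pos).
    apply Rle_trans with (exp (sg * s)
      * (M * exp (L * exp (- a)) / (2 + sg) * exp (- (2 + sg) * s))).
    * apply Rmult_le_compat_l; [left; apply exp_pos | auto].
    * replace (- 2 * s) with (sg * s + (- (2 + sg)) * s) in * by ring.
      generalize (weight_ge L s HL); replace (- 2 * s) with (sg * s + (- (2 + sg)) * s) by ring.
      rewrite exp_plus; intros HW.
      rewrite (Rmult_comm (exp (sg * s))), Rmult_assoc.
      apply Rmult_le_compat_l; [|rewrite Rmult_comm; easy].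
      apply Rdiv_le_0_compat; [|easy].
      apply Rmult_le_pos; [easy | left; apply exp_pos].
Qed.

(** The system is triangular once the source is given, so the four factors are solved one after
    another from entry 3 down. *)
Lemma chain_solve (L a M : R) (F : R -> R) :
  0 <= L -> (forall s, continuous F s) ->
  (forall s, a <= s -> Rabs (F s) <= M * weight L s) ->
  exists y, (forall s, chain_at y (F s) s) /\ exists M', weight_bound L a M' y.
Proof.
intros HL HF HM.
assert (Hc : forall sg (p q : R -> R), (forall s, is_derive p s (sg * p s + q s)) ->
  forall s, continuous p s).
{ intros sg p q H s; exact (derivable_cont _ _ _ (H s)). }
destruct (first_order_solve 1 L a M F) as [p3 [H3 [M3 B3]]]; auto.
destruct (first_order_solve (- 1) L a M3 p3) as [p2 [H2 [M2 B2]]]; eauto.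
destruct (first_order_solve 1 L a M2 p2) as [p1 [H1 [M1 B1]]]; eauto.
destruct (first_order_solve (- 1) L a M1 p1) as [p0 [H0 [M0 B0]]]; eauto.
exists (fun i => match i with 0%nat => p0 | 1%nat => p1 | 2%nat => p2 | _ => p3 end).
split.
- intros s; split; [|split; [|split]].
  + replace (p1 s - p0 s) with (- 1 * p0 s + p1 s) by ring; apply H0.
  + rewrite <- (Rmult_1_l (p1 s)) at 1; apply H1.
  + replace (p3 s - p2 s) with (- 1 * p2 s + p3 s) by ring; apply H2.
  + rewrite <- (Rmult_1_l (p3 s)) at 1; apply H3.
- exists (Rabs M0 + Rabs M1 + Rabs M2 + Rabs M3); intros i s Hi Hs.
  generalize (weight_pos L s) (Rle_abs M0) (Rle_abs M1) (Rle_abs M2) (Rle_abs M3)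
    (Rabs_pos M0) (Rabs_pos M1) (Rabs_pos M2) (Rabs_pos M3); intros.
  destruct i as [|[|[|[|i]]]]; [| | | |lia].
  + apply Rle_trans with (1 := B0 s Hs); apply Rmult_le_compat_r; lra.
  + apply Rle_trans with (1 := B1 s Hs); apply Rmult_le_compat_r; lra.
  + apply Rle_trans with (1 := B2 s Hs); apply Rmult_le_compat_r; lra.
  + apply Rle_trans with (1 := B3 s Hs); apply Rmult_le_compat_r; lra.
Qed.

Lemma continuous_Rmax_const (a s : R) : continuous (Rmax a) s.
Proof.
apply (continuous_ext (fun s => (a + s + Rabs (s - a)) / 2)).
- intros x; unfold Rmax; destruct (Rle_dec a x).
  + rewrite Rabs_pos_eq; lra.
  + rewrite Rabs_left; lra.
- apply (continuous_mult (fun s => a + s + Rabs (s - a)) (fun _ => / 2));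
    [|apply continuous_const].
  apply (continuous_plus (V := R_NormedModule) (fun s => a + s) (fun s => Rabs (s - a))).
  + apply (continuous_plus (V := R_NormedModule) (fun _ => a) (fun s => s));
      [apply continuous_const | apply continuous_id].
  + apply (continuous_comp (fun s => s - a) Rabs); [|apply continuous_Rabs].
    apply (continuous_minus (V := R_NormedModule) (fun s => s) (fun _ => a));
      [apply continuous_id | apply continuous_const].
Qed.

(* Evaluating everything at [Rmax a s] turns functions known on [a, oo) into
   continuous functions on R; to the left of [a] the source is frozen. *)
Lemma continuous_truncate (a : R) (f : R -> R) :
  (forall s, a <= s -> continuous f s) -> forall s, continuous (fun s => f (Rmax a s)) s.
Proof.
intros Hf s; apply (continuous_comp (Rmax a) f); [apply continuous_Rmax_const|].
apply Hf, Rmax_l.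
Qed.

(** Picard iteration in the weighted sup norm, with contraction factor 1/2 because [2 * B <= L]. The
    source depends on entry 0 alone, so only that entry is iterated. *)
Lemma volterra (L a A B : R) (f : R -> R -> R) :
  0 <= A -> 0 <= B -> 2 * B <= L ->
  (forall v : R -> R, (forall s, continuous v s) ->
     forall s, continuous (fun s => f (Rmax a s) (v s)) s) ->
  (forall s, a <= s -> Rabs (f s 0) <= A * weight L s) ->
  (forall s x y, a <= s -> Rabs (f s x - f s y) <= B * exp (- s) * Rabs (x - y)) ->
  exists y, (forall s, chain_at y (f (Rmax a s) (y 0%nat (Rmax a s))) s) /\
    weight_bound L a A y.
Proof.
intros HA HB HL Hf H0 Hlip.
assert (HL0 : 0 <= L) by lra.
(* Continuity is asked of the truncation only: the limit of the iterates is controlled on [[a, oo)]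
   alone. *)
set (good := fun v : R -> R => (forall s, continuous (fun s => v (Rmax a s)) s) /\
  exists M, forall s, a <= s -> Rabs (v s) <= M * weight L s).
set (T := fun (v : R -> R) (y : nat -> R -> R) =>
  (forall s, chain_at y (f (Rmax a s) (v (Rmax a s))) s) /\ exists M, weight_bound L a M y).
assert (HfB : forall s x, a <= s -> Rabs (f s x) <= A * weight L s + B * exp (- s) * Rabs x).
{ intros s x Hs; replace (f s x) with (f s 0 + (f s x - f s 0)) by ring.
  apply Rle_trans with (1 := Rabs_triang _ _); apply Rplus_le_compat; [auto|].
  apply Rle_trans with (1 := Hlip s x 0 Hs); rewrite Rminus_0_r; lra. }
assert (HT : forall v, good v -> exists y, T v y).
{ intros v [Hv [M HM]].
  apply (chain_solve L a (A + B * exp (- a) * M) (fun s => f (Rmax a s) (v (Rmax a s)))); [easy| |].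
  - intros s; exact (Hf (fun s => v (Rmax a s)) Hv s).
  - intros s Hs; rewrite Rmax_right by easy.
    apply Rle_trans with (1 := HfB s (v s) Hs).
    rewrite Rmult_plus_distr_r; apply Rplus_le_compat_l.
    rewrite (Rmult_assoc _ M); apply Rmult_le_compat; [|apply Rabs_pos| |auto].
    + apply Rmult_le_pos; [easy | left; apply exp_pos].
    + apply Rmult_le_compat_l; [easy|]; apply exp_le; lra. }
assert (Hgood : forall v y, T v y -> good (y 0%nat)).
{ intros v y [Hy [M HM]]; split.
  - apply continuous_truncate; intros s _.
    eapply chain_continuous; [apply Hy | lia].
  - exists M; intros s Hs; apply HM; [lia | easy]. }
(* The solvability of the linear chain is a bare existence statement; a choice operator makes it an
   iteration map. *)
set (step := fun v => epsilon (inhabits (fun (_ : nat) (_ : R) => 0)) (T v)).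
assert (Hstep : forall v, good v -> T v (step v)).
{ intros v Hv; apply epsilon_spec; auto. }
set (Y := fix Y (n : nat) : nat -> R -> R :=
  match n with 0%nat => fun _ _ => 0 | S n => step (Y n 0%nat) end).
assert (G0 : good (fun _ => 0)).
{ split; [intros s; apply continuous_const|].
  exists 0; intros s _; rewrite Rabs_R0; lra. }
assert (HG : forall n, good (Y n 0%nat)).
{ induction n as [|n IH]; [exact G0|].
  apply Hgood with (Y n 0%nat); now apply Hstep. }
assert (HY : forall n, T (Y n 0%nat) (Y (S n))) by (intros n; now apply Hstep).
(* The contraction: inputs at weighted distance [D] have images at distance [D / 2], in all four
   entries. *)
assert (Hsub : forall v w y z D,
  T v y -> T w z -> 0 <= D ->
  (forall s, a <= s -> Rabs (v s - w s) <= D * weight L s) ->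
  weight_bound L a (D / 2) (lincomb 1 (- 1) y z)).
{ intros v w y z D [Hy [M HM]] [Hz [N HN]] HD Hvw.
  apply (chain_estimate L a _ (M + N) _
    (fun s => 1 * f (Rmax a s) (v (Rmax a s)) + - 1 * f (Rmax a s) (w (Rmax a s))));
    auto; [lra| | |].
  - intros s _; now apply chain_lincomb.
  - intros s Hs; rewrite Rmax_right by easy.
    replace (1 * f s (v s) + - 1 * f s (w s)) with (f s (v s) - f s (w s)) by ring.
    apply Rle_trans with (1 := Hlip s (v s) (w s) Hs).
    generalize (weight_pos L s) (exp_pos (- s)); intros W0 E0.
    apply Rle_trans with (L / 2 * exp (- s) * (D * weight L s)).
    + apply Rmult_le_compat; auto; [nra | apply Rabs_pos | nra].
    + assert (0 <= D * weight L s) by (apply Rmult_le_pos; lra); lra.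
  - intros i s Hi Hs; unfold lincomb.
    specialize (HM i s Hi Hs); specialize (HN i s Hi Hs).
    apply Rle_trans with (1 := Rabs_triang _ _); rewrite !Rabs_mult, Rabs_R1.
    replace (Rabs (- 1)) with 1 by (rewrite Rabs_left; lra); lra. }
assert (Hd : forall n s, a <= s ->
  Rabs (Y (S n) 0%nat s - Y n 0%nat s) <= A * (1 / 2) ^ n * weight L s).
{ induction n as [|n IH]; intros s Hs.
  - destruct (HY 0%nat) as [E [M HM]].
    assert (HB1 : weight_bound L a A (Y 1%nat)).
    { apply (chain_stability L a A B M _ (fun s => f (Rmax a s) (Y 0%nat 0%nat (Rmax a s)))); auto.
      intros r Hr; rewrite Rmax_right by easy; simpl.
      apply Rle_trans with (1 := H0 r Hr).
      assert (0 <= B * exp (- r) * Rabs (step (fun _ => 0) 0%nat r)); [|lra].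
      apply Rmult_le_pos; [|apply Rabs_pos]; apply Rmult_le_pos; [easy|left; apply exp_pos]. }
    specialize (HB1 0%nat s ltac:(lia) Hs).
    change (Y 0%nat 0%nat s) with 0; rewrite Rminus_0_r; simpl pow; lra.
  - assert (Hp : 0 <= A * (1 / 2) ^ n) by (apply Rmult_le_pos; [easy | apply pow_le; lra]).
    generalize (Hsub _ _ _ _ _ (HY (S n)) (HY n) Hp IH 0%nat s ltac:(lia) Hs).
    unfold lincomb.
    replace (1 * Y (S (S n)) 0%nat s + - 1 * Y (S n) 0%nat s)
      with (Y (S (S n)) 0%nat s - Y (S n) 0%nat s) by ring.
    replace (A * (1 / 2) ^ n / 2) with (A * (1 / 2) ^ S n) by (simpl; field); easy. }
assert (Hd2 : forall n k s, a <= s ->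
  Rabs (Y (n + k)%nat 0%nat s - Y n 0%nat s) <= 2 * A * (1 / 2) ^ n * (1 - (1 / 2) ^ k) * weight L s).
{ induction k as [|k IH]; intros s Hs.
  - rewrite Nat.add_0_r, Rminus_diag, Rabs_R0; simpl; lra.
  - rewrite Nat.add_succ_r.
    replace (Y (S (n + k)) 0%nat s - Y n 0%nat s) with
      ((Y (S (n + k)) 0%nat s - Y (n + k)%nat 0%nat s) + (Y (n + k)%nat 0%nat s - Y n 0%nat s))
      by ring.
    apply Rle_trans with (1 := Rabs_triang _ _).
    specialize (IH s Hs); specialize (Hd (n + k)%nat s Hs).
    rewrite pow_add in Hd; simpl pow; lra. }
assert (Hd3 : forall n m s, a <= s -> (n <= m)%nat ->
  Rabs (Y m 0%nat s - Y n 0%nat s) <= 2 * A * (1 / 2) ^ n * weight L s).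
{ intros n m s Hs Hnm; replace m with (n + (m - n))%nat by lia.
  apply Rle_trans with (1 := Hd2 n (m - n)%nat s Hs).
  apply Rmult_le_compat_r; [left; apply weight_pos|].
  assert (0 <= (1 / 2) ^ (m - n)) by (apply pow_le; lra).
  assert (0 <= 2 * A * (1 / 2) ^ n) by (apply Rmult_le_pos; [lra | apply pow_le; lra]).
  nra. }
assert (Hsmall : forall C eps, 0 <= C -> 0 < eps -> exists n, C * (1 / 2) ^ n < eps).
{ intros C eps HC He.
  destruct (pow_lt_1_zero (1 / 2)) with (y := eps / (C + 1)) as [N HN].
  - rewrite Rabs_pos_eq; lra.
  - apply Rdiv_lt_0_compat; lra.
  - exists N; specialize (HN N (le_n N)).
    assert (0 < (1 / 2) ^ N) by (apply pow_lt; lra).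
    rewrite Rabs_pos_eq in HN by lra.
    apply Rlt_div_r in HN; [nra|lra]. }
set (v := fun s => real (Lim_seq (fun n => Y n 0%nat s))).
assert (Hlim : forall s, a <= s -> is_lim_seq (fun n => Y n 0%nat s) (v s)).
{ intros s Hs; apply Lim_seq_correct', ex_lim_seq_cauchy_corr; intros eps.
  destruct (Hsmall (2 * A * weight L s) (eps / 2)) as [N HN].
  - apply Rmult_le_pos; [lra | left; apply weight_pos].
  - generalize (cond_pos eps); lra.
  - exists N; intros n m Hn Hm.
    replace (Y n 0%nat s - Y m 0%nat s)
      with ((Y n 0%nat s - Y N 0%nat s) - (Y m 0%nat s - Y N 0%nat s)) by ring.
    apply Rle_lt_trans with (1 := Rabs_triang _ _); rewrite Rabs_Ropp.
    generalize (Hd3 N n s Hs Hn) (Hd3 N m s Hs Hm); lra. }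
assert (Hv : forall n s, a <= s -> Rabs (v s - Y n 0%nat s) <= 2 * A * (1 / 2) ^ n * weight L s).
{ intros n s Hs.
  assert (H1 : is_lim_seq (fun k => Y (n + k)%nat 0%nat s - Y n 0%nat s) (v s - Y n 0%nat s)).
  { apply is_lim_seq_minus'; [|apply is_lim_seq_const].
    apply (is_lim_seq_ext (fun k => Y (k + n)%nat 0%nat s)).
    - intros k; now rewrite Nat.add_comm.
    - apply (is_lim_seq_incr_n (fun n => Y n 0%nat s)); auto. }
  apply is_lim_seq_abs in H1.
  apply (is_lim_seq_le _ _ _ _ (fun k => Hd3 n (n + k)%nat s Hs ltac:(lia)) H1
    (is_lim_seq_const _)). }
assert (Gv : good v).
{ split.
  (* The weight decreases, so [weight L a] makes the convergence uniform on [[a, oo)], and the limit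
     is continuous. *)
  - intros s0; apply filterlim_locally; intros eps.
    destruct (Hsmall (2 * A * weight L a) (eps / 4)) as [N HN].
    + apply Rmult_le_pos; [lra | left; apply weight_pos].
    + generalize (cond_pos eps); lra.
    + assert (He2 : 0 < eps / 2) by (generalize (cond_pos eps); lra).
      destruct (proj1 (filterlim_locally _ _) (proj1 (HG N) s0) (mkposreal _ He2)) as [d Hd'].
      exists d; intros s Hs; specialize (Hd' s Hs).
      unfold ball in *; simpl in *; unfold AbsRing_ball, abs, minus, plus, opp in *; simpl in *.
      assert (HW : forall r, 2 * A * (1 / 2) ^ N * weight L (Rmax a r) < eps / 4).
      { intros r; apply Rle_lt_trans with (2 := HN).
        assert (weight L (Rmax a r) <= weight L a).
        { unfold weight; apply exp_le; generalize (Rmax_l a r); intros Hr.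
          assert (exp (- Rmax a r) <= exp (- a)) by (apply exp_le; lra); nra. }
        assert (0 <= 2 * A * (1 / 2) ^ N) by (apply Rmult_le_pos; [lra | apply pow_le; lra]).
        nra. }
      generalize (HW s) (HW s0) (Hv N _ (Rmax_l a s)) (Hv N _ (Rmax_l a s0)); intros W1 W2 V1 V2.
      apply Rabs_def2 in Hd'; apply Rabs_le_between in V1; apply Rabs_le_between in V2.
      apply Rabs_def1; lra.
  - exists (2 * A); intros s Hs; specialize (Hv 0%nat s Hs).
    change (Y 0%nat 0%nat s) with 0 in Hv; rewrite Rminus_0_r in Hv; simpl in Hv; lra. }
(* Solving once more with the limit [v] as input yields a full chain; the contraction places its
   entry 0 arbitrarily close to [v], hence equal to it. *)
destruct (HT v Gv) as [y Hy]; exists y.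
assert (Hyv : forall s, a <= s -> y 0%nat s = v s).
{ intros s Hs.
  assert (H : Rabs (y 0%nat s - v s) <= 0).
  { apply (le_of_half_pow _ _ (2 * A * weight L s)); intros n.
    assert (Hp : 0 <= 2 * A * (1 / 2) ^ n).
    { apply Rmult_le_pos; [lra | apply pow_le; lra]. }
    generalize (Hsub _ _ _ _ _ Hy (HY n) Hp (Hv n) 0%nat s ltac:(lia) Hs).
    generalize (Hv (S n) s Hs); unfold lincomb; intros V1 V2.
    replace (y 0%nat s - v s) with
      ((1 * y 0%nat s + - 1 * Y (S n) 0%nat s) - (v s - Y (S n) 0%nat s)) by ring.
    apply Rle_trans with (1 := Rabs_triang _ _); rewrite Rabs_Ropp.
    simpl pow in *; lra. }
  generalize (Rabs_pos (y 0%nat s - v s)); intros H'.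
  assert (HH : Rabs (y 0%nat s - v s) = 0) by lra.
  apply Rabs_eq_0 in HH; lra. }
destruct Hy as [Hy [M HM]].
assert (Hy' : forall s, chain_at y (f (Rmax a s) (y 0%nat (Rmax a s))) s).
{ intros s; rewrite Hyv by apply Rmax_l; apply Hy. }
split; [easy|].
apply (chain_stability L a A B M y (fun s => f (Rmax a s) (y 0%nat (Rmax a s)))); auto.
intros s Hs; rewrite Rmax_right by easy; auto.
Qed.

(** * Decaying solutions of the linearised equation *)

Lemma linear_solution_le (y f : nat -> R -> R) (a b : R) :
  a <= b -> linear_solution y a f -> linear_solution y b f.
Proof.
intros H [F1 F2]; split.
- intros s Hs; apply F1; lra.
- intros i Hi; now apply decays_le with a, F2.
Qed.

Lemma linear_solution_opp (y f : nat -> R -> R) (a : R) :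
  linear_solution y a f -> linear_solution (opp_chain y) a f.
Proof.
intros [F1 F2]; split; [|easy]; intros s Hs.
apply (chain_ext _ (3 * y 0%nat s ^ 2 * f 0%nat s)); [unfold opp_chain; ring | auto].
Qed.

Lemma reflect_opp_solution (y f : nat -> R -> R) (a : R) :
  linear_solution (reflect y) a f -> linear_solution (reflect (opp_chain y)) a f.
Proof.
intros [F1 F2]; split; [|easy]; intros s Hs.
apply (chain_ext _ (3 * reflect y 0%nat s ^ 2 * f 0%nat s));
  [unfold opp_chain, reflect; ring | auto].
Qed.

(** A negative solution is replaced by its opposite, which has the same linearised equation because
    the coefficient [3 u^2] is even in [u]. *)
Lemma nondegenerate_somewhere (y : nat -> R -> R) :
  orbit y -> (exists s, y 0%nat s <> 0) ->
  exists x, forall f g,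
    linear_solution y x f -> linear_solution (reflect y) (- x) g -> reflected_data f g x ->
    exists l, forall i, (i < 4)%nat -> f i x = l * deriv_chain y i x.
Proof.
intros Hy Hs; destruct (orbit_sign y Hy Hs) as [Hpos|Hneg].
- destruct (orbit_maximum y Hy Hpos) as [x [Y1 Y2]].
  exists x; intros f g; now apply nondegenerate.
- assert (Hy' := orbit_opp y Hy).
  assert (Hpos : forall s, 0 < opp_chain y 0%nat s).
  { intros s; unfold opp_chain; specialize (Hneg s); lra. }
  destruct (orbit_maximum _ Hy' Hpos) as [x [Y1 Y2]].
  exists x; intros f g Hf Hg HR.
  destruct (nondegenerate _ f g x Hy' Hpos Y1 Y2) as [l Hl]; auto.
  + now apply linear_solution_opp.
  + now apply reflect_opp_solution.
  + exists (- l); intros i Hi; rewrite Hl by easy.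
    unfold deriv_chain, opp_chain; destruct i as [|[|[|i]]]; ring.
Qed.

Lemma rate_cube (s : R) : rate s ^ 3 = exp (- 2 * s).
Proof.
unfold rate; simpl; rewrite Rmult_1_r, <- !exp_plus; f_equal; field.
Qed.

Lemma rate_square_le (a s : R) : a <= s -> rate s ^ 2 <= exp (- a / 3) * exp (- s).
Proof.
intros Hs; unfold rate; simpl; rewrite Rmult_1_r, <- !exp_plus; apply exp_le; lra.
Qed.

Lemma weight_le_rate (L a : R) :
  0 <= L -> exists W, 0 <= W /\ forall s, a <= s -> weight L s <= W * rate s ^ 3.
Proof.
intros HL; exists (exp (L * exp (- a))); split; [left; apply exp_pos|].
intros s Hs; rewrite rate_cube; now apply weight_le.
Qed.

Lemma weight_ge_rate (L s : R) : 0 <= L -> rate s ^ 3 <= weight L s.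
Proof. intros HL; rewrite rate_cube; now apply weight_ge. Qed.

(** A decaying solution [p] of the constant-coefficient equation is corrected by a [v] with source
    [3 u^2 (p + v)]. As [3 u^2 p] is of order [rate ^ 3 = exp (- 2 s)], so is the correction, and
    the leading behaviour of [p] survives. *)
Lemma linear_solution_perturb (y p : nat -> R -> R) (a : R) :
  orbit y -> (forall s, chain_at p 0 s) -> chain_decays a p ->
  exists f M, linear_solution y a f /\
    forall i s, (i < 4)%nat -> a <= s -> Rabs (f i s - p i s) <= M * exp (- 2 * s).
Proof.
intros Hy Hp Hpd.
destruct (decays_nonneg a (y 0%nat)) as [C [HC0 HC]]; [apply Hy; lia|].
destruct (chain_decays_bound a p Hpd) as [D [HD0 HD]].
set (B := 3 * C ^ 2 * exp (- a / 3)).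
assert (HB : 0 <= B).
{ unfold B; apply Rmult_le_pos; [generalize (pow2_ge_0 C); lra | left; apply exp_pos]. }
set (L := 2 * B); assert (HL : 0 <= L) by (unfold L; lra).
assert (HC2 : forall s, a <= s -> 3 * y 0%nat s ^ 2 <= 3 * C ^ 2 * rate s ^ 2).
{ intros s Hs; specialize (HC s Hs).
  assert (Rabs (y 0%nat s) ^ 2 <= (C * rate s) ^ 2).
  { apply pow_incr; split; [apply Rabs_pos | easy]. }
  rewrite pow2_abs in H; rewrite Rpow_mult_distr in H; lra. }
destruct (volterra L a (3 * C ^ 2 * D) B (fun s x => 3 * y 0%nat s ^ 2 * (p 0%nat s + x)))
  as [v [Hv1 Hv2]]; auto.
- apply Rmult_le_pos; [generalize (pow2_ge_0 C); lra | easy].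
- unfold L; lra.
- intros v Hv s.
  apply (continuous_mult (fun s => 3 * y 0%nat (Rmax a s) ^ 2)
    (fun s => p 0%nat (Rmax a s) + v s)).
  + apply (continuous_comp (fun s => y 0%nat (Rmax a s)) (fun z => 3 * z ^ 2)).
    * apply (continuous_truncate a (y 0%nat)); intros r _; apply (orbit_continuous y); auto; lia.
    * eapply derivable_cont with (l := 6 * y 0%nat (Rmax a s)); auto_derive; [easy|ring].
  + apply (continuous_plus (V := R_NormedModule) (fun s => p 0%nat (Rmax a s)) v); [|apply Hv].
    apply (continuous_truncate a (p 0%nat)); intros r _.
    eapply chain_continuous; [apply Hp | lia].
- intros s Hs; rewrite Rplus_0_r, Rabs_mult.
  rewrite (Rabs_pos_eq (3 * _)) by (generalize (pow2_ge_0 (y 0%nat s)); lra).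
  apply Rle_trans with ((3 * C ^ 2 * rate s ^ 2) * (D * rate s)).
  + apply Rmult_le_compat; [generalize (pow2_ge_0 (y 0%nat s)); lra | apply Rabs_pos | |].
    * now apply HC2.
    * apply HD; [lia | easy].
  + replace (3 * C ^ 2 * rate s ^ 2 * (D * rate s)) with (3 * C ^ 2 * D * rate s ^ 3) by ring.
    apply Rmult_le_compat_l; [|now apply weight_ge_rate].
    apply Rmult_le_pos; [generalize (pow2_ge_0 C); lra | easy].
- intros s u w Hs.
  replace (3 * y 0%nat s ^ 2 * (p 0%nat s + u) - 3 * y 0%nat s ^ 2 * (p 0%nat s + w))
    with (3 * y 0%nat s ^ 2 * (u - w)) by ring.
  rewrite Rabs_mult; apply Rmult_le_compat_r; [apply Rabs_pos|].
  rewrite (Rabs_pos_eq (3 * _)) by (generalize (pow2_ge_0 (y 0%nat s)); lra).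
  apply Rle_trans with (1 := HC2 s Hs); unfold B.
  rewrite (Rmult_assoc (3 * C ^ 2)); apply Rmult_le_compat_l; [generalize (pow2_ge_0 C); lra|].
  now apply rate_square_le.
- destruct (weight_le_rate L a HL) as [W [HW0 HW]].
  assert (HM : forall i s, (i < 4)%nat -> a <= s ->
    Rabs (v i s) <= 3 * C ^ 2 * D * W * exp (-2 * s)).
  { intros i s Hi Hs; apply Rle_trans with (1 := Hv2 i s Hi Hs).
    rewrite (Rmult_assoc _ W); apply Rmult_le_compat_l.
    - apply Rmult_le_pos; [generalize (pow2_ge_0 C); lra | easy].
    - rewrite <- rate_cube; auto. }
  exists (lincomb 1 1 p v), (3 * C ^ 2 * D * W); split; [split|].
  + intros s Hs; specialize (Hv1 s); rewrite Rmax_right in Hv1 by easy.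
    apply (chain_ext _ (1 * 0 + 1 * (3 * y 0%nat s ^ 2 * (p 0%nat s + v 0%nat s))));
      [unfold lincomb; ring | now apply chain_lincomb].
  + apply chain_decays_lincomb; [easy|].
    intros i Hi; exists (3 * C ^ 2 * D * W * rate a ^ 2); intros s Hs.
    apply Rle_trans with (1 := HM i s Hi Hs); rewrite <- rate_cube.
    rewrite (Rmult_assoc _ (rate a ^ 2)); apply Rmult_le_compat_l.
    * apply Rmult_le_pos; [|easy].
      apply Rmult_le_pos; [generalize (pow2_ge_0 C); lra | easy].
    * generalize (rate_pos s) (rate_le a s Hs); intros R0 R1.
      replace (rate s ^ 3) with (rate s ^ 2 * rate s) by ring.
      apply Rmult_le_compat_r; [lra|]; apply pow_incr; lra.
  + intros i s Hi Hs; unfold lincomb.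
    replace (1 * p i s + 1 * v i s - p i s) with (v i s) by ring; auto.
Qed.

Lemma decays_exp_opp (a : R) : decays a (fun s => exp (- s)).
Proof.
exists (exp (- a / 3)); intros s Hs; rewrite Rabs_pos_eq by (left; apply exp_pos).
unfold rate; rewrite <- exp_plus; apply exp_le; lra.
Qed.

Lemma decays_id_exp_opp (a : R) : decays a (fun s => s * exp (- s)).
Proof.
apply decays_extend with 0.
- intros s _; eapply derivable_cont with (l := exp (- s) - s * exp (- s)).
  auto_derive; [easy|ring].
- exists 3; intros s Hs.
  rewrite Rabs_pos_eq by (apply Rmult_le_pos; [easy | left; apply exp_pos]).
  replace (exp (- s)) with (exp (- (s / 3)) * rate s)
    by (unfold rate; rewrite <- exp_plus; f_equal; field).
  rewrite <- Rmult_assoc; apply Rmult_le_compat_r; [left; apply rate_pos|].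
  rewrite exp_Ropp; apply Rle_div_l; [apply exp_pos|].
  generalize (exp_ineq1_le (s / 3)); lra.
Qed.

Lemma exp_bound_0 (c K a : R) :
  (forall s, a <= s -> Rabs (c * exp (- s)) <= K * exp (- 2 * s)) -> c = 0.
Proof.
intros H.
assert (HK : forall s, a <= s -> Rabs c <= K * exp (- 1 * s)).
{ intros s Hs; specialize (H s Hs).
  rewrite Rabs_mult, (Rabs_pos_eq (exp _)) in H by (left; apply exp_pos).
  apply Rmult_le_reg_r with (exp (- s)); [apply exp_pos|].
  rewrite Rmult_assoc, <- exp_plus.
  replace (- 1 * s + - s) with (- 2 * s) by ring; easy. }
generalize (le_0_of_decay K 1 a (Rabs c) Rlt_0_1 HK) (Rabs_pos c); intros H1 H2.
apply Rabs_eq_0; lra.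
Qed.

Lemma linear_solution_zero (y f : nat -> R -> R) (a x : R) :
  orbit y -> linear_solution y a f -> a <= x ->
  (forall i, (i < 4)%nat -> f i x = 0) ->
  forall i s, (i < 4)%nat -> a <= s -> f i s = 0.
Proof.
intros Hy Hf Hx H0 i s Hi Hs.
destruct (orbit_bounded y a Hy) as [B [_ HB]].
apply (chain_zero f (fun s => 3 * y 0%nat s ^ 2) a (Rmax x s) x (3 * B)); auto.
- split; [easy | apply Rmax_l].
- intros r [Hr _]; now apply Hf.
- intros r [Hr _]; specialize (HB r Hr); lra.
- split; [easy | apply Rmax_r].
Qed.

Lemma two_decaying_solutions (y : nat -> R -> R) (a x : R) :
  orbit y -> a <= x ->
  exists f g, linear_solution y a f /\ linear_solution y a g /\
    forall c d, (forall i, (i < 4)%nat -> c * f i x + d * g i x = 0) -> c = 0 /\ d = 0.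
Proof.
intros Hy Hx.
(* Chains of [exp (- s)] and [s * exp (- s)], the decaying solutions of [(D^2 - 1)^2 p = 0]. *)
set (p := fun (i : nat) (s : R) => match i with 0%nat => exp (- s) | _ => 0 end).
set (q := fun (i : nat) (s : R) => match i with
  | 0%nat => s * exp (- s) | 1%nat => exp (- s) | 2%nat => - 2 * exp (- s) | _ => 0 end).
destruct (linear_solution_perturb y p a Hy) as [f [M [Hf HM]]].
{ intros s; split; [|split; [|split]]; unfold p; auto_derive; try easy; ring. }
{ intros i Hi; unfold p; destruct i as [|i]; [apply decays_exp_opp|].
  exists 0; intros s _; rewrite Rabs_R0; lra. }
destruct (linear_solution_perturb y q a Hy) as [g [N [Hg HN]]].
{ intros s; split; [|split; [|split]]; unfold q; auto_derive; try easy; ring. }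
{ intros i Hi; unfold q; destruct i as [|[|[|i]]].
  - apply decays_id_exp_opp.
  - apply decays_exp_opp.
  - apply decays_scal, decays_exp_opp.
  - exists 0; intros s _; rewrite Rabs_R0; lra. }
exists f, g; split; [easy|split; [easy|]]; intros c d H0.
assert (HZ : forall i s, (i < 4)%nat -> a <= s -> c * f i s + d * g i s = 0).
{ intros i s Hi Hs.
  apply (linear_solution_zero y (lincomb c d f g) a x); auto.
  now apply linear_solution_lincomb. }
assert (HZ' : forall i s, (i < 4)%nat -> a <= s ->
  Rabs (c * p i s + d * q i s) <= (Rabs c * M + Rabs d * N) * exp (- 2 * s)).
{ intros i s Hi Hs.
  replace (c * p i s + d * q i s) with (- (c * (f i s - p i s) + d * (g i s - q i s)))
    by (generalize (HZ i s Hi Hs); lra).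
  rewrite Rabs_Ropp; apply Rle_trans with (1 := Rabs_triang _ _); rewrite !Rabs_mult.
  rewrite Rmult_plus_distr_r, !Rmult_assoc; apply Rplus_le_compat;
    (apply Rmult_le_compat_l; [apply Rabs_pos | auto]). }
(* Entry 1 of [p] is zero while that of [q] is [exp (- s)], so it isolates [d]; entry 0 then
   isolates [c]. Neither multiple can be of order [exp (- 2 s)] unless it vanishes. *)
assert (Hd : d = 0).
{ apply (exp_bound_0 d (Rabs c * M + Rabs d * N) a); intros s Hs.
  generalize (HZ' 1%nat s ltac:(lia) Hs); unfold p, q; now rewrite Rmult_0_r, Rplus_0_l. }
split; [|easy].
apply (exp_bound_0 c (Rabs c * M + Rabs d * N) a); intros s Hs.
generalize (HZ' 0%nat s ltac:(lia) Hs); unfold p, q.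
now rewrite Hd at 1; rewrite Rmult_0_l, Rplus_0_r.
Qed.

(** The decaying solutions contain a plane, so they are not all multiples of [u']. *)
Lemma transversal_direction (y : nat -> R -> R) (a x : R) :
  orbit y -> a <= x ->
  exists f, linear_solution y a f /\
    ~ exists l, forall i, (i < 4)%nat -> f i x = l * deriv_chain y i x.
Proof.
intros Hy Hx; destruct (two_decaying_solutions y a x Hy Hx) as [f [g [Hf [Hg H]]]].
apply NNPP; intros HN.
assert (Hall : forall h, linear_solution y a h ->
  exists l, forall i, (i < 4)%nat -> h i x = l * deriv_chain y i x).
{ intros h Hh; apply NNPP; intros Hh'; apply HN; now exists h. }
destruct (Hall f Hf) as [l Hl]; destruct (Hall g Hg) as [m Hm].
destruct (H m (- l)) as [H1 H2].
{ intros i Hi; rewrite Hl, Hm by easy; ring. }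
destruct (H 1 0) as [H3 _]; [|lra].
intros i Hi; rewrite Hl by easy; replace l with 0 by lra; ring.
Qed.

Lemma deriv_chain_nonzero (y : nat -> R -> R) (x : R) :
  orbit y -> (exists s, y 0%nat s <> 0) ->
  ~ (forall i, (i < 4)%nat -> deriv_chain y i x = 0).
Proof.
intros Hy Hs H.
assert (H0 := H 0%nat ltac:(lia)); assert (H1 := H 1%nat ltac:(lia)).
unfold deriv_chain in H0, H1.
apply (critical_second_derivative y x Hy); [now apply orbit_nonzero|lra|lra].
Qed.

(** A relation at [x] propagates to [x0] by uniqueness. There [c0 u' + c1 f] equals a solution
    decaying at [-oo], hence is [l u'] by nondegeneracy. Back at [x] this gives [c1 = 0] since [f]
    is not a multiple of [u'], then [c2 = 0] likewise, and [c0 = 0] since [u'] and [u''] never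
    vanish together. *)
Lemma independent_directions (y : nat -> R -> R) (x : R) :
  orbit y -> (exists s, y 0%nat s <> 0) ->
  exists f g, linear_solution y x f /\ linear_solution (reflect y) (- x) g /\
    forall c0 c1 c2,
      (forall i, (i < 4)%nat -> c0 * deriv_chain y i x + c1 * f i x + c2 * reflect g i x = 0) ->
      c0 = 0 /\ c1 = 0 /\ c2 = 0.
Proof.
intros Hy Hs.
destruct (nondegenerate_somewhere y Hy Hs) as [x0 Hnd].
(* [f] is constructed from [a] to the right and the reflection of [g] from [b] to the left, so that
   both live on an interval containing [x] and [x0]. *)
set (a := Rmin x x0); set (b := Rmax x x0).
assert (Hax : a <= x) by apply Rmin_l; assert (Hax0 : a <= x0) by apply Rmin_r.
assert (Hxb : x <= b) by apply Rmax_l; assert (Hx0b : x0 <= b) by apply Rmax_r.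
destruct (transversal_direction y a x Hy Hax) as [f [Hf Hfd]].
destruct (transversal_direction (reflect y) (- b) (- x) (orbit_reflect y Hy)) as [g [Hg Hgd]];
  [lra|].
exists f, g; split; [now apply linear_solution_le with a|split].
{ apply linear_solution_le with (- b); [lra|easy]. }
intros c0 c1 c2 H0.
assert (Hd := deriv_chain_solution y a Hy).
set (h := lincomb c0 c1 (deriv_chain y) f).
assert (Hh : linear_solution y a h) by now apply linear_solution_lincomb.
assert (HR0 : forall i, (i < 4)%nat -> h i x0 + c2 * reflect g i x0 = 0).
{ intros i Hi; destruct (orbit_bounded y a Hy) as [B [_ HB]].
  replace (h i x0 + c2 * reflect g i x0) with (lincomb 1 c2 h (reflect g) i x0)
    by (unfold lincomb; ring).
  apply (chain_zero (lincomb 1 c2 h (reflect g)) (fun s => 3 * y 0%nat s ^ 2) a b x (3 * B));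
    auto.
  - intros s Hsab.
    apply (chain_ext _ (1 * (3 * y 0%nat s ^ 2 * h 0%nat s)
      + c2 * (3 * reflect y 0%nat (- s) ^ 2 * g 0%nat (- s)))).
    + unfold lincomb, reflect; rewrite Ropp_involutive; ring.
    + apply chain_lincomb; [apply Hh; lra|].
      apply chain_reflect, Hg; lra.
  - intros s [Hsa _]; specialize (HB s Hsa); lra.
  - intros j Hj; rewrite <- (H0 j Hj); unfold h, lincomb; ring. }
destruct (Hnd h (lincomb (- c2) 0 g g)) as [l Hl].
{ now apply linear_solution_le with a. }
{ apply linear_solution_lincomb; apply linear_solution_le with (- b); auto; lra. }
{ assert (R0 := HR0 0%nat ltac:(lia)); assert (R1 := HR0 1%nat ltac:(lia)).
  assert (R2 := HR0 2%nat ltac:(lia)); assert (R3 := HR0 3%nat ltac:(lia)).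
  unfold reflect in R0, R1, R2, R3; unfold reflected_data, lincomb.
  split; [lra|split; [lra|split; lra]]. }
assert (Hx : forall i, (i < 4)%nat -> (c0 - l) * deriv_chain y i x + c1 * f i x = 0).
{ intros i Hi.
  replace ((c0 - l) * deriv_chain y i x + c1 * f i x)
    with (lincomb 1 (- l) h (deriv_chain y) i x) by (unfold h, lincomb; ring).
  apply (linear_solution_zero y (lincomb 1 (- l) h (deriv_chain y)) a x0); auto.
  - now apply linear_solution_lincomb.
  - intros j Hj; unfold lincomb; rewrite Hl by easy; ring. }
assert (Hc1 : c1 = 0).
{ destruct (Req_dec c1 0) as [|Hc1]; [easy|exfalso; apply Hfd].
  exists ((l - c0) / c1); intros i Hi; specialize (Hx i Hi).
  apply Rmult_eq_reg_l with c1; [|easy]; field_simplify; [lra|easy]. }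
subst c1.
assert (Hc2 : c2 = 0).
{ destruct (Req_dec c2 0) as [|Hc2]; [easy|exfalso; apply Hgd].
  exists (c0 / c2).
  assert (R0 := H0 0%nat ltac:(lia)); assert (R1 := H0 1%nat ltac:(lia)).
  assert (R2 := H0 2%nat ltac:(lia)); assert (R3 := H0 3%nat ltac:(lia)).
  unfold reflect, deriv_chain in R0, R1, R2, R3.
  intros i Hi; unfold deriv_chain, reflect; rewrite Ropp_involutive.
  apply Rmult_eq_reg_l with c2; [|easy].
  rewrite <- Rmult_assoc; replace (c2 * (c0 / c2)) with c0 by (field; easy).
  destruct i as [|[|[|[|i]]]]; [nra ..|lia]. }
subst c2; split; [|easy].
destruct (Req_dec c0 0) as [|Hc0]; [easy|exfalso].
apply (deriv_chain_nonzero y x Hy Hs); intros i Hi; specialize (H0 i Hi).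
apply Rmult_eq_reg_l with c0; [lra|easy].
Qed.

(** * Perturbation of the orbit inside the stable manifold *)

Lemma continuous_Rplus (f g : R -> R) (s : R) :
  continuous f s -> continuous g s -> continuous (fun s => f s + g s) s.
Proof. apply (continuous_plus (V := R_NormedModule)). Qed.

Lemma continuous_Rminus (f g : R -> R) (s : R) :
  continuous f s -> continuous g s -> continuous (fun s => f s - g s) s.
Proof. apply (continuous_minus (V := R_NormedModule)). Qed.

Lemma continuous_Rmult (f g : R -> R) (s : R) :
  continuous f s -> continuous g s -> continuous (fun s => f s * g s) s.
Proof. apply (continuous_mult (K := R_AbsRing)). Qed.

Lemma continuous_pow (f : R -> R) (n : nat) (s : R) :
  continuous f s -> continuous (fun s => f s ^ n) s.
Proof.
intros H; induction n as [|n IH]; [apply continuous_const|].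
now apply (continuous_Rmult f (fun s => f s ^ n)).
Qed.

Lemma continuous_abs (f : R -> R) (s : R) :
  continuous f s -> continuous (fun s => Rabs (f s)) s.
Proof. intros H; apply (continuous_comp f Rabs); [easy | apply continuous_Rabs]. Qed.

Ltac cont :=
  repeat first [ assumption | apply continuous_const | apply continuous_Rminus
    | apply continuous_Rplus | apply continuous_Rmult | apply continuous_pow
    | apply continuous_abs ].

(** For [r >= 0], the projection onto [[- r, r]], written with absolute values so that the tactic
    [cont] handles its continuity. *)
Definition clamp (r x : R) : R := (Rabs (x + r) - Rabs (x - r)) * / 2.

Lemma clamp_bound (r x : R) : 0 <= r -> Rabs (clamp r x) <= r.
Proof.
intros Hr; unfold clamp; apply Rabs_le.
unfold Rabs; destruct (Rcase_abs (x + r)), (Rcase_abs (x - r)); lra.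
Qed.

Lemma clamp_id (r x : R) : Rabs x <= r -> clamp r x = x.
Proof.
intros H; apply Rabs_le_between in H; unfold clamp.
rewrite Rabs_pos_eq, Rabs_left1 by lra; field.
Qed.

Lemma clamp_lipschitz (r x y : R) : 0 <= r -> Rabs (clamp r x - clamp r y) <= Rabs (x - y).
Proof.
intros Hr; unfold clamp, Rabs.
destruct (Rcase_abs (x + r)), (Rcase_abs (x - r)), (Rcase_abs (y + r)), (Rcase_abs (y - r)),
  (Rcase_abs (x - y)); match goal with |- context [Rcase_abs ?z] => destruct (Rcase_abs z) end; lra.
Qed.

Lemma Rabs_mult_le (x y p q : R) :
  Rabs x <= p -> Rabs y <= q -> Rabs (x * y) <= p * q.
Proof.
intros Hx Hy; rewrite Rabs_mult; apply Rmult_le_compat; try easy; apply Rabs_pos.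
Qed.

Lemma Rabs_plus_le (x y p q : R) :
  Rabs x <= p -> Rabs y <= q -> Rabs (x + y) <= p + q.
Proof. intros Hx Hy; apply Rle_trans with (1 := Rabs_triang _ _); lra. Qed.

Lemma cube_lipschitz (m x y : R) :
  Rabs x <= m -> Rabs y <= m -> Rabs (x ^ 3 - y ^ 3) <= 3 * m ^ 2 * Rabs (x - y).
Proof.
intros Hx Hy; replace (x ^ 3 - y ^ 3) with ((x * x + x * y + y * y) * (x - y)) by ring.
apply Rabs_mult_le; [|lra].
replace (3 * m ^ 2) with (m * m + m * m + m * m) by ring.
repeat apply Rabs_plus_le; now apply Rabs_mult_le.
Qed.

Lemma square_lipschitz (m x y : R) :
  Rabs x <= m -> Rabs y <= m -> Rabs (x ^ 2 - y ^ 2) <= 2 * m * Rabs (x - y).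
Proof.
intros Hx Hy; replace (x ^ 2 - y ^ 2) with ((x + y) * (x - y)) by ring.
apply Rabs_mult_le; [|lra].
replace (2 * m) with (m + m) by ring; now apply Rabs_plus_le.
Qed.

Lemma weight_bound_lincomb (L a M N : R) (y z : nat -> R -> R) (c : R) :
  weight_bound L a M y -> weight_bound L a N z ->
  weight_bound L a (M + Rabs c * N) (lincomb 1 c y z).
Proof.
intros HM HN i s Hi Hs; unfold lincomb; rewrite Rmult_plus_distr_r, Rmult_1_l.
apply Rabs_plus_le; [now apply HM|].
rewrite Rabs_mult, Rmult_assoc; apply Rmult_le_compat_l; [apply Rabs_pos | now apply HN].
Qed.

(** The source that [v] must have for [u + t f + v] to solve the nonlinear equation, when [u] solves
    it and [f] solves the linearised one. *)
Definition perturbation_source (u f v t : R) : R := (u + t * f + v) ^ 3 - u ^ 3 - 3 * u ^ 2 * (t * f).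

(* Clamping [t f + v] to [[- rate, rate]] makes the source globally Lipschitz, as
   [volterra] requires; for small [t] the clamp is inactive at the fixed point. *)
Lemma perturbed_solution (y f : nat -> R -> R) (a C L W t : R) :
  0 <= C -> 0 <= W ->
  6 * (C + 1) ^ 2 * exp (- a / 3) <= L ->
  (forall s, a <= s -> continuous (y 0%nat) s /\ Rabs (y 0%nat s) <= C * rate s) ->
  (forall s, a <= s -> continuous (f 0%nat) s /\ Rabs (f 0%nat s) <= C * rate s) ->
  (forall s, a <= s -> weight L s <= W * rate s) ->
  Rabs t * (C + 4 * C ^ 3 * W + 1) <= 1 ->
  exists v, (forall s, a <= s ->
      chain_at v (perturbation_source (y 0%nat s) (f 0%nat s) (v 0%nat s) t) s) /\
    weight_bound L a (4 * C ^ 3 * t ^ 2) v.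
Proof.
intros HC HW HL Hy Hf HWt Ht.
(* The clamped argument has size at most [(C + 1) * rate s], where the cube has Lipschitz constant
   [3 * ((C + 1) * rate s) ^ 2 <= B * exp (- s)]. *)
set (B := 3 * (C + 1) ^ 2 * exp (- a / 3)).
assert (HC3 : 0 <= C ^ 3) by now apply pow_le.
assert (HB : 0 <= B).
{ unfold B; apply Rmult_le_pos; [generalize (pow2_ge_0 (C + 1)); lra | left; apply exp_pos]. }
assert (HtC : Rabs t * C <= 1 /\ Rabs t <= 1 /\ Rabs t * C + Rabs t * (4 * C ^ 3 * W) <= 1).
{ generalize (Rabs_pos t); intros Hp.
  assert (0 <= 4 * C ^ 3 * W) by (apply Rmult_le_pos; lra).
  assert (0 <= Rabs t * (4 * C ^ 3 * W)) by now apply Rmult_le_pos.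
  assert (0 <= Rabs t * C) by now apply Rmult_le_pos.
  lra. }
destruct HtC as [Ht1 [Ht2 Ht3]].
assert (Htf : forall s, a <= s -> Rabs (t * f 0%nat s) <= Rabs t * (C * rate s)).
{ intros s Hs; apply Rabs_mult_le; [lra | now apply Hf]. }
assert (Htf' : forall s, a <= s -> Rabs (t * f 0%nat s) <= rate s).
{ intros s Hs; apply Rle_trans with (1 := Htf s Hs); generalize (rate_pos s); nra. }
destruct (volterra L a (4 * C ^ 3 * t ^ 2) B
  (fun s x => (y 0%nat s + clamp (rate s) (t * f 0%nat s + x)) ^ 3
     - y 0%nat s ^ 3 - 3 * y 0%nat s ^ 2 * (t * f 0%nat s))) as [v [Hv1 Hv2]]; auto.
- apply Rmult_le_pos; [lra | apply pow2_ge_0].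
- unfold B; lra.
- intros v Hv s; unfold clamp.
  assert (C1 : continuous (fun s => y 0%nat (Rmax a s)) s).
  { apply (continuous_truncate a (y 0%nat)); intros r Hr; now apply Hy. }
  assert (C2 : continuous (fun s => f 0%nat (Rmax a s)) s).
  { apply (continuous_truncate a (f 0%nat)); intros r Hr; now apply Hf. }
  assert (C3 : continuous (fun s => rate (Rmax a s)) s).
  { apply (continuous_truncate a rate); intros r _; unfold rate.
    eapply derivable_cont with (l := - (2 / 3) * exp (- (2 / 3) * r)); auto_derive; [easy|ring]. }
  assert (C4 := Hv s).
  cont.
- intros s Hs; rewrite Rplus_0_r, clamp_id by auto.
  (* At [v = 0] the terms linear in [t] cancel, so the source is quadratic in [t]; with
     [Rabs t <= 1] the bound is [4 * C ^ 3 * t ^ 2 * rate s ^ 3]. *)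
  replace ((y 0%nat s + t * f 0%nat s) ^ 3 - y 0%nat s ^ 3 - 3 * y 0%nat s ^ 2 * (t * f 0%nat s))
    with (((t * f 0%nat s) * (t * f 0%nat s)) * (3 * y 0%nat s + t * f 0%nat s)) by ring.
  apply Rle_trans with (((Rabs t * (C * rate s)) * (Rabs t * (C * rate s)))
    * (3 * (C * rate s) + 1 * (C * rate s))).
  + apply Rabs_mult_le; [apply Rabs_mult_le; auto|].
    apply Rabs_plus_le.
    * apply Rabs_mult_le; [rewrite Rabs_pos_eq; lra | now apply Hy].
    * apply Rabs_mult_le; [easy | now apply Hf].
  + replace (Rabs t * (C * rate s) * (Rabs t * (C * rate s)) * (3 * (C * rate s) + 1 * (C * rate s)))
      with (4 * C ^ 3 * Rabs t ^ 2 * rate s ^ 3) by ring.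
    rewrite pow2_abs; apply Rmult_le_compat_l.
    * apply Rmult_le_pos; [lra | apply pow2_ge_0].
    * apply weight_ge_rate; unfold B in HB; lra.
- intros s p q Hs; generalize (rate_pos s); intros Hr.
  match goal with |- Rabs ?e <= _ =>
    replace e with ((y 0%nat s + clamp (rate s) (t * f 0%nat s + p)) ^ 3
      - (y 0%nat s + clamp (rate s) (t * f 0%nat s + q)) ^ 3) by ring end.
  apply Rle_trans with (3 * ((C + 1) * rate s) ^ 2 * Rabs (p - q)).
  + eapply Rle_trans; [apply (cube_lipschitz ((C + 1) * rate s))|].
    * rewrite Rmult_plus_distr_r, Rmult_1_l; apply Rabs_plus_le; [now apply Hy|].
      apply clamp_bound; lra.
    * rewrite Rmult_plus_distr_r, Rmult_1_l; apply Rabs_plus_le; [now apply Hy|].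
      apply clamp_bound; lra.
    * apply Rmult_le_compat_l; [generalize (pow2_ge_0 ((C + 1) * rate s)); lra|].
      replace (y 0%nat s + clamp (rate s) (t * f 0%nat s + p)
        - (y 0%nat s + clamp (rate s) (t * f 0%nat s + q)))
        with (clamp (rate s) (t * f 0%nat s + p) - clamp (rate s) (t * f 0%nat s + q)) by ring.
      apply Rle_trans with (1 := clamp_lipschitz (rate s) _ _ (Rlt_le _ _ Hr)).
      right; f_equal; ring.
  + apply Rmult_le_compat_r; [apply Rabs_pos|].
    rewrite Rpow_mult_distr; unfold B.
    rewrite <- Rmult_assoc, (Rmult_assoc (3 * (C + 1) ^ 2)).
    apply Rmult_le_compat_l; [generalize (pow2_ge_0 (C + 1)); lra | now apply rate_square_le].
- exists v; split; [|easy]; intros s Hs.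
  specialize (Hv1 s); rewrite Rmax_right in Hv1 by easy; rewrite clamp_id in Hv1.
  + unfold perturbation_source; rewrite Rplus_assoc; exact Hv1.
  (* The clamp is inactive: the smallness of [t] keeps [t f + v] below [rate s]. *)
  + apply Rle_trans with (Rabs t * (C * rate s) + 4 * C ^ 3 * t ^ 2 * (W * rate s)).
    * apply Rabs_plus_le; [auto|].
      apply Rle_trans with (1 := Hv2 0%nat s ltac:(lia) Hs).
      apply Rmult_le_compat_l; [|auto].
      apply Rmult_le_pos; [lra | apply pow2_ge_0].
    * rewrite <- (pow2_abs t).
      replace (Rabs t * (C * rate s) + 4 * C ^ 3 * Rabs t ^ 2 * (W * rate s))
        with ((Rabs t * C + Rabs t * (Rabs t * (4 * C ^ 3 * W))) * rate s) by ring.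
      generalize (rate_pos s); intros Hr.
      rewrite <- (Rmult_1_l (rate s)) at 2; apply Rmult_le_compat_r; [lra|].
      assert (0 <= Rabs t * (4 * C ^ 3 * W)).
      { apply Rmult_le_pos; [apply Rabs_pos|]; apply Rmult_le_pos; lra. }
      assert (Rabs t * (Rabs t * (4 * C ^ 3 * W)) <= 1 * (Rabs t * (4 * C ^ 3 * W)))
        by now apply Rmult_le_compat_r.
      lra.
Qed.

(** With [w = t f + v], the source is the formal [t]-derivative of [perturbation_source], so [V] is
    the candidate for the derivative of [v] in [t]. The bound linear in [D] makes it vanish at
    [t = 0]. *)
Lemma linearized_solution (y f : nat -> R -> R) (w : R -> R) (a C L D : R) :
  0 <= C -> 0 <= D -> D <= 1 ->
  6 * (C + 1) ^ 2 * exp (- a / 3) <= L ->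
  (forall s, a <= s -> continuous (y 0%nat) s /\ Rabs (y 0%nat s) <= C * rate s) ->
  (forall s, a <= s -> continuous (f 0%nat) s /\ Rabs (f 0%nat s) <= C * rate s) ->
  (forall s, a <= s -> continuous w s /\ Rabs (w s) <= D * rate s) ->
  exists V, (forall s, a <= s ->
      chain_at V (3 * (y 0%nat s + w s) ^ 2 * (f 0%nat s + V 0%nat s)
                  - 3 * y 0%nat s ^ 2 * f 0%nat s) s) /\
    weight_bound L a (3 * (2 * C + 1) * C * D) V.
Proof.
intros HC HD HD1 HL Hy Hf Hw.
set (B := 3 * (C + 1) ^ 2 * exp (- a / 3)).
assert (HB : 0 <= B).
{ unfold B; apply Rmult_le_pos; [generalize (pow2_ge_0 (C + 1)); lra | left; apply exp_pos]. }
assert (HA : 0 <= 3 * (2 * C + 1) * C * D).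
{ repeat apply Rmult_le_pos; lra. }
destruct (volterra L a (3 * (2 * C + 1) * C * D) B
  (fun s x => 3 * (y 0%nat s + w s) ^ 2 * (f 0%nat s + x) - 3 * y 0%nat s ^ 2 * f 0%nat s))
  as [V [HV1 HV2]]; auto.
- unfold B; lra.
- intros v Hv s.
  assert (C1 : continuous (fun s => y 0%nat (Rmax a s)) s).
  { apply (continuous_truncate a (y 0%nat)); intros r Hr; now apply Hy. }
  assert (C2 : continuous (fun s => f 0%nat (Rmax a s)) s).
  { apply (continuous_truncate a (f 0%nat)); intros r Hr; now apply Hf. }
  assert (C3 : continuous (fun s => w (Rmax a s)) s).
  { apply (continuous_truncate a w); intros r Hr; now apply Hw. }
  assert (C4 := Hv s).
  cont.
- intros s Hs.
  destruct (Hy s Hs) as [_ Yb]; destruct (Hf s Hs) as [_ Fb]; destruct (Hw s Hs) as [_ Wb].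
  generalize (rate_pos s); intros Hr.
  replace (3 * (y 0%nat s + w s) ^ 2 * (f 0%nat s + 0) - 3 * y 0%nat s ^ 2 * f 0%nat s)
    with (3 * (((2 * y 0%nat s + w s) * f 0%nat s) * w s)) by ring.
  apply Rle_trans with (3 * (((2 * (C * rate s) + 1 * rate s) * (C * rate s)) * (D * rate s))).
  + apply Rabs_mult_le; [rewrite Rabs_pos_eq; lra|].
    apply Rabs_mult_le; [|easy]; apply Rabs_mult_le; [|easy].
    apply Rabs_plus_le; [apply Rabs_mult_le; [rewrite Rabs_pos_eq; lra|easy]|].
    apply Rle_trans with (1 := Wb); apply Rmult_le_compat_r; lra.
  + replace (3 * ((2 * (C * rate s) + 1 * rate s) * (C * rate s) * (D * rate s)))
      with (3 * (2 * C + 1) * C * D * rate s ^ 3) by ring.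
    apply Rmult_le_compat_l; [easy|]; apply weight_ge_rate; unfold B in HB; lra.
- intros s p q Hs.
  destruct (Hy s Hs) as [_ Yb]; destruct (Hw s Hs) as [_ Wb].
  generalize (rate_pos s); intros Hr.
  replace (3 * (y 0%nat s + w s) ^ 2 * (f 0%nat s + p) - 3 * y 0%nat s ^ 2 * f 0%nat s
     - (3 * (y 0%nat s + w s) ^ 2 * (f 0%nat s + q) - 3 * y 0%nat s ^ 2 * f 0%nat s))
    with (3 * (y 0%nat s + w s) ^ 2 * (p - q)) by ring.
  rewrite Rabs_mult; apply Rmult_le_compat_r; [apply Rabs_pos|].
  rewrite (Rabs_pos_eq (3 * _)) by (generalize (pow2_ge_0 (y 0%nat s + w s)); lra).
  apply Rle_trans with (3 * ((C + 1) * rate s) ^ 2).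
  + apply Rmult_le_compat_l; [lra|]; rewrite <- pow2_abs; apply pow_incr; split; [apply Rabs_pos|].
    rewrite Rmult_plus_distr_r; apply Rabs_plus_le; [easy|].
    apply Rle_trans with (1 := Wb); apply Rmult_le_compat_r; lra.
  + rewrite Rpow_mult_distr; unfold B.
    rewrite <- Rmult_assoc, (Rmult_assoc (3 * (C + 1) ^ 2)).
    apply Rmult_le_compat_l; [generalize (pow2_ge_0 (C + 1)); lra | now apply rate_square_le].
- exists V; split; [|easy]; intros s Hs.
  specialize (HV1 s); rewrite Rmax_right in HV1 by easy; exact HV1.
Qed.

Lemma continuous_of_lipschitz (f : R -> R) (t e C : R) :
  0 < e -> (forall h, Rabs h < e -> Rabs (f (t + h) - f t) <= C * Rabs h) -> continuous f t.
Proof.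
intros He H; apply filterlim_locally; intros eps.
assert (HC : 0 < Rabs C + 1) by (generalize (Rabs_pos C); lra).
assert (Hd : 0 < Rmin e (eps / (Rabs C + 1))).
{ apply Rmin_glb_lt; [easy|]; apply Rdiv_lt_0_compat; [apply cond_pos | easy]. }
exists (mkposreal _ Hd); intros s Hs.
unfold ball in *; simpl in *; unfold AbsRing_ball, abs, minus, plus, opp in *; simpl in *.
assert (H1 : Rabs (s + - t) < e) by (apply Rlt_le_trans with (1 := Hs), Rmin_l).
assert (H2 : Rabs (s + - t) < eps / (Rabs C + 1)) by (apply Rlt_le_trans with (1 := Hs), Rmin_r).
specialize (H _ H1); replace (t + (s + - t)) with s in H by ring.
apply Rle_lt_trans with (1 := H); apply Rlt_div_r in H2; [|easy].
generalize (Rle_abs C) (Rabs_pos (s + - t)); nra.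
Qed.

(** Solutions are chosen separately for each [t], yet they are comparable because the weighted
    estimates include uniqueness. In turn: [v] is Lipschitz in [t], [V] is its derivative up to a
    quadratic remainder, and [V] is Lipschitz. *)
Lemma perturbed_family (y f : nat -> R -> R) (a : R) :
  orbit y -> linear_solution y a f ->
  exists (e K : R) (v V : R -> nat -> R -> R), 0 < e /\ 0 <= K /\
    forall t, Rabs t < e ->
    (forall s, a <= s ->
       chain_at (v t) (perturbation_source (y 0%nat s) (f 0%nat s) (v t 0%nat s) t) s) /\
    (forall i s, (i < 4)%nat -> a <= s -> Rabs (v t i s) <= K * t ^ 2 * rate s) /\
    (forall i, (i < 4)%nat -> is_derive (fun t => v t i a) t (V t i a) /\
       continuous (fun t => V t i a) t /\ Rabs (V t i a) <= K * Rabs t).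
Proof.
intros Hy Hf.
destruct (decays_nonneg a (y 0%nat)) as [C1 [HC1 HC1']]; [apply Hy; lia|].
destruct (decays_nonneg a (f 0%nat)) as [C2 [HC2 HC2']]; [apply Hf; lia|].
set (C := C1 + C2); assert (HC : 0 <= C) by (unfold C; lra).
assert (Hy0 : forall s, a <= s -> continuous (y 0%nat) s /\ Rabs (y 0%nat s) <= C * rate s).
{ intros s Hs; split; [apply (orbit_continuous y); auto; lia|].
  apply Rle_trans with (1 := HC1' s Hs); apply Rmult_le_compat_r;
    [left; apply rate_pos | unfold C; lra]. }
assert (Hf0 : forall s, a <= s -> continuous (f 0%nat) s /\ Rabs (f 0%nat s) <= C * rate s).
{ intros s Hs; split.
  - eapply chain_continuous; [apply Hf; easy | lia].
  - apply Rle_trans with (1 := HC2' s Hs); apply Rmult_le_compat_r;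
      [left; apply rate_pos | unfold C; lra]. }
set (B := 3 * (C + 1) ^ 2 * exp (- a / 3)).
assert (HB : 0 <= B).
{ unfold B; apply Rmult_le_pos; [generalize (pow2_ge_0 (C + 1)); lra | left; apply exp_pos]. }
set (L := 2 * B); assert (HL : 0 <= L) by (unfold L; lra).
assert (HL' : 6 * (C + 1) ^ 2 * exp (- a / 3) <= L) by (unfold L, B; lra).
assert (HW : exists W, 0 <= W /\ forall s, a <= s -> weight L s <= W * rate s).
{ destruct (weight_le_rate L a HL) as [W [HW0 HW]]; exists (W * rate a ^ 2); split.
  - apply Rmult_le_pos; [easy | apply pow2_ge_0].
  - intros s Hs; apply Rle_trans with (1 := HW s Hs).
    rewrite Rmult_assoc; apply Rmult_le_compat_l; [easy|].
    generalize (rate_pos s) (rate_le a s Hs); intros R0 R1.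
    replace (rate s ^ 3) with (rate s ^ 2 * rate s) by ring.
    apply Rmult_le_compat_r; [lra|]; apply pow_incr; lra. }
destruct HW as [W [HW0 HW]].
assert (HC3 : 0 <= C ^ 3) by now apply pow_le.
(* [Rabs t * Q * rate s] bounds the displacement [t f + v]; the radius [e = 1 / (Q + 1)] keeps it
   below [rate s]. *)
set (Q := C + 4 * C ^ 3 * W).
assert (HCW : 0 <= 4 * C ^ 3 * W) by (apply Rmult_le_pos; lra).
assert (HQ : 0 <= Q) by (unfold Q; lra).
set (e := / (Q + 1)).
assert (He : 0 < e) by (apply Rinv_0_lt_compat; lra).
assert (HeQ : forall t, Rabs t < e -> Rabs t * (Q + 1) <= 1).
{ intros t Ht; apply Rle_trans with (e * (Q + 1)).
  - apply Rmult_le_compat_r; lra.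
  - right; unfold e; field; lra. }
set (Pv := fun t v => (forall s, a <= s ->
      chain_at v (perturbation_source (y 0%nat s) (f 0%nat s) (v 0%nat s) t) s) /\
    weight_bound L a (4 * C ^ 3 * t ^ 2) v).
set (inh := inhabits (fun (_ : nat) (_ : R) => 0)).
set (v := fun t => epsilon inh (Pv t)).
assert (Hv : forall t, Rabs t < e -> Pv t (v t)).
{ intros t Ht; apply epsilon_spec.
  apply (perturbed_solution y f a C L W t); auto. }
set (w := fun t s => t * f 0%nat s + v t 0%nat s).
assert (Hw : forall t, Rabs t < e -> forall s, a <= s ->
  continuous (w t) s /\ Rabs (w t s) <= Rabs t * Q * rate s).
{ intros t Ht s Hs; destruct (Hv t Ht) as [V1 V2]; split.
  - unfold w; destruct (Hf0 s Hs) as [F1 _].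
    assert (V3 : continuous (v t 0%nat) s) by (eapply chain_continuous; [apply V1; easy | lia]).
    cont.
  - unfold w; replace (Rabs t * Q * rate s)
      with (Rabs t * (C * rate s) + Rabs t * (4 * C ^ 3) * (W * rate s)) by (unfold Q; ring).
    apply Rabs_plus_le; [apply Rabs_mult_le; [lra | now apply Hf0]|].
    apply Rle_trans with (1 := V2 0%nat s ltac:(lia) Hs).
    apply Rmult_le_compat; auto.
    + apply Rmult_le_pos; [lra | apply pow2_ge_0].
    + left; apply weight_pos.
    + rewrite <- pow2_abs, Rmult_comm; simpl; rewrite Rmult_1_r.
      apply Rmult_le_compat_r; [lra|].
      generalize (HeQ t Ht) (Rabs_pos t); intros E0 E1.
      assert (Rabs t <= 1) by nra.
      rewrite <- (Rmult_1_r (Rabs t)) at 3; now apply Rmult_le_compat_l. }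
assert (HtQ : forall t, Rabs t < e -> 0 <= Rabs t * Q <= 1).
{ intros t Ht; generalize (HeQ t Ht) (Rabs_pos t); intros E0 E1; split; [now apply Rmult_le_pos|].
  lra. }
assert (HU : forall t, Rabs t < e -> forall s, a <= s ->
  Rabs (y 0%nat s + w t s) <= (C + 1) * rate s).
{ intros t Ht s Hs; rewrite Rmult_plus_distr_r; apply Rabs_plus_le; [now apply Hy0|].
  apply Rle_trans with (1 := proj2 (Hw t Ht s Hs)).
  apply Rmult_le_compat_r; [left; apply rate_pos | now apply HtQ]. }
assert (HBr : forall s, a <= s -> 3 * ((C + 1) * rate s) ^ 2 <= B * exp (- s)).
{ intros s Hs; rewrite Rpow_mult_distr; unfold B.
  rewrite <- Rmult_assoc, (Rmult_assoc (3 * (C + 1) ^ 2)).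
  apply Rmult_le_compat_l; [generalize (pow2_ge_0 (C + 1)); lra | now apply rate_square_le]. }
set (A := 3 * (2 * C + 1) * C).
assert (HA : 0 <= A) by (unfold A; repeat apply Rmult_le_pos; lra).
set (PV := fun t V => (forall s, a <= s ->
      chain_at V (3 * (y 0%nat s + w t s) ^ 2 * (f 0%nat s + V 0%nat s)
                  - 3 * y 0%nat s ^ 2 * f 0%nat s) s) /\
    weight_bound L a (A * (Rabs t * Q)) V).
set (V := fun t => epsilon inh (PV t)).
assert (HV : forall t, Rabs t < e -> PV t (V t)).
{ intros t Ht; apply epsilon_spec.
  apply (linearized_solution y f (w t) a C L (Rabs t * Q)); auto; now apply HtQ. }
assert (HVb : forall t, Rabs t < e -> forall s, a <= s ->
  Rabs (f 0%nat s + V t 0%nat s) <= (C + A * W) * rate s).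
{ intros t Ht s Hs; rewrite Rmult_plus_distr_r; apply Rabs_plus_le; [now apply Hf0|].
  apply Rle_trans with (1 := proj2 (HV t Ht) 0%nat s ltac:(lia) Hs).
  rewrite Rmult_assoc; rewrite (Rmult_assoc A); apply Rmult_le_compat_l; [easy|].
  apply Rle_trans with (1 * weight L s).
  - apply Rmult_le_compat_r; [left; apply weight_pos | now apply HtQ].
  - rewrite Rmult_1_l; auto. }
assert (HWr : forall s X, 0 <= X -> X * rate s ^ 3 <= X * weight L s).
{ intros s X HX; apply Rmult_le_compat_l; [easy | now apply weight_ge_rate]. }
assert (Hvs : forall t s, Rabs t < e -> a <= s ->
  chain_at (v t) ((y 0%nat s + w t s) ^ 3 - y 0%nat s ^ 3 - 3 * y 0%nat s ^ 2 * (t * f 0%nat s)) s).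
{ intros t s Ht Hs; unfold w; rewrite <- Rplus_assoc; exact (proj1 (Hv t Ht) s Hs). }
set (K1 := 6 * (C + 1) ^ 2 * C).
assert (HC12 : 0 <= (C + 1) ^ 2) by apply pow2_ge_0.
assert (HK1 : 0 <= K1) by (unfold K1; apply Rmult_le_pos; lra).
(* In the source of the difference, the difference [r] itself occurs with a factor at most
   [B * exp (- s)], which stability absorbs; the remaining terms fix the constant. [Hdiff] and
   [HVlip] follow the same scheme. *)
assert (Hlip : forall t t', Rabs t < e -> Rabs t' < e ->
  weight_bound L a (K1 * Rabs (t' - t)) (lincomb 1 (- 1) (v t') (v t))).
{ intros t t' Ht Ht'.
  apply (chain_stability L a (K1 * Rabs (t' - t)) B
    (4 * C ^ 3 * t' ^ 2 + Rabs (- 1) * (4 * C ^ 3 * t ^ 2)) _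
    (fun s => 1 * ((y 0%nat s + w t' s) ^ 3 - y 0%nat s ^ 3 - 3 * y 0%nat s ^ 2 * (t' * f 0%nat s))
      + - 1 * ((y 0%nat s + w t s) ^ 3 - y 0%nat s ^ 3 - 3 * y 0%nat s ^ 2 * (t * f 0%nat s)))).
  - apply Rmult_le_pos; [easy | apply Rabs_pos].
  - easy.
  - unfold L; lra.
  - intros s Hs; apply chain_lincomb; auto.
  - intros s Hs; unfold lincomb.
    set (r := 1 * v t' 0%nat s + - 1 * v t 0%nat s).
    assert (Er : (y 0%nat s + w t' s) - (y 0%nat s + w t s) = (t' - t) * f 0%nat s + r)
      by (unfold w, r; ring).
    replace (1 * ((y 0%nat s + w t' s) ^ 3 - y 0%nat s ^ 3 - 3 * y 0%nat s ^ 2 * (t' * f 0%nat s))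
      + - 1 * ((y 0%nat s + w t s) ^ 3 - y 0%nat s ^ 3 - 3 * y 0%nat s ^ 2 * (t * f 0%nat s)))
      with (((y 0%nat s + w t' s) ^ 3 - (y 0%nat s + w t s) ^ 3)
        + 3 * (- ((t' - t) * f 0%nat s)) * (y 0%nat s * y 0%nat s)) by ring.
    generalize (rate_pos s); intros Rp.
    apply Rle_trans with (3 * ((C + 1) * rate s) ^ 2 * (Rabs (t' - t) * (C * rate s) + Rabs r)
      + 3 * (Rabs (t' - t) * (C * rate s)) * (((C + 1) * rate s) * ((C + 1) * rate s))).
    + apply Rabs_plus_le.
      * eapply Rle_trans; [apply (cube_lipschitz ((C + 1) * rate s)); now apply HU|].
        apply Rmult_le_compat_l; [generalize (pow2_ge_0 ((C + 1) * rate s)); lra|].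
        rewrite Er; apply Rabs_plus_le; [|lra].
        apply Rabs_mult_le; [lra | now apply Hf0].
      * assert (Y1 : Rabs (y 0%nat s) <= (C + 1) * rate s).
        { apply Rle_trans with (1 := proj2 (Hy0 s Hs)); apply Rmult_le_compat_r; lra. }
        apply Rabs_mult_le; [|now apply Rabs_mult_le].
        apply Rabs_mult_le; [rewrite Rabs_pos_eq; lra|].
        rewrite Rabs_Ropp; apply Rabs_mult_le; [lra | now apply Hf0].
    + specialize (HBr s Hs).
      assert (HP : 0 <= K1 * Rabs (t' - t)) by (apply Rmult_le_pos; [easy | apply Rabs_pos]).
      specialize (HWr s _ HP).
      assert (3 * ((C + 1) * rate s) ^ 2 * Rabs r <= B * exp (- s) * Rabs r)
        by (apply Rmult_le_compat_r; [apply Rabs_pos | easy]).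
      assert (K1 * Rabs (t' - t) * rate s ^ 3 = 3 * ((C + 1) * rate s) ^ 2 * (Rabs (t' - t) * (C * rate s))
        + 3 * (Rabs (t' - t) * (C * rate s)) * ((C + 1) * rate s * ((C + 1) * rate s)))
        by (unfold K1; ring).
      lra.
  - apply weight_bound_lincomb; now apply Hv. }
set (K2 := C + K1 * W).
assert (HK2 : 0 <= K2) by (unfold K2; generalize (Rmult_le_pos _ _ HK1 HW0); lra).
assert (HdU : forall t t', Rabs t < e -> Rabs t' < e -> forall s, a <= s ->
  Rabs ((y 0%nat s + w t' s) - (y 0%nat s + w t s)) <= Rabs (t' - t) * (K2 * rate s)).
{ intros t t' Ht Ht' s Hs.
  replace ((y 0%nat s + w t' s) - (y 0%nat s + w t s))
    with ((t' - t) * f 0%nat s + lincomb 1 (- 1) (v t') (v t) 0%nat s)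
    by (unfold w, lincomb; ring).
  replace (Rabs (t' - t) * (K2 * rate s))
    with (Rabs (t' - t) * (C * rate s) + K1 * Rabs (t' - t) * (W * rate s))
    by (unfold K2; ring).
  apply Rabs_plus_le; [apply Rabs_mult_le; [lra | now apply Hf0]|].
  apply Rle_trans with (1 := Hlip t t' Ht Ht' 0%nat s ltac:(lia) Hs).
  apply Rmult_le_compat_l; [|auto]; apply Rmult_le_pos; [easy | apply Rabs_pos]. }
set (K3 := 3 * (C + 1) * K2 ^ 2).
assert (HK3 : 0 <= K3).
{ unfold K3; apply Rmult_le_pos; [lra | apply pow2_ge_0]. }
assert (Hdiff : forall t t', Rabs t < e -> Rabs t' < e ->
  weight_bound L a (K3 * (t' - t) ^ 2)
    (lincomb 1 (- (t' - t)) (lincomb 1 (- 1) (v t') (v t)) (V t))).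
{ intros t t' Ht Ht'.
  apply (chain_stability L a (K3 * (t' - t) ^ 2) B
    (K1 * Rabs (t' - t) + Rabs (- (t' - t)) * (A * (Rabs t * Q))) _
    (fun s => 1 * (1 * ((y 0%nat s + w t' s) ^ 3 - y 0%nat s ^ 3 - 3 * y 0%nat s ^ 2 * (t' * f 0%nat s))
      + - 1 * ((y 0%nat s + w t s) ^ 3 - y 0%nat s ^ 3 - 3 * y 0%nat s ^ 2 * (t * f 0%nat s)))
      + - (t' - t) * (3 * (y 0%nat s + w t s) ^ 2 * (f 0%nat s + V t 0%nat s)
                  - 3 * y 0%nat s ^ 2 * f 0%nat s))).
  - apply Rmult_le_pos; [easy | apply pow2_ge_0].
  - easy.
  - unfold L; lra.
  - intros s Hs; apply chain_lincomb; [apply chain_lincomb; auto|]; now apply HV.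
  - intros s Hs.
    set (r := lincomb 1 (- (t' - t)) (lincomb 1 (- 1) (v t') (v t)) (V t) 0%nat s).
    assert (Er : (t' - t) * (f 0%nat s + V t 0%nat s)
      = ((y 0%nat s + w t' s) - (y 0%nat s + w t s)) - r)
      by (unfold w, r, lincomb; ring).
    generalize (HU t Ht s Hs) (HU t' Ht' s Hs) (HdU t t' Ht Ht' s Hs).
    set (U := y 0%nat s + w t s) in *; set (U' := y 0%nat s + w t' s) in *; intros U1 U2 U3.
    replace (1 * (1 * (U' ^ 3 - y 0%nat s ^ 3 - 3 * y 0%nat s ^ 2 * (t' * f 0%nat s))
      + - 1 * (U ^ 3 - y 0%nat s ^ 3 - 3 * y 0%nat s ^ 2 * (t * f 0%nat s)))
      + - (t' - t) * (3 * U ^ 2 * (f 0%nat s + V t 0%nat s) - 3 * y 0%nat s ^ 2 * f 0%nat s))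
      with (U' ^ 3 - U ^ 3 - 3 * U ^ 2 * ((t' - t) * (f 0%nat s + V t 0%nat s))) by ring.
    rewrite Er.
    (* The Taylor remainder of the cube, quadratic in [U' - U], plus a term linear in [r] for
       stability to absorb. *)
    replace (U' ^ 3 - U ^ 3 - 3 * U ^ 2 * (U' - U - r))
      with (((U' - U) * (U' - U)) * (U' + 2 * U) + 3 * (U * U) * r) by ring.
    generalize (rate_pos s); intros Rp.
    apply Rle_trans with
      ((Rabs (t' - t) * (K2 * rate s) * (Rabs (t' - t) * (K2 * rate s)))
        * ((C + 1) * rate s + 2 * ((C + 1) * rate s))
       + 3 * ((C + 1) * rate s * ((C + 1) * rate s)) * Rabs r).
    + apply Rabs_plus_le.
      * apply Rabs_mult_le; [now apply Rabs_mult_le|].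
        apply Rabs_plus_le; [easy|]; apply Rabs_mult_le; [rewrite Rabs_pos_eq; lra | easy].
      * apply Rabs_mult_le; [|lra].
        apply Rabs_mult_le; [rewrite Rabs_pos_eq; lra|]; now apply Rabs_mult_le.
    + specialize (HBr s Hs).
      assert (HP : 0 <= K3 * (t' - t) ^ 2) by (apply Rmult_le_pos; [easy | apply pow2_ge_0]).
      specialize (HWr s _ HP).
      assert (3 * ((C + 1) * rate s) ^ 2 * Rabs r <= B * exp (- s) * Rabs r)
        by (apply Rmult_le_compat_r; [apply Rabs_pos | easy]).
      assert (K3 * (t' - t) ^ 2 * rate s ^ 3 =
        Rabs (t' - t) * (K2 * rate s) * (Rabs (t' - t) * (K2 * rate s))
        * ((C + 1) * rate s + 2 * ((C + 1) * rate s)))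
        by (rewrite <- pow2_abs; unfold K3; ring).
      lra.
  - apply weight_bound_lincomb; [now apply Hlip | now apply HV]. }
set (K4 := 6 * (C + 1) * K2 * (C + A * W)).
assert (HK4 : 0 <= K4).
{ unfold K4; generalize (Rmult_le_pos _ _ HA HW0); intros; repeat apply Rmult_le_pos; lra. }
assert (HVlip : forall t t', Rabs t < e -> Rabs t' < e ->
  weight_bound L a (K4 * Rabs (t' - t)) (lincomb 1 (- 1) (V t') (V t))).
{ intros t t' Ht Ht'.
  apply (chain_stability L a (K4 * Rabs (t' - t)) B
    (A * (Rabs t' * Q) + Rabs (- 1) * (A * (Rabs t * Q))) _
    (fun s => 1 * (3 * (y 0%nat s + w t' s) ^ 2 * (f 0%nat s + V t' 0%nat s)
                  - 3 * y 0%nat s ^ 2 * f 0%nat s)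
      + - 1 * (3 * (y 0%nat s + w t s) ^ 2 * (f 0%nat s + V t 0%nat s)
                  - 3 * y 0%nat s ^ 2 * f 0%nat s))).
  - apply Rmult_le_pos; [easy | apply Rabs_pos].
  - easy.
  - unfold L; lra.
  - intros s Hs; apply chain_lincomb; now apply HV.
  - intros s Hs.
    set (r := lincomb 1 (- 1) (V t') (V t) 0%nat s).
    generalize (HU t Ht s Hs) (HU t' Ht' s Hs) (HdU t t' Ht Ht' s Hs) (HVb t' Ht' s Hs).
    set (U := y 0%nat s + w t s) in *; set (U' := y 0%nat s + w t' s) in *; intros U1 U2 U3 U4.
    replace (1 * (3 * U' ^ 2 * (f 0%nat s + V t' 0%nat s) - 3 * y 0%nat s ^ 2 * f 0%nat s)
      + - 1 * (3 * U ^ 2 * (f 0%nat s + V t 0%nat s) - 3 * y 0%nat s ^ 2 * f 0%nat s))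
      with (3 * (U' ^ 2 - U ^ 2) * (f 0%nat s + V t' 0%nat s) + 3 * (U * U) * r)
      by (unfold r, lincomb; ring).
    generalize (rate_pos s); intros Rp.
    apply Rle_trans with
      (3 * (2 * ((C + 1) * rate s) * (Rabs (t' - t) * (K2 * rate s))) * ((C + A * W) * rate s)
       + 3 * ((C + 1) * rate s * ((C + 1) * rate s)) * Rabs r).
    + apply Rabs_plus_le.
      * apply Rabs_mult_le; [|easy]; apply Rabs_mult_le; [rewrite Rabs_pos_eq; lra|].
        apply Rle_trans with (1 := square_lipschitz ((C + 1) * rate s) _ _ U2 U1).
        apply Rmult_le_compat_l; [|easy].
        apply Rmult_le_pos; [lra|]; apply Rmult_le_pos; lra.
      * apply Rabs_mult_le; [|lra].
        apply Rabs_mult_le; [rewrite Rabs_pos_eq; lra|]; now apply Rabs_mult_le.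
    + specialize (HBr s Hs).
      assert (HP : 0 <= K4 * Rabs (t' - t)) by (apply Rmult_le_pos; [easy | apply Rabs_pos]).
      specialize (HWr s _ HP).
      assert (3 * ((C + 1) * rate s) ^ 2 * Rabs r <= B * exp (- s) * Rabs r)
        by (apply Rmult_le_compat_r; [apply Rabs_pos | easy]).
      assert (K4 * Rabs (t' - t) * rate s ^ 3 =
        3 * (2 * ((C + 1) * rate s) * (Rabs (t' - t) * (K2 * rate s))) * ((C + A * W) * rate s))
        by (unfold K4; ring).
      lra.
  - apply weight_bound_lincomb; now apply HV. }
assert (Wa := weight_pos L a).
exists e, (4 * C ^ 3 * W + A * Q * weight L a), v, V; split; [easy|split].
{ assert (0 <= A * Q * weight L a); [|lra].
  apply Rmult_le_pos; [now apply Rmult_le_pos | lra]. }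
intros t Ht; split; [now apply Hv|split].
- intros i s Hi Hs; apply Rle_trans with (1 := proj2 (Hv t Ht) i s Hi Hs).
  apply Rle_trans with (4 * C ^ 3 * t ^ 2 * (W * rate s)).
  + apply Rmult_le_compat_l; [|auto]; apply Rmult_le_pos; [lra | apply pow2_ge_0].
  + assert (0 <= A * Q * weight L a * t ^ 2 * rate s).
    { apply Rmult_le_pos; [|left; apply rate_pos]; apply Rmult_le_pos; [|apply pow2_ge_0].
      apply Rmult_le_pos; [now apply Rmult_le_pos | lra]. }
    lra.
- intros i Hi.
  assert (He' : 0 < e - Rabs t) by lra.
  assert (Hth : forall h, Rabs h < e - Rabs t -> Rabs (t + h) < e).
  { intros h Hh; apply Rle_lt_trans with (1 := Rabs_triang _ _); lra. }
  split; [|split].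
  + apply (is_derive_of_quadratic _ _ _ (e - Rabs t) (K3 * weight L a)); [easy|].
    intros h Hh.
    generalize (Hdiff t (t + h) Ht (Hth h Hh) i a Hi (Rle_refl a)).
    replace (t + h - t) with h by ring; unfold lincomb.
    replace (1 * (1 * v (t + h) i a + -1 * v t i a) + - h * V t i a)
      with (v (t + h) i a - v t i a - h * V t i a) by ring.
    lra.
  + apply (continuous_of_lipschitz _ _ (e - Rabs t) (K4 * weight L a)); [easy|].
    intros h Hh.
    generalize (HVlip t (t + h) Ht (Hth h Hh) i a Hi (Rle_refl a)).
    replace (t + h - t) with h by ring; unfold lincomb.
    replace (1 * V (t + h) i a + -1 * V t i a) with (V (t + h) i a - V t i a) by ring.
    lra.
  + apply Rle_trans with (1 := proj2 (HV t Ht) i a Hi (Rle_refl a)).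
    assert (0 <= 4 * C ^ 3 * W * Rabs t) by (apply Rmult_le_pos; [easy | apply Rabs_pos]).
    lra.
Qed.

(** * Linear dependence and the space R4 *)

Lemma dependent_2 (a b : R) : exists k l, (k <> 0 \/ l <> 0) /\ k * a + l * b = 0.
Proof.
destruct (Req_dec a 0) as [Ha|Ha].
- exists 1, 0; split; [left; lra | rewrite Ha; ring].
- exists (- b / a), 1; split; [right; lra | field; easy].
Qed.

(** One step of Gaussian elimination: the first equation determines [k0], and a system with one
    equation fewer remains. *)
Lemma dependent_3_pivot (a0 a1 a2 b0 b1 b2 : R) : a0 <> 0 ->
  exists k0 k1 k2, (k0 <> 0 \/ k1 <> 0 \/ k2 <> 0) /\
    k0 * a0 + k1 * a1 + k2 * a2 = 0 /\ k0 * b0 + k1 * b1 + k2 * b2 = 0.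
Proof.
intros H; destruct (dependent_2 (b1 - a1 / a0 * b0) (b2 - a2 / a0 * b0)) as [k1 [k2 [Hk E]]].
exists (- (k1 * a1 + k2 * a2) / a0), k1, k2; split; [tauto|split; [field; easy|]].
rewrite <- E; field; easy.
Qed.

Lemma dependent_3 (a0 a1 a2 b0 b1 b2 : R) :
  exists k0 k1 k2, (k0 <> 0 \/ k1 <> 0 \/ k2 <> 0) /\
    k0 * a0 + k1 * a1 + k2 * a2 = 0 /\ k0 * b0 + k1 * b1 + k2 * b2 = 0.
Proof.
destruct (Req_dec a0 0) as [H0|H0].
2: now apply dependent_3_pivot.
destruct (Req_dec a1 0) as [H1|H1].
2: { destruct (dependent_3_pivot a1 a0 a2 b1 b0 b2 H1) as [k1 [k0 [k2 [Hk [E1 E2]]]]].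
     exists k0, k1, k2; split; [tauto|split; lra]. }
destruct (Req_dec a2 0) as [H2|H2].
2: { destruct (dependent_3_pivot a2 a0 a1 b2 b0 b1 H2) as [k2 [k0 [k1 [Hk [E1 E2]]]]].
     exists k0, k1, k2; split; [tauto|split; lra]. }
destruct (dependent_2 b0 b1) as [k0 [k1 [Hk E]]].
exists k0, k1, 0; split; [tauto|split; [rewrite H0, H1; ring|lra]].
Qed.

Lemma dependent_4_pivot (a0 a1 a2 a3 b0 b1 b2 b3 c0 c1 c2 c3 : R) : a0 <> 0 ->
  exists k0 k1 k2 k3, (k0 <> 0 \/ k1 <> 0 \/ k2 <> 0 \/ k3 <> 0) /\
    k0 * a0 + k1 * a1 + k2 * a2 + k3 * a3 = 0 /\
    k0 * b0 + k1 * b1 + k2 * b2 + k3 * b3 = 0 /\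
    k0 * c0 + k1 * c1 + k2 * c2 + k3 * c3 = 0.
Proof.
intros H.
destruct (dependent_3 (b1 - a1 / a0 * b0) (b2 - a2 / a0 * b0) (b3 - a3 / a0 * b0)
  (c1 - a1 / a0 * c0) (c2 - a2 / a0 * c0) (c3 - a3 / a0 * c0)) as [k1 [k2 [k3 [Hk [E1 E2]]]]].
exists (- (k1 * a1 + k2 * a2 + k3 * a3) / a0), k1, k2, k3.
split; [tauto|split; [field; easy|split]].
- rewrite <- E1; field; easy.
- rewrite <- E2; field; easy.
Qed.

Lemma dependent_4 (a0 a1 a2 a3 b0 b1 b2 b3 c0 c1 c2 c3 : R) :
  exists k0 k1 k2 k3, (k0 <> 0 \/ k1 <> 0 \/ k2 <> 0 \/ k3 <> 0) /\
    k0 * a0 + k1 * a1 + k2 * a2 + k3 * a3 = 0 /\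
    k0 * b0 + k1 * b1 + k2 * b2 + k3 * b3 = 0 /\
    k0 * c0 + k1 * c1 + k2 * c2 + k3 * c3 = 0.
Proof.
destruct (Req_dec a0 0) as [H0|H0].
2: now apply dependent_4_pivot.
destruct (Req_dec a1 0) as [H1|H1].
2: { destruct (dependent_4_pivot a1 a0 a2 a3 b1 b0 b2 b3 c1 c0 c2 c3 H1)
       as [k1 [k0 [k2 [k3 [Hk [E1 [E2 E3]]]]]]].
     exists k0, k1, k2, k3; split; [tauto|split; [lra|split; lra]]. }
destruct (Req_dec a2 0) as [H2|H2].
2: { destruct (dependent_4_pivot a2 a0 a1 a3 b2 b0 b1 b3 c2 c0 c1 c3 H2)
       as [k2 [k0 [k1 [k3 [Hk [E1 [E2 E3]]]]]]].
     exists k0, k1, k2, k3; split; [tauto|split; [lra|split; lra]]. }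
destruct (Req_dec a3 0) as [H3|H3].
2: { destruct (dependent_4_pivot a3 a0 a1 a2 b3 b0 b1 b2 c3 c0 c1 c2 H3)
       as [k3 [k0 [k1 [k2 [Hk [E1 [E2 E3]]]]]]].
     exists k0, k1, k2, k3; split; [tauto|split; [lra|split; lra]]. }
destruct (dependent_3 b0 b1 b2 c0 c1 c2) as [k0 [k1 [k2 [Hk [E1 E2]]]]].
exists k0, k1, k2, 0; split; [tauto|split; [rewrite H0, H1, H2, H3; ring|split; lra]].
Qed.

(** On the kernel of [l], a coordinate with nonzero coefficient is determined by the other three.
    Four vectors of the kernel are thus dependent as vectors of [R^3], and independence of the first
    three lets the relation be solved for [s]. *)
Lemma span_of_kernel (l p q r s : nat -> R) :
  (forall v, v = p \/ v = q \/ v = r \/ v = s ->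
     l 0%nat * v 0%nat + l 1%nat * v 1%nat + l 2%nat * v 2%nat + l 3%nat * v 3%nat = 0) ->
  l 2%nat <> 0 \/ l 3%nat <> 0 ->
  (forall c0 c1 c2, (forall i, (i < 4)%nat -> c0 * p i + c1 * q i + c2 * r i = 0) ->
     c0 = 0 /\ c1 = 0 /\ c2 = 0) ->
  exists c0 c1 c2, forall i, (i < 4)%nat -> s i = c0 * p i + c1 * q i + c2 * r i.
Proof.
intros Hl Hnz Hind.
assert (Hdep : exists k0 k1 k2 k3, (k0 <> 0 \/ k1 <> 0 \/ k2 <> 0 \/ k3 <> 0) /\
  forall i, (i < 4)%nat -> k0 * p i + k1 * q i + k2 * r i + k3 * s i = 0).
{ assert (Lp := Hl p ltac:(tauto)); assert (Lq := Hl q ltac:(tauto)).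
  assert (Lr := Hl r ltac:(tauto)); assert (Ls := Hl s ltac:(tauto)).
  destruct Hnz as [Hnz|Hnz].
  - destruct (dependent_4 (p 0%nat) (q 0%nat) (r 0%nat) (s 0%nat)
      (p 1%nat) (q 1%nat) (r 1%nat) (s 1%nat) (p 3%nat) (q 3%nat) (r 3%nat) (s 3%nat))
      as [k0 [k1 [k2 [k3 [Hk [E0 [E1 E3]]]]]]].
    exists k0, k1, k2, k3; split; [easy|].
    assert (E2 : k0 * p 2%nat + k1 * q 2%nat + k2 * r 2%nat + k3 * s 2%nat = 0).
    { apply Rmult_eq_reg_l with (l 2%nat); [|easy].
      generalize (f_equal (Rmult k0) Lp) (f_equal (Rmult k1) Lq) (f_equal (Rmult k2) Lr)
        (f_equal (Rmult k3) Ls) (f_equal (Rmult (l 0%nat)) E0) (f_equal (Rmult (l 1%nat)) E1)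
        (f_equal (Rmult (l 3%nat)) E3); lra. }
    intros i Hi; destruct i as [|[|[|[|i]]]]; [easy ..|lia].
  - destruct (dependent_4 (p 0%nat) (q 0%nat) (r 0%nat) (s 0%nat)
      (p 1%nat) (q 1%nat) (r 1%nat) (s 1%nat) (p 2%nat) (q 2%nat) (r 2%nat) (s 2%nat))
      as [k0 [k1 [k2 [k3 [Hk [E0 [E1 E2]]]]]]].
    exists k0, k1, k2, k3; split; [easy|].
    assert (E3 : k0 * p 3%nat + k1 * q 3%nat + k2 * r 3%nat + k3 * s 3%nat = 0).
    { apply Rmult_eq_reg_l with (l 3%nat); [|easy].
      generalize (f_equal (Rmult k0) Lp) (f_equal (Rmult k1) Lq) (f_equal (Rmult k2) Lr)
        (f_equal (Rmult k3) Ls) (f_equal (Rmult (l 0%nat)) E0) (f_equal (Rmult (l 1%nat)) E1)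
        (f_equal (Rmult (l 2%nat)) E2); lra. }
    intros i Hi; destruct i as [|[|[|[|i]]]]; [easy ..|lia]. }
destruct Hdep as [k0 [k1 [k2 [k3 [Hk E]]]]].
assert (Hk3 : k3 <> 0).
{ intros H3; subst k3; destruct (Hind k0 k1 k2) as [A0 [A1 A2]]; [|tauto].
  intros i Hi; generalize (E i Hi); lra. }
exists (- k0 / k3), (- k1 / k3), (- k2 / k3); intros i Hi.
apply Rmult_eq_reg_l with k3; [|easy].
replace (k3 * (- k0 / k3 * p i + - k1 / k3 * q i + - k2 / k3 * r i))
  with (- (k0 * p i + k1 * q i + k2 * r i)) by (field; easy).
generalize (E i Hi); lra.
Qed.

(** * Coordinatewise calculus in [R4] *)

Lemma is_derive_pair (U V : NormedModule R_AbsRing) (f : R -> U) (g : R -> V) (x : R) (l : U) (m : V) :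
  is_derive f x l -> is_derive g x m ->
  is_derive (V := prod_NormedModule R_AbsRing U V) (fun t => (f t, g t)) x (l, m).
Proof.
intros Hf Hg.
apply (filterdiff_comp'_2 (W := prod_NormedModule R_AbsRing U V) f g (fun a b => (a, b)) x
  (fun y => scal y l) (fun y => scal y m) (fun a b => (a, b))); try assumption.
apply (filterdiff_ext (fun t : prod_NormedModule R_AbsRing U V => t)).
- now intros [a b].
- apply (filterdiff_ext_lin _ (fun t : prod_NormedModule R_AbsRing U V => t)).
  + apply filterdiff_id.
  + now intros [a b].
Qed.

Lemma is_derive_fst (U V : NormedModule R_AbsRing) (f : R -> prod_NormedModule R_AbsRing U V)
  (x : R) (l : prod_NormedModule R_AbsRing U V) :
  is_derive f x l -> is_derive (fun t => fst (f t)) x (fst l).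
Proof.
intros Hf.
apply (filterdiff_comp' f (fun p => fst p) x (fun y => scal y l) (fun p => fst p)); [exact Hf|].
apply filterdiff_linear, is_linear_fst.
Qed.

Lemma is_derive_snd (U V : NormedModule R_AbsRing) (f : R -> prod_NormedModule R_AbsRing U V)
  (x : R) (l : prod_NormedModule R_AbsRing U V) :
  is_derive f x l -> is_derive (fun t => snd (f t)) x (snd l).
Proof.
intros Hf.
apply (filterdiff_comp' f (fun p => snd p) x (fun y => scal y l) (fun p => snd p)); [exact Hf|].
apply filterdiff_linear, is_linear_snd.
Qed.

Definition coord0 (m : R4) : R := fst (fst (fst m)).
Definition coord1 (m : R4) : R := snd (fst (fst m)).
Definition coord2 (m : R4) : R := snd (fst m).
Definition coord3 (m : R4) : R := snd m.

Lemma R4_eta (m : R4) : m = (coord0 m, coord1 m, coord2 m, coord3 m).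
Proof. now destruct m as [[[a b] c] d]. Qed.

Lemma R4_is_derive (g : R -> R4) (t : R) (v : R4) :
  is_derive (fun t => coord0 (g t)) t (coord0 v) -> is_derive (fun t => coord1 (g t)) t (coord1 v) ->
  is_derive (fun t => coord2 (g t)) t (coord2 v) -> is_derive (fun t => coord3 (g t)) t (coord3 v) ->
  is_derive g t v.
Proof.
intros H0 H1 H2 H3.
apply (is_derive_ext (fun t => (coord0 (g t), coord1 (g t), coord2 (g t), coord3 (g t)) : R4)).
- intros s; symmetry; apply R4_eta.
- rewrite (R4_eta v); repeat apply is_derive_pair; assumption.
Qed.

Lemma R4_derive_components (g : R -> R4) (t : R) (v : R4) :
  is_derive g t v ->
  is_derive (fun t => coord0 (g t)) t (coord0 v) /\ is_derive (fun t => coord1 (g t)) t (coord1 v) /\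
  is_derive (fun t => coord2 (g t)) t (coord2 v) /\ is_derive (fun t => coord3 (g t)) t (coord3 v).
Proof.
intros H; assert (H' := is_derive_fst _ _ _ _ _ H); assert (H'' := is_derive_fst _ _ _ _ _ H').
split; [|split; [|split]].
- exact (is_derive_fst _ _ _ _ _ H'').
- exact (is_derive_snd _ _ _ _ _ H'').
- exact (is_derive_snd _ _ _ _ _ H').
- exact (is_derive_snd _ _ _ _ _ H).
Qed.

Lemma R4_filterlim (T : Type) (F : (T -> Prop) -> Prop) {FF : Filter F} (g : T -> R4) (m : R4) :
  filterlim (fun t => coord0 (g t)) F (locally (coord0 m)) ->
  filterlim (fun t => coord1 (g t)) F (locally (coord1 m)) ->
  filterlim (fun t => coord2 (g t)) F (locally (coord2 m)) ->
  filterlim (fun t => coord3 (g t)) F (locally (coord3 m)) ->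
  filterlim g F (locally m).
Proof.
intros H0 H1 H2 H3; apply filterlim_locally; intros eps.
generalize (filter_and _ _ (filter_and _ _ (proj1 (filterlim_locally _ _) H0 eps)
    (proj1 (filterlim_locally _ _) H1 eps))
  (filter_and _ _ (proj1 (filterlim_locally _ _) H2 eps)
    (proj1 (filterlim_locally _ _) H3 eps))).
apply filter_imp; intros t [[B0 B1] [B2 B3]].
split; [split; [split|]|]; assumption.
Qed.

Lemma R4_ball_components (m p : R4) (e : R) :
  ball m e p -> Rabs (coord0 p - coord0 m) < e /\ Rabs (coord1 p - coord1 m) < e /\
    Rabs (coord2 p - coord2 m) < e /\ Rabs (coord3 p - coord3 m) < e.
Proof. intros [[[B0 B1] B2] B3]; split; [|split; [|split]]; assumption. Qed.

Lemma prod_norm_le (U V : NormedModule R_AbsRing) (p : prod_NormedModule R_AbsRing U V) :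
  norm p <= norm (fst p) + norm (snd p).
Proof.
change (prod_norm p <= norm (fst p) + norm (snd p)); unfold prod_norm.
apply Rsqr_incr_0_var.
- rewrite Rsqr_sqrt.
  + unfold Rsqr; generalize (norm_ge_0 (fst p)) (norm_ge_0 (snd p)); nra.
  + generalize (pow2_ge_0 (norm (fst p))) (pow2_ge_0 (norm (snd p))); lra.
- generalize (norm_ge_0 (fst p)) (norm_ge_0 (snd p)); lra.
Qed.

Lemma R4_norm_le (m : R4) :
  norm m <= Rabs (coord0 m) + Rabs (coord1 m) + Rabs (coord2 m) + Rabs (coord3 m).
Proof.
assert (H1 := prod_norm_le _ _ m); assert (H2 := prod_norm_le _ _ (fst m)).
assert (H3 := prod_norm_le _ _ (fst (fst m))).
unfold coord0, coord1, coord2, coord3.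
change (norm (snd m)) with (Rabs (snd m)) in H1.
change (norm (snd (fst m))) with (Rabs (snd (fst m))) in H2.
change (norm (snd (fst (fst m)))) with (Rabs (snd (fst (fst m)))) in H3.
change (norm (fst (fst (fst m)))) with (Rabs (fst (fst (fst m)))) in H3.
apply Rle_trans with (1 := H1); apply Rplus_le_compat_r.
apply Rle_trans with (1 := H2); apply Rplus_le_compat_r; exact H3.
Qed.

(** The way back from chain entries to [(u, u', u'', u''')]. It is linear, so it serves for tangent
    vectors too. *)
Definition point (y : nat -> R -> R) (s : R) : R4 :=
  (y 0%nat s, y 1%nat s - y 0%nat s, y 2%nat s + y 0%nat s,
   y 3%nat s - y 2%nat s + y 1%nat s - y 0%nat s).

(** The effect of [u (x) -> u (- x)] on phase space. It reverses the flow and exchanges the stable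
    and the unstable manifold. *)
Definition reversal (m : R4) : R4 := (coord0 m, - coord1 m, coord2 m, - coord3 m).

Lemma decays_filterlim (a : R) (f : R -> R) :
  decays a f -> filterlim f (Rbar_locally p_infty) (locally 0).
Proof.
intros Hf; destruct (decays_nonneg a f Hf) as [C [HC0 HC]].
apply filterlim_locally; intros eps.
destruct (exp_decay_lt C (2 / 3) a eps) as [s0 [Hs0 Hs]]; [lra | apply cond_pos|].
exists s0; intros s Hss.
assert (Has : a <= s) by lra.
assert (Hr : rate s <= rate s0) by (apply rate_le; lra).
change (exp (- (2 / 3) * s0)) with (rate s0) in Hs.
change (Rabs (f s - 0) < eps); rewrite Rminus_0_r.
apply Rle_lt_trans with (1 := HC s Has).
apply Rle_lt_trans with (2 := Hs); now apply Rmult_le_compat_l.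
Qed.

Lemma forward_of_chain (y : nat -> R -> R) :
  (forall s, 0 <= s -> chain_at y (y 0%nat s ^ 3) s) -> chain_decays 0 y ->
  forward_to_0 (point y) (point y 0).
Proof.
intros Hy Hd; split; [easy|split].
- intros s Hs; destruct (Hy s Hs) as [E0 [E1 [E2 E3]]].
  apply R4_is_derive; unfold coord0, coord1, coord2, coord3; simpl; der.
- assert (D0 := Hd 0%nat ltac:(lia)); assert (D1 := Hd 1%nat ltac:(lia)).
  assert (D2 := Hd 2%nat ltac:(lia)); assert (D3 := Hd 3%nat ltac:(lia)).
  apply R4_filterlim; try apply Rbar_locally_filter;
    apply (decays_filterlim 0); unfold coord0, coord1, coord2, coord3; simpl; decay.
Qed.

Lemma chain_shift (y : nat -> R -> R) (F x s : R) :
  chain_at y F (x + s) -> chain_at (fun i s => y i (x + s)) F s.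
Proof.
intros [E0 [E1 [E2 E3]]].
assert (H : forall (f : R -> R) (l : R), is_derive f (x + s) l -> is_derive (fun s => f (x + s)) s l).
{ intros f l Hf; der. }
split; [|split; [|split]]; now apply H.
Qed.

Lemma decays_shift (x : R) (f : R -> R) :
  decays x f -> decays 0 (fun s => f (x + s)).
Proof.
intros [C HC]; exists (C * rate x); intros s Hs; rewrite Rmult_assoc, <- rate_plus.
apply HC; lra.
Qed.

(** The four coordinates are signed sums of 1, 2, 2 and 4 chain entries, and [1 + 2 + 2 + 4 = 9]. *)
Lemma point_norm_le (y : nat -> R -> R) (s M : R) :
  (forall i, (i < 4)%nat -> Rabs (y i s) <= M) -> norm (point y s) <= 9 * M.
Proof.
intros H; apply Rle_trans with (1 := R4_norm_le _); unfold point, coord0, coord1, coord2, coord3; simpl.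
assert (H0 := H 0%nat ltac:(lia)); assert (H1 := H 1%nat ltac:(lia)).
assert (H2 := H 2%nat ltac:(lia)); assert (H3 := H 3%nat ltac:(lia)).
assert (A1 : Rabs (y 1%nat s - y 0%nat s) <= 2 * M).
{ apply Rabs_le_between in H0; apply Rabs_le_between in H1; apply Rabs_le; lra. }
assert (A2 : Rabs (y 2%nat s + y 0%nat s) <= 2 * M).
{ apply Rabs_le_between in H0; apply Rabs_le_between in H2; apply Rabs_le; lra. }
assert (A3 : Rabs (y 3%nat s - y 2%nat s + y 1%nat s - y 0%nat s) <= 4 * M).
{ apply Rabs_le_between in H0; apply Rabs_le_between in H1; apply Rabs_le_between in H2;
    apply Rabs_le_between in H3; apply Rabs_le; lra. }
lra.
Qed.

Lemma point_ext (y z : nat -> R -> R) (s t : R) :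
  (forall i, (i < 4)%nat -> y i s = z i t) -> point y s = point z t.
Proof. intros H; unfold point; rewrite !H by lia; easy. Qed.

Lemma chain_at_ext (y z : nat -> R -> R) (F s : R) :
  (forall i r, y i r = z i r) -> chain_at y F s -> chain_at z F s.
Proof.
intros H [E0 [E1 [E2 E3]]].
rewrite ?(H 0%nat s), ?(H 1%nat s), ?(H 2%nat s), ?(H 3%nat s) in *.
split; [|split; [|split]]; (eapply is_derive_ext; [intros r; apply H|]); assumption.
Qed.

(** The curve is [t -> u + t f + v t] at [x], with velocity [f + V t]; at [t = 0] both corrections
    vanish. The bound [M * rate] is common to all small [t], so one [T] places the whole curve in
    one disc. *)
Lemma tangent_stable_of_solution (y f : nat -> R -> R) (x : R) :
  orbit y -> linear_solution y x f -> tangent_stable (point y x) (point f x).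
Proof.
intros Hy Hf delta Hdelta.
destruct (perturbed_family y f x Hy Hf) as [e [K [v [V [He [HK H]]]]]].
destruct (chain_decays_bound x y) as [Cy [HCy0 HCy]]; [apply Hy|].
destruct (chain_decays_bound x f) as [Cf [HCf0 HCf]]; [apply Hf|].
set (M := Cy + Cf + K).
(* Chosen so that [9 * M * rate (x + T) < delta], in view of [point_norm_le]. *)
destruct (exp_decay_lt (9 * M * rate x) (2 / 3) 0 delta) as [T [HT0 HT]]; [lra|easy|].
change (exp (- (2 / 3) * T)) with (rate T) in HT.
exists T; split; [easy|].
set (Y := fun t i s => y i s + t * f i s + v t i s).
assert (He' : 0 < Rmin e 1) by (apply Rmin_glb_lt; lra).
assert (HY : forall t, Rabs t < Rmin e 1 -> forall i s, (i < 4)%nat -> x <= s ->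
  Rabs (Y t i s) <= M * rate s).
{ intros t Ht i s Hi Hs.
  assert (Ht1 : Rabs t < e) by (apply Rlt_le_trans with (1 := Ht), Rmin_l).
  assert (Ht2 : Rabs t < 1) by (apply Rlt_le_trans with (1 := Ht), Rmin_r).
  destruct (H t Ht1) as [_ [Hb _]]; specialize (Hb i s Hi Hs).
  replace (M * rate s) with (Cy * rate s + 1 * (Cf * rate s) + K * rate s)
    by (unfold M; ring).
  apply Rabs_plus_le; [apply Rabs_plus_le; [auto|]|].
  - apply Rabs_mult_le; [lra | auto].
  - apply Rle_trans with (1 := Hb); apply Rmult_le_compat_r; [left; apply rate_pos|].
    rewrite <- (Rmult_1_r K) at 2; apply Rmult_le_compat_l; [easy|].
    rewrite <- pow2_abs; generalize (Rabs_pos t); nra. }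
exists (fun t => point (Y t) x), (fun t => point (fun i s => f i s + V t i s) x), (Rmin e 1).
assert (H0 : Rabs 0 < e) by (rewrite Rabs_R0; easy).
destruct (H 0 H0) as [_ [Hb0 Hd0]].
split; [easy|split; [|split]].
- apply point_ext; intros i Hi; unfold Y.
  specialize (Hb0 i x Hi (Rle_refl x)).
  assert (E : v 0 i x = 0).
  { apply Rabs_eq_0, Rle_antisym; [|apply Rabs_pos].
    replace 0 with (K * 0 ^ 2 * rate x) at 2 by ring; exact Hb0. }
  rewrite E; ring.
- apply point_ext; intros i Hi.
  destruct (Hd0 i Hi) as [_ [_ Hb]]; rewrite Rabs_R0, Rmult_0_r in Hb.
  assert (E : V 0 i x = 0) by (apply Rabs_eq_0, Rle_antisym; [easy|apply Rabs_pos]).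
  rewrite E; ring.
- intros t Ht.
  assert (Ht1 : Rabs t < e) by (apply Rlt_le_trans with (1 := Ht), Rmin_l).
  destruct (H t Ht1) as [Hc [_ Hd]].
  assert (Hder : forall i, (i < 4)%nat ->
    is_derive (fun t => Y t i x) t (f i x + V t i x) /\ continuous (fun t => f i x + V t i x) t).
  { intros i Hi; destruct (Hd i Hi) as [D1 [D2 _]]; split.
    - unfold Y; pose (w := fun t => v t i x).
      change (is_derive (fun t => y i x + t * f i x + w t) t (f i x + V t i x)).
      change (is_derive w t (V t i x)) in D1.
      revert D1; generalize (V t i x) (f i x) (y i x); clearbody w; clear; intros l a b D1.
      der.
    - apply continuous_Rplus; [apply continuous_const | exact D2]. }
  destruct (Hder 0%nat ltac:(lia)) as [D0 K0]; destruct (Hder 1%nat ltac:(lia)) as [D1 K1].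
  destruct (Hder 2%nat ltac:(lia)) as [D2 K2]; destruct (Hder 3%nat ltac:(lia)) as [D3 K3].
  split; [|split].
  + apply R4_is_derive; unfold point, coord0, coord1, coord2, coord3; simpl.
    * exact D0.
    * apply (is_derive_minus (V := R_NormedModule) (fun t => Y t 1%nat x) (fun t => Y t 0%nat x));
        assumption.
    * apply (is_derive_plus (V := R_NormedModule) (fun t => Y t 2%nat x) (fun t => Y t 0%nat x));
        assumption.
    * apply (is_derive_minus (V := R_NormedModule)
        (fun t => Y t 3%nat x - Y t 2%nat x + Y t 1%nat x) (fun t => Y t 0%nat x)); [|assumption].
      apply (is_derive_plus (V := R_NormedModule)
        (fun t => Y t 3%nat x - Y t 2%nat x) (fun t => Y t 1%nat x)); [|assumption].
      apply (is_derive_minus (V := R_NormedModule) (fun t => Y t 3%nat x) (fun t => Y t 2%nat x));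
        assumption.
  + apply R4_filterlim; [apply locally_filter| | | |]; unfold point, coord0, coord1, coord2, coord3; simpl.
    * exact K0.
    * apply (continuous_Rminus (fun t => f 1%nat x + V t 1%nat x) (fun t => f 0%nat x + V t 0%nat x));
        assumption.
    * apply (continuous_Rplus (fun t => f 2%nat x + V t 2%nat x) (fun t => f 0%nat x + V t 0%nat x));
        assumption.
    * apply (continuous_Rminus (fun t => f 3%nat x + V t 3%nat x - (f 2%nat x + V t 2%nat x)
          + (f 1%nat x + V t 1%nat x)) (fun t => f 0%nat x + V t 0%nat x)); [|assumption].
      apply (continuous_Rplus (fun t => f 3%nat x + V t 3%nat x - (f 2%nat x + V t 2%nat x))
        (fun t => f 1%nat x + V t 1%nat x)); [|assumption].
      apply (continuous_Rminus (fun t => f 3%nat x + V t 3%nat x) (fun t => f 2%nat x + V t 2%nat x));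
        assumption.
  + exists (point (fun i s => Y t i (x + s))); split.
    * replace (point (Y t) x) with (point (fun i s => Y t i (x + s)) 0)
        by (apply point_ext; intros; now rewrite Rplus_0_r).
      apply forward_of_chain.
      -- intros s Hs; apply chain_shift.
         assert (Hxs : x <= x + s) by lra.
         specialize (Hc (x + s) Hxs).
         (* The sources of [u], [t f] and [v] add up to [(u + t f + v)^3]. *)
         apply (chain_ext _ (1 * (1 * y 0%nat (x + s) ^ 3
             + t * (3 * y 0%nat (x + s) ^ 2 * f 0%nat (x + s)))
           + 1 * perturbation_source (y 0%nat (x + s)) (f 0%nat (x + s)) (v t 0%nat (x + s)) t)).
         ++ unfold perturbation_source, Y; ring.
         ++ assert (HH : chain_at (lincomb 1 1 (lincomb 1 t y f) (v t))
             (1 * (1 * y 0%nat (x + s) ^ 3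
             + t * (3 * y 0%nat (x + s) ^ 2 * f 0%nat (x + s)))
           + 1 * perturbation_source (y 0%nat (x + s)) (f 0%nat (x + s)) (v t 0%nat (x + s)) t)
             (x + s)).
            { apply chain_lincomb; [apply chain_lincomb; [apply Hy | now apply Hf] | exact Hc]. }
            revert HH; apply chain_at_ext; intros i r; unfold lincomb, Y; ring.
      -- intros i Hi; apply (decays_shift x (Y t i)); exists M; intros s Hs; now apply HY.
    * intros s Hs; apply Rle_lt_trans with (9 * (M * rate (x + s))).
      -- apply point_norm_le; intros i Hi; apply HY; auto; lra.
      -- rewrite rate_plus; apply Rle_lt_trans with (2 := HT).
         assert (Hr : rate s <= rate T) by now apply rate_le.
         replace (9 * (M * (rate x * rate s))) with (9 * M * rate x * rate s) by ring.
         apply Rmult_le_compat_l; [|easy].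
         apply Rmult_le_pos; [unfold M; lra | left; apply rate_pos].
Qed.

(** * Time reversal and the energy level *)

Lemma reversal_derive (g : R -> R4) (t : R) (v : R4) :
  is_derive g t v -> is_derive (fun t => reversal (g t)) t (reversal v).
Proof.
intros H; destruct (R4_derive_components g t v H) as [H0 [H1 [H2 H3]]].
apply R4_is_derive.
- exact H0.
- exact (is_derive_opp (V := R_NormedModule) _ _ _ H1).
- exact H2.
- exact (is_derive_opp (V := R_NormedModule) _ _ _ H3).
Qed.

Lemma reversal_filterlim (T : Type) (F : (T -> Prop) -> Prop) {FF : Filter F} (g : T -> R4) (m : R4) :
  filterlim g F (locally m) -> filterlim (fun t => reversal (g t)) F (locally (reversal m)).
Proof.
intros H; assert (H' := fun eps => proj1 (filterlim_locally _ _) H eps).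
apply filterlim_locally; intros eps; generalize (H' eps); apply filter_imp; intros t Ht.
apply R4_ball_components in Ht; destruct Ht as [B0 [B1 [B2 B3]]].
split; [split; [split|]|]; unfold reversal; simpl.
- exact B0.
- change (Rabs (- coord1 (g t) - - coord1 m) < eps).
  replace (- coord1 (g t) - - coord1 m) with (- (coord1 (g t) - coord1 m)) by ring; now rewrite Rabs_Ropp.
- exact B2.
- change (Rabs (- coord3 (g t) - - coord3 m) < eps).
  replace (- coord3 (g t) - - coord3 m) with (- (coord3 (g t) - coord3 m)) by ring; now rewrite Rabs_Ropp.
Qed.

Lemma reversal_norm (m : R4) : norm (reversal m) = norm m.
Proof.
destruct m as [[[a b] c] d].
change (sqrt (sqrt (sqrt (Rabs a ^ 2 + Rabs (- b) ^ 2) ^ 2 + Rabs c ^ 2) ^ 2 + Rabs (- d) ^ 2)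
  = sqrt (sqrt (sqrt (Rabs a ^ 2 + Rabs b ^ 2) ^ 2 + Rabs c ^ 2) ^ 2 + Rabs d ^ 2)).
now rewrite !Rabs_Ropp.
Qed.

Lemma reversal_flow (U : R -> R4) (s : R) :
  is_derive U (- s) (vector_field (U (- s))) ->
  is_derive (fun s => reversal (U (- s))) s (vector_field (reversal (U (- s)))).
Proof.
intros H; destruct (R4_derive_components _ _ _ H) as [D0 [D1 [D2 D3]]].
apply is_derive_opp_arg in D0; apply is_derive_opp_arg in D1.
apply is_derive_opp_arg in D2; apply is_derive_opp_arg in D3.
revert D0 D1 D2 D3.
set (a := fun s => coord0 (U (- s))); set (b := fun s => coord1 (U (- s))).
set (c := fun s => coord2 (U (- s))); set (d := fun s => coord3 (U (- s))).
rewrite (R4_eta (U (- s))).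
change (coord0 (U (- s))) with (a s); change (coord1 (U (- s))) with (b s).
change (coord2 (U (- s))) with (c s); change (coord3 (U (- s))) with (d s).
unfold vector_field, reversal; unfold coord0, coord1, coord2, coord3; simpl.
intros D0 D1 D2 D3.
apply R4_is_derive; unfold coord0, coord1, coord2, coord3; simpl.
- exact D0.
- change (is_derive (fun s => - b s) s (c s)); der.
- exact D2.
- change (is_derive (fun s => - d s) s (2 * c s - a s + a s * (a s * (a s * 1)))); der.
Qed.

Lemma reversal_zero : reversal (zero : R4) = zero.
Proof.
unfold reversal, coord0, coord1, coord2, coord3; simpl.
change ((0, - 0, 0, - 0) = (0, 0, 0, 0) :> R4); now rewrite Ropp_0.
Qed.

Lemma reversal_backward (U : R -> R4) (m : R4) :
  forward_to_0 U m -> backward_to_0 (fun s => reversal (U (- s))) (reversal m).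
Proof.
intros [H0 [H1 H2]]; split; [|split].
- now rewrite Ropp_0, H0.
- intros s Hs; apply reversal_flow, H1; lra.
- rewrite <- reversal_zero.
  apply (filterlim_comp _ _ _ Ropp (fun s => reversal (U s)) _ (Rbar_locally p_infty)).
  + exact (filterlim_Rbar_opp m_infty).
  + apply reversal_filterlim; [apply Rbar_locally_filter | exact H2].
Qed.

Lemma reversal_forward (U : R -> R4) (m : R4) :
  backward_to_0 U m -> forward_to_0 (fun s => reversal (U (- s))) (reversal m).
Proof.
intros [H0 [H1 H2]]; split; [|split].
- now rewrite Ropp_0, H0.
- intros s Hs; apply reversal_flow, H1; lra.
- rewrite <- reversal_zero.
  apply (filterlim_comp _ _ _ Ropp (fun s => reversal (U s)) _ (Rbar_locally m_infty)).
  + exact (filterlim_Rbar_opp p_infty).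
  + apply reversal_filterlim; [apply Rbar_locally_filter | exact H2].
Qed.

Lemma tangent_unstable_reversal (m v : R4) :
  tangent_stable m v -> tangent_unstable (reversal m) (reversal v).
Proof.
intros H delta Hd; destruct (H delta Hd) as [T [HT [g [dg [e [He [G0 [G1 G2]]]]]]]].
exists T; split; [easy|].
exists (fun t => reversal (g t)), (fun t => reversal (dg t)), e.
split; [easy|split; [now rewrite G0|split; [now rewrite G1|]]].
intros t Ht; destruct (G2 t Ht) as [D [Cg [U [HU HUd]]]].
split; [now apply reversal_derive|split].
- apply reversal_filterlim; [apply locally_filter | exact Cg].
- exists (fun s => reversal (U (- s))); split; [now apply reversal_backward|].
  intros s Hs; rewrite reversal_norm; apply HUd; lra.
Qed.

Lemma reversal_involutive (m : R4) : reversal (reversal m) = m.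
Proof.
rewrite (R4_eta m) at 2; unfold reversal, coord0, coord1, coord2, coord3; simpl; now rewrite !Ropp_involutive.
Qed.

Lemma R4_eq (a b c d a' b' c' d' : R) :
  a = a' -> b = b' -> c = c' -> d = d' -> (a, b, c, d) = (a', b', c', d') :> R4.
Proof. now intros -> -> -> ->. Qed.

Lemma R4_eq_plus (a b c d a1 b1 c1 d1 a2 b2 c2 d2 : R) :
  a = a1 + a2 -> b = b1 + b2 -> c = c1 + c2 -> d = d1 + d2 ->
  ((a, b, c, d) : R4) = plus ((a1, b1, c1, d1) : R4) ((a2, b2, c2, d2) : R4).
Proof. now intros -> -> -> ->. Qed.

Lemma point_reflect (y : nat -> R -> R) (s : R) : point (reflect y) s = reversal (point y (- s)).
Proof.
unfold point, reversal, reflect, coord0, coord1, coord2, coord3; simpl.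
apply R4_eq; ring.
Qed.

(** The energy is constant along the flow and continuous at 0. Hence both manifolds lie in the zero
    level, which gives the easy inclusion of tangent spaces. *)
Lemma energy_forward (U : R -> R4) (m : R4) : forward_to_0 U m -> energy m = 0.
Proof.
intros [H0 [H1 H2]].
assert (Hc : forall s, 0 <= s -> is_derive (fun s => energy (U s)) s 0).
{ intros s Hs; destruct (R4_derive_components _ _ _ (H1 s Hs)) as [D0 [D1 [D2 D3]]].
  apply (is_derive_ext (fun s => coord1 (U s) * coord3 (U s) - / 2 * coord2 (U s) ^ 2 - coord1 (U s) ^ 2
    + / 2 * coord0 (U s) ^ 2 - / 4 * coord0 (U s) ^ 4)).
  - intros r; now rewrite (R4_eta (U r)).
  - revert D0 D1 D2 D3.
    set (a := fun s => coord0 (U s)); set (b := fun s => coord1 (U s)).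
    set (c := fun s => coord2 (U s)); set (d := fun s => coord3 (U s)).
    rewrite (R4_eta (U s)).
    change (coord0 (U s)) with (a s); change (coord1 (U s)) with (b s).
    change (coord2 (U s)) with (c s); change (coord3 (U s)) with (d s).
    unfold vector_field, coord0, coord1, coord2, coord3; simpl; intros D0 D1 D2 D3.
    change (is_derive (fun s => b s * d s - / 2 * c s ^ 2 - b s ^ 2 + / 2 * a s ^ 2 - / 4 * a s ^ 4) s 0).
    der. }
assert (Hconst : forall s, 0 <= s -> energy (U s) = energy m).
{ intros s Hs; rewrite <- H0; apply Rle_antisym.
  - assert (H : - energy (U 0) <= - energy (U s)); [|lra].
    apply (nondecreasing_of_derive (fun s => - energy (U s)) (fun _ => 0)); [easy| |intros; lra].
    intros r Hr; assert (Hr' : 0 <= r) by lra; specialize (Hc r Hr').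
    revert Hc; set (E := fun s => energy (U s)); intros Hc; change (is_derive (fun s => - E s) r 0).
    der.
  - apply (nondecreasing_of_derive (fun s => energy (U s)) (fun _ => 0)); [easy| |intros; lra].
    intros r Hr; apply Hc; lra. }
assert (Hsmall : forall eps, 0 < eps -> eps < 1 -> Rabs (energy m) <= 4 * eps).
{ intros eps He He1.
  destruct (proj1 (filterlim_locally _ _) H2 (mkposreal eps He)) as [M HM].
  assert (HMs : M < Rmax 0 (M + 1)) by (generalize (Rmax_r 0 (M + 1)); lra).
  set (r := Rmax 0 (M + 1)) in *.
  assert (HB : Rabs (coord0 (U r) - 0) < eps /\ Rabs (coord1 (U r) - 0) < eps /\
    Rabs (coord2 (U r) - 0) < eps /\ Rabs (coord3 (U r) - 0) < eps)
    by exact (R4_ball_components _ _ _ (HM _ HMs)).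
  rewrite !Rminus_0_r in HB.
  rewrite <- (Hconst r (Rmax_l _ _)), (R4_eta (U r)); unfold energy.
  revert HB; generalize (coord0 (U r)) (coord1 (U r)) (coord2 (U r)) (coord3 (U r)).
  clear - He He1; intros a b c d [A [B [C D]]].
  apply Rabs_def2 in A; apply Rabs_def2 in B; apply Rabs_def2 in C; apply Rabs_def2 in D.
  assert (A2 : 0 <= a ^ 2 <= eps) by nra.
  assert (A4 : 0 <= a ^ 4 <= eps) by (replace (a ^ 4) with (a ^ 2 * a ^ 2) by ring; nra).
  assert (B2 : 0 <= b ^ 2 <= eps) by nra.
  assert (C2 : 0 <= c ^ 2 <= eps) by nra.
  assert (BD : - eps <= b * d <= eps) by nra.
  apply Rabs_le; lra. }
assert (H : Rabs (energy m) <= 0); [|apply Rabs_eq_0; generalize (Rabs_pos (energy m)); lra].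
apply (le_of_half_pow _ _ 4); intros n; rewrite Rplus_0_l.
assert (Hp : 0 < (1 / 2) ^ n) by (apply pow_lt; lra).
destruct n as [|n].
- generalize (Hsmall (1 / 2)); simpl; lra.
- apply Hsmall; [easy|].
  assert ((1 / 2) ^ n <= 1 ^ n) by (apply pow_incr; lra).
  rewrite pow1 in H; simpl; lra.
Qed.

Lemma energy_reversal (m : R4) : energy (reversal m) = energy m.
Proof. destruct m as [[[a b] c] d]; unfold reversal, energy, coord0, coord1, coord2, coord3; simpl; ring. Qed.

(** * The tangent space of the zero energy set *)

Lemma tangent_space_mono (S S' : R4 -> Prop) (m v : R4) :
  (forall p, S p -> S' p) -> tangent_space S m v -> tangent_space S' m v.
Proof.
intros H [g [dg [e [He [G0 [G1 G2]]]]]]; exists g, dg, e.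
split; [easy|split; [easy|split; [easy|]]].
intros t Ht; destruct (G2 t Ht) as [D [C P]]; auto.
Qed.

Definition energy_differential (m v : R4) : R :=
  (coord0 m - coord0 m ^ 3) * coord0 v + (coord3 m - 2 * coord1 m) * coord1 v - coord2 m * coord2 v + coord1 m * coord3 v.

Lemma energy_tangent_kernel (m v : R4) :
  tangent_space zero_energy_set m v -> energy_differential m v = 0.
Proof.
intros [g [dg [e [He [G0 [G1 G2]]]]]].
assert (H0 : Rabs 0 < e) by (rewrite Rabs_R0; easy).
destruct (G2 0 H0) as [D _]; rewrite G1 in D.
destruct (R4_derive_components _ _ _ D) as [D0 [D1 [D2 D3]]].
rewrite <- G0.
assert (DE : is_derive (fun s => coord1 (g s) * coord3 (g s) - / 2 * coord2 (g s) ^ 2 - coord1 (g s) ^ 2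
    + / 2 * coord0 (g s) ^ 2 - / 4 * coord0 (g s) ^ 4) 0 (energy_differential (g 0) v)).
{ unfold energy_differential; revert D0 D1 D2 D3.
  set (a := fun s => coord0 (g s)); set (b := fun s => coord1 (g s)).
  set (c := fun s => coord2 (g s)); set (d := fun s => coord3 (g s)).
  change (coord0 (g 0)) with (a 0); change (coord1 (g 0)) with (b 0).
  change (coord2 (g 0)) with (c 0); change (coord3 (g 0)) with (d 0).
  intros D0 D1 D2 D3.
  change (is_derive (fun s => b s * d s - / 2 * c s ^ 2 - b s ^ 2 + / 2 * a s ^ 2 - / 4 * a s ^ 4) 0
    ((a 0 - a 0 ^ 3) * coord0 v + (d 0 - 2 * b 0) * coord1 v - c 0 * coord2 v + b 0 * coord3 v)).
  der. }
assert (DZ : is_derive (fun s => coord1 (g s) * coord3 (g s) - / 2 * coord2 (g s) ^ 2 - coord1 (g s) ^ 2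
    + / 2 * coord0 (g s) ^ 2 - / 4 * coord0 (g s) ^ 4) 0 0).
{ apply (is_derive_ext_loc (fun _ => 0)).
  - exists (mkposreal e He); intros t Ht.
    assert (Ht' : Rabs t < e).
    { change (Rabs (t - 0) < e) in Ht; now rewrite Rminus_0_r in Ht. }
    destruct (G2 t Ht') as [_ [_ P]]; unfold zero_energy_set in P.
    rewrite (R4_eta (g t)) in P; symmetry; exact P.
  - apply (is_derive_const (V := R_NormedModule)). }
apply is_derive_unique in DE; apply is_derive_unique in DZ; now rewrite <- DE.
Qed.

(** An explicit implicit function theorem. Three coordinates move linearly along [v] and the fourth
    is solved from [E = 0]: [u'''], which enters linearly with factor [u'], when [u' <> 0], and
    otherwise [u''] by a square root. *)
Lemma energy_kernel_tangent (m v : R4) :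
  energy m = 0 -> coord1 m <> 0 \/ coord2 m <> 0 -> energy_differential m v = 0 ->
  tangent_space zero_energy_set m v.
Proof.
destruct m as [[[a b] c] d]; destruct v as [[[p q] r] w].
unfold energy_differential, coord0, coord1, coord2, coord3; simpl; intros HE Hbc Hd.
destruct (Req_dec b 0) as [Hb|Hb].
- assert (Hc : c <> 0) by tauto.
  (* Scaled by [c ^ 2] so that the third coordinate is [c * sqrt (N t)], which keeps the sign of [c]
     and starts at [c] because [N 0 = 1]. The kernel condition enters through [dN 0 = 2 * r / c]. *)
  set (N := fun t => 2 * ((b + t * q) * (d + t * w) - (b + t * q) ^ 2 + / 2 * (a + t * p) ^ 2
    - / 4 * (a + t * p) ^ 4) / c ^ 2).
  set (dN := fun t => 2 * (q * (d + t * w) + (b + t * q) * w - 2 * q * (b + t * q)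
    + p * (a + t * p) - p * (a + t * p) ^ 3) / c ^ 2).
  assert (HdN : forall t, is_derive N t (dN t)).
  { intros t; unfold N, dN; auto_derive; [easy|field; easy]. }
  assert (HN0 : N 0 = 1).
  { unfold N; apply Rmult_eq_reg_r with (c ^ 2); [|now apply pow_nonzero].
    field_simplify; [|easy]; nra. }
  assert (HdN0 : dN 0 = 2 * r / c).
  { unfold dN; apply Rmult_eq_reg_r with (c ^ 2); [|now apply pow_nonzero].
    field_simplify; [|easy|easy]; nra. }
  assert (Hcont : continuous N 0) by (eapply derivable_cont; apply HdN).
  destruct (proj1 (filterlim_locally _ _) Hcont (mkposreal _ Rlt_0_1)) as [e He].
  assert (HNp : forall t, Rabs t < e -> 0 < N t).
  { intros t Ht; assert (Hb' : ball 0 e t) by (change (Rabs (t - 0) < e); now rewrite Rminus_0_r).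
    specialize (He t Hb'); change (Rabs (N t - N 0) < 1) in He; rewrite HN0 in He.
    apply Rabs_def2 in He; lra. }
  exists (fun t => (a + t * p, b + t * q, c * sqrt (N t), d + t * w)),
    (fun t => (p, q, c * (dN t / (2 * sqrt (N t))), w)), e.
  split; [apply cond_pos|split; [|split]].
  + rewrite HN0, sqrt_1, !Rmult_0_l, !Rplus_0_r, Rmult_1_r; easy.
  + rewrite HN0, HdN0, sqrt_1; f_equal; f_equal; field; easy.
  + intros t Ht; specialize (HNp t Ht).
    assert (Hs : 0 < sqrt (N t)) by now apply sqrt_lt_R0.
    generalize (HdN t); intros HdNt.
    split; [|split].
    * apply R4_is_derive; unfold coord0, coord1, coord2, coord3; simpl.
      -- auto_derive; [easy|ring].
      -- auto_derive; [easy|ring].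
      -- clearbody N dN; der.
      -- auto_derive; [easy|ring].
    * apply R4_filterlim; [apply locally_filter| | | |]; unfold coord0, coord1, coord2, coord3; simpl;
        try apply (continuous_const (U := R_UniformSpace) (V := R_UniformSpace)).
      apply (continuous_Rmult (fun _ => c) (fun t => dN t / (2 * sqrt (N t))));
        [apply continuous_const|].
      apply (continuous_Rmult dN (fun t => / (2 * sqrt (N t)))).
      -- eapply derivable_cont with (l := Derive dN t); apply Derive_correct.
         unfold dN; auto_derive; easy.
      -- eapply derivable_cont with (l := Derive (fun t => / (2 * sqrt (N t))) t).
         apply Derive_correct; clearbody N; auto_derive; split; [|split; [lra|]].
         ++ now exists (dN t).
         ++ split; [lra|easy].
    * unfold zero_energy_set, energy.
      assert (Hsq : (c * sqrt (N t)) ^ 2 = c ^ 2 * N t).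
      { rewrite Rpow_mult_distr, pow2_sqrt by lra; easy. }
      rewrite Hsq; unfold N; field; easy.
- set (N := fun t => / 2 * (c + t * r) ^ 2 + (b + t * q) ^ 2 - / 2 * (a + t * p) ^ 2
    + / 4 * (a + t * p) ^ 4).
  set (dN := fun t => r * (c + t * r) + 2 * q * (b + t * q) - p * (a + t * p)
    + p * (a + t * p) ^ 3).
  assert (HdN : forall t, is_derive N t (dN t)).
  { intros t; unfold N, dN; auto_derive; [easy|field; easy]. }
  assert (Hq : 0 < 2 * (Rabs q + 1)) by (generalize (Rabs_pos q); lra).
  assert (Hbp : 0 < Rabs b) by now apply Rabs_pos_lt.
  (* Within this radius [t * q] cannot cancel [b], so the denominator [b + t * q] stays nonzero. *)
  set (e := Rabs b / (2 * (Rabs q + 1))).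
  assert (He : 0 < e) by now apply Rdiv_lt_0_compat.
  assert (Hnz : forall t, Rabs t < e -> b + t * q <> 0).
  { intros t Ht H0; assert (Hbt : Rabs b = Rabs t * Rabs q).
    { rewrite <- Rabs_mult, <- Rabs_Ropp; f_equal; lra. }
    apply Rlt_div_r in Ht; [|easy]; generalize (Rabs_pos t) (Rabs_pos q); nra. }
  exists (fun t => (a + t * p, b + t * q, c + t * r, N t / (b + t * q))),
    (fun t => (p, q, r, (dN t * (b + t * q) - N t * q) / (b + t * q) ^ 2)), e.
  split; [easy|split; [|split]].
  + rewrite !Rmult_0_l, !Rplus_0_r; f_equal; unfold N; rewrite !Rmult_0_l, !Rplus_0_r.
    apply Rmult_eq_reg_r with b; [|easy]; field_simplify; [|easy]; nra.
  + f_equal; unfold N, dN; rewrite !Rmult_0_l, !Rplus_0_r.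
    apply Rmult_eq_reg_r with (b ^ 2); [|now apply pow_nonzero].
    replace ((((r * c + 2 * q * b - p * a + p * a ^ 3) * b
      - (/ 2 * c ^ 2 + b ^ 2 - / 2 * a ^ 2 + / 4 * a ^ 4) * q) / b ^ 2) * b ^ 2)
      with ((r * c + 2 * q * b - p * a + p * a ^ 3) * b
      - (/ 2 * c ^ 2 + b ^ 2 - / 2 * a ^ 2 + / 4 * a ^ 4) * q) by (field; easy).
    replace (/ 2 * c ^ 2 + b ^ 2 - / 2 * a ^ 2 + / 4 * a ^ 4) with (b * d) by (simpl in *; lra).
    replace (r * c + 2 * q * b - p * a + p * a ^ 3) with (d * q + b * w) by (simpl in *; lra).
    ring.
  + intros t Ht; specialize (Hnz t Ht).
    generalize (HdN t); intros HdNt.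
    assert (Hcd : continuous (fun t => (dN t * (b + t * q) - N t * q) / (b + t * q) ^ 2) t).
    { apply (ex_derive_continuous (fun t => (dN t * (b + t * q) - N t * q) / (b + t * q) ^ 2)).
      unfold N, dN; auto_derive; exact (pow_nonzero _ 2 Hnz). }
    split; [|split].
    * apply R4_is_derive; unfold coord0, coord1, coord2, coord3; simpl; try (auto_derive; [easy|ring]).
      clearbody N dN; der; try (simpl; field; easy).
    * apply R4_filterlim; [apply locally_filter| | | |]; unfold coord0, coord1, coord2, coord3; simpl;
        try apply (continuous_const (U := R_UniformSpace) (V := R_UniformSpace)).
      exact Hcd.
    * unfold zero_energy_set, energy.
      replace ((b + t * q) * (N t / (b + t * q))) with (N t) by (field; easy).
      unfold N; ring.
Qed.

(** * From a homoclinic solution to its chain, and the conclusion *)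

Definition homoclinic_chain (u : R -> R) (i : nat) (s : R) : R :=
  match i with
  | 0%nat => u s
  | 1%nat => u s + Derive_n u 1 s
  | 2%nat => Derive_n u 2 s - u s
  | _ => Derive_n u 3 s - Derive_n u 1 s + Derive_n u 2 s - u s
  end.

Lemma homoclinic_chain_at (u : R -> R) (s : R) :
  is_solution u -> chain_at (homoclinic_chain u) (u s ^ 3) s.
Proof.
intros [Hd He].
assert (D : forall k, (k < 4)%nat -> is_derive (Derive_n u k) s (Derive_n u (S k) s)).
{ intros k Hk; apply Derive_correct; exact (Hd (S k) s ltac:(lia)). }
assert (D0 := D 0%nat ltac:(lia)); assert (D1 := D 1%nat ltac:(lia)).
assert (D2 := D 2%nat ltac:(lia)); assert (D3 := D 3%nat ltac:(lia)).
specialize (He s).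
change (Derive_n u 0) with u in D0.
unfold homoclinic_chain; revert D0 D1 D2 D3 He.
generalize (Derive_n u 1) (Derive_n u 2) (Derive_n u 3) (Derive_n u 4).
intros u1 u2 u3 u4 D0 D1 D2 D3 He.
split; [|split; [|split]]; der; lra.
Qed.

Lemma homoclinic_orbit (u : R -> R) : homoclinic u -> orbit (homoclinic_chain u).
Proof.
intros [Hs [_ Hl]].
assert (Hc : forall s, chain_at (homoclinic_chain u) (homoclinic_chain u 0 s ^ 3) s).
{ intros s; now apply homoclinic_chain_at. }
assert (L : forall k, (k < 4)%nat -> is_lim (Derive_n u k) p_infty 0 /\
  is_lim (fun s => Derive_n u k (- s)) p_infty 0).
{ intros k Hk; destruct (Hl k ltac:(lia)) as [L1 L2]; split; [easy|].
  apply (filterlim_comp _ _ _ Ropp (Derive_n u k) _ (Rbar_locally m_infty)).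
  - exact (filterlim_Rbar_opp p_infty).
  - exact L2. }
assert (Lc : forall (a b c d : R) (f0 f1 f2 f3 : R -> R),
  is_lim f0 p_infty 0 -> is_lim f1 p_infty 0 -> is_lim f2 p_infty 0 -> is_lim f3 p_infty 0 ->
  is_lim (fun s => a * f0 s + b * f1 s + c * f2 s + d * f3 s) p_infty 0).
{ intros a b c d f0 f1 f2 f3 H0 H1 H2 H3.
  assert (Hm : forall (k : R) f, is_lim f p_infty 0 -> is_lim (fun s => k * f s) p_infty 0).
  { intros k f Hf; replace (Finite 0) with (Rbar_mult k 0) by (simpl; now rewrite Rmult_0_r).
    now apply is_lim_scal_l. }
  replace (Finite 0) with (Finite (0 + 0 + 0 + 0)) by (f_equal; ring).
  repeat apply is_lim_plus'; now apply Hm. }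
destruct (L 0%nat ltac:(lia)) as [P0 M0]; destruct (L 1%nat ltac:(lia)) as [P1 M1].
destruct (L 2%nat ltac:(lia)) as [P2 M2]; destruct (L 3%nat ltac:(lia)) as [P3 M3].
split; [easy|split].
- apply homoclinic_chain_decays; [easy|].
  intros i Hi; destruct i as [|[|[|i]]].
  + exact P0.
  + eapply is_lim_ext; [|apply (Lc 1 1 0 0 _ _ _ _ P0 P1 P2 P3)].
    intros s; unfold homoclinic_chain; simpl; ring.
  + eapply is_lim_ext; [|apply (Lc (- 1) 0 1 0 _ _ _ _ P0 P1 P2 P3)].
    intros s; unfold homoclinic_chain; simpl; ring.
  + eapply is_lim_ext; [|apply (Lc (- 1) (- 1) 1 1 _ _ _ _ P0 P1 P2 P3)].
    intros s; unfold homoclinic_chain; simpl; ring.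
- apply homoclinic_chain_decays; [intros s; apply chain_reflect, Hc|].
  intros i Hi; destruct i as [|[|[|i]]].
  + exact M0.
  + eapply is_lim_ext; [|apply (Lc 1 (- 1) 0 0 _ _ _ _ M0 M1 M2 M3)].
    intros s; unfold homoclinic_chain, reflect; simpl; ring.
  + eapply is_lim_ext; [|apply (Lc (- 1) 0 1 0 _ _ _ _ M0 M1 M2 M3)].
    intros s; unfold homoclinic_chain, reflect; simpl; ring.
  + eapply is_lim_ext; [|apply (Lc (- 1) 1 1 (- 1) _ _ _ _ M0 M1 M2 M3)].
    intros s; unfold homoclinic_chain, reflect; simpl; ring.
Qed.

Lemma orbit_forward (y : nat -> R -> R) (x : R) : orbit y -> stable_manifold (point y x).
Proof.
intros Hy; exists (point (fun i s => y i (x + s))).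
replace (point y x) with (point (fun i s => y i (x + s)) 0)
  by (apply point_ext; intros; now rewrite Rplus_0_r).
apply forward_of_chain.
- intros s _; apply chain_shift, Hy.
- intros i Hi; apply (decays_shift x (y i)); now apply Hy.
Qed.

(** In chain coordinates [dE] is the linear form of [linear_energy], so decaying solutions provide
    vectors in its kernel. *)
Lemma energy_differential_chain (y p : nat -> R -> R) (x t : R) :
  energy_differential (point y x) (point p t) =
  (- (y 3%nat x - y 2%nat x) - y 2%nat x - y 0%nat x ^ 3) * p 0%nat t
  + (y 3%nat x - y 2%nat x) * p 1%nat t
  + (- (y 1%nat x - y 0%nat x) - y 2%nat x - y 0%nat x) * p 2%nat t
  + (y 1%nat x - y 0%nat x) * p 3%nat t.
Proof. unfold energy_differential, point, coord0, coord1, coord2, coord3; simpl; ring. Qed.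

Theorem mainTheorem2 (u : R -> R) (hu : homoclinic u) :
  forall x : R, transversal_in_zero_energy_at (orbit_point u x).
Proof.
intros x.
assert (Hy := homoclinic_orbit u hu).
assert (Hnz : exists s, homoclinic_chain u 0 s <> 0) by apply hu.
replace (orbit_point u x) with (point (homoclinic_chain u) x)
  by (unfold orbit_point, point, homoclinic_chain; apply R4_eq; ring).
set (y := homoclinic_chain u) in *; clearbody y; clear u hu.
assert (Hr := orbit_reflect y Hy).
assert (Hrev : point y x = reversal (point (reflect y) (- x)))
  by (rewrite point_reflect, reversal_involutive, Ropp_involutive; easy).
assert (HE : energy (point y x) = 0).
{ destruct (orbit_forward y x Hy) as [U HU]; now apply (energy_forward U). }
(* The energy level is regular at this point, since [u'] and [u''] do not vanish together. *)
assert (Hcrit : coord1 (point y x) <> 0 \/ coord2 (point y x) <> 0).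
{ unfold coord1, coord2, point; simpl.
  destruct (Req_dec (y 1%nat x - y 0%nat x) 0) as [H1|H1]; [right|now left].
  apply critical_second_derivative; [easy|now apply orbit_nonzero|lra]. }
split; [now apply orbit_forward|split; [|split; [exact HE|]]].
{ rewrite Hrev; destruct (orbit_forward (reflect y) (- x) Hr) as [U HU].
  exists (fun s => reversal (U (- s))); now apply reversal_backward. }
intros v; split.
- intros [vs [vu [Hs [Hu Hv]]]].
  (* Any [delta] serves here: lying in a disc already implies zero energy. *)
  destruct (Hs 1 Rlt_0_1) as [T [_ HTs]]; destruct (Hu 1 Rlt_0_1) as [T' [_ HTu]].
  assert (Ks : energy_differential (point y x) vs = 0).
  { apply energy_tangent_kernel; revert HTs; apply tangent_space_mono.
    intros p [U [HU _]]; now apply (energy_forward U). }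
  assert (Ku : energy_differential (point y x) vu = 0).
  { apply energy_tangent_kernel; revert HTu; apply tangent_space_mono.
    intros p [U [HU _]]; unfold zero_energy_set; rewrite <- energy_reversal.
    apply (energy_forward (fun s => reversal (U (- s)))); now apply reversal_forward. }
  apply energy_kernel_tangent; auto.
  rewrite Hv; revert Ks Ku; destruct vs as [[[s0 s1] s2] s3]; destruct vu as [[[u0 u1] u2] u3].
  unfold energy_differential, coord0, coord1, coord2, coord3; simpl; unfold plus; simpl; lra.
- intros Hv; apply energy_tangent_kernel in Hv.
  destruct (independent_directions y x Hy Hnz) as [f [g [Hf [Hg Hind]]]].
  (* The chain coordinates of [v]. *)
  set (n := fun i : nat => match i with
    | 0%nat => coord0 v | 1%nat => coord1 v + coord0 v | 2%nat => coord2 v - coord0 v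
    | _ => coord3 v + (coord2 v - coord0 v) - coord1 v end).
  assert (Hn : point (fun i _ => n i) 0 = v).
  { rewrite (R4_eta v); unfold point, n, coord0, coord1, coord2, coord3; simpl.
    apply R4_eq; ring. }
  (* The coefficients of [dE] in chain coordinates; entries 2 and 3 are [- (u' + u'')] and [u'], not
     both zero. *)
  set (l := fun i : nat => match i with
    | 0%nat => - (y 3%nat x - y 2%nat x) - y 2%nat x - y 0%nat x ^ 3
    | 1%nat => y 3%nat x - y 2%nat x
    | 2%nat => - (y 1%nat x - y 0%nat x) - y 2%nat x - y 0%nat x
    | _ => y 1%nat x - y 0%nat x end).
  assert (Hd := deriv_chain_solution y x Hy).
  destruct (span_of_kernel l (fun i => deriv_chain y i x) (fun i => f i x)
    (fun i => reflect g i x) n) as [k0 [k1 [k2 Hk]]].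
  + intros w [->|[->|[->| ->]]]; unfold l.
    * generalize (linear_energy y (deriv_chain y) x x Hy Hd (Rle_refl x)); lra.
    * generalize (linear_energy y f x x Hy Hf (Rle_refl x)); lra.
    * generalize (linear_energy (reflect y) g (- x) (- x) Hr Hg (Rle_refl (- x))).
      unfold reflect; rewrite Ropp_involutive; lra.
    * rewrite <- Hn, energy_differential_chain in Hv; lra.
  + unfold l; unfold coord1, coord2, point in Hcrit; simpl in Hcrit; lra.
  + exact Hind.
  (* The direction of [u'] is common to both tangent spaces and is counted on the stable side; the
     unstable part is the reversal of a stable direction of the reflected orbit. *)
  + exists (point (lincomb k0 k1 (deriv_chain y) f) x),
      (reversal (point (lincomb k2 0 g g) (- x))).
    split; [|split].
    * apply tangent_stable_of_solution; [easy|]; now apply linear_solution_lincomb.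
    * rewrite Hrev; apply tangent_unstable_reversal, tangent_stable_of_solution; [easy|].
      now apply linear_solution_lincomb.
    * rewrite <- Hn.
      assert (K0 := Hk 0%nat ltac:(lia)); assert (K1 := Hk 1%nat ltac:(lia)).
      assert (K2 := Hk 2%nat ltac:(lia)); assert (K3 := Hk 3%nat ltac:(lia)).
      unfold point, reversal, coord0, coord1, coord2, coord3; cbn [fst snd].
      apply R4_eq_plus; rewrite ?K0, ?K1, ?K2, ?K3; unfold lincomb, reflect; ring.
Qed.
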